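(* Let $k$ be a product formula field of characteristic $0$, $f\in k(z)$ a rational function of degree $>1$ and $a\in k(z)$ a rational function of degree $>0$. Then for every $v\in M_k$ and every chordal disk $D$ in $\mathbb{P}^1(\mathbb{C}_v)$ of radius $>0$, as $n\to\infty$, \[ \log\sup_{z\in D}[f^n(z),a(z)]_v=O\Big(\sqrt{n\cdot([f^n=a]\times[f^n=a])(\operatorname{diag})}\Big), \] where the implied constant may depend on $f$, $a$ (and $v$, $D$).
   Context: A product formula field is a field $k$ with places $M_k$, non-trivial absolute values $|\cdot|_v$, integers $N_v\in\mathbb{N}$ such that for $z\in k^*$, $|z|_v\neq1$ for finitely many $v$ and $\prod_v|z|_v^{N_v}=1$. $\mathbb{C}_v$ is the completion of an algebraic closure of $k_v$, with a fixed embedding $\overline{k}\hookrightarrow\mathbb{C}_v$. On $\mathbb{C}_v^2$, $\|\cdot\|_v$ is the max norm if $|\cdot|_v$ is non-archimedean and the Euclidean norm otherwise; the chordal metric on $\mathbb{P}^1(\mathbb{C}_v)$ is $[z,w]_v=|z_0w_1-z_1w_0|_v/(\|(z_0,z_1)\|_v\|(w_0,w_1)\|_v)$ for homogeneous coordinates $(z_0,z_1)$ of $z$ and $(w_0,w_1)$ of $w$. A chordal disk is a set $\{z\in\mathbb{P}^1(\mathbb{C}_v):[z,w]_v\le r\}$, $r\ge0$ its radius. For lifts $F=(F_0,F_1)$ of $f$ and $A$ of $a$ (homogeneous polynomial pairs over $k$ of degrees $\deg f,\deg a$ without common nontrivial zero inducing $f,a$ on $\mathbb{P}^1$), and $f^n\not\equiv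 a$, $[f^n=a]$ is the divisor of zeros in $\mathbb{P}^1(\overline{k})$, counted with multiplicity, of the homogeneous polynomial $F^n_0A_1-F^n_1A_0$; $([f^n=a]\times[f^n=a])(\operatorname{diag})=\sum_w(\operatorname{ord}_w[f^n=a])^2$. *)

(* Defs.v *)
From HB Require Import structures.
From mathcomp Require Export all_boot all_order all_algebra.
From mathcomp Require Export all_classical all_reals all_analysis.
(* The notations of mpoly clash with those of mathcomp-analysis. *)
From mathcomp Require Export -(notations) mpoly.

Set Implicit Arguments.
Unset Strict Implicit.
Unset Printing Implicit Defensive.

Import Order.TTheory GRing.Theory Num.Theory.

Open Scope classical_set_scope.
Open Scope ring_scope.



Section AbsoluteValues.
Variable R : realType.

Record absval (K : fieldType) := AbsVal {
  absv :> K -> R;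
  absv_ge0 : forall x, 0 <= absv x;
  absv_eq0 : forall x, absv x = 0 <-> x = 0;
  absvM : forall x y, absv (x * y) = absv x * absv y;
  absvD : forall x y, absv (x + y) <= absv x + absv y
}.

Definition absv_nontrivial (K : fieldType) (a : absval K) : Prop :=
  exists2 x : K, x != 0 & a x != 1.

Definition absv_nonarchimedean (K : fieldType) (a : absval K) : Prop :=
  forall x y, a (x + y) <= Num.max (a x) (a y).

Definition absv_equivalent (K : fieldType) (a b : absval K) : Prop :=
  exists2 s : R, 0 < s & forall x, b x = a x `^ s.

Definition absv_complete (K : fieldType) (a : absval K) : Prop :=
  forall u : nat -> K,
    (forall e : R, 0 < e -> exists N : nat, forall m n : nat,
       (N <= m)%N -> (N <= n)%N -> a (u m - u n) < e) ->
    exists l : K, forall e : R, 0 < e -> exists N : nat, forall n : nat,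
       (N <= n)%N -> a (u n - l) < e.

Definition absv_extends (K L : fieldType) (i : {rmorphism K -> L})
    (a : absval K) (b : absval L) : Prop :=
  forall x, b (i x) = a x.

Definition is_completion (K L : fieldType) (i : {rmorphism K -> L})
    (a : absval K) (b : absval L) : Prop :=
  [/\ absv_extends i a b,
      forall (y : L) (e : R), 0 < e -> exists x : K, b (y - i x) < e
    & absv_complete b].

End AbsoluteValues.

Definition is_algebraic_closure (K : fieldType) (L : closedFieldType)
    (i : {rmorphism K -> L}) : Prop :=
  forall y : L, algebraicOver i y.

(* A place is an equivalence class of absolute values, hence [pf_inj].  The
   [\big] below is the product over the finite set of places where the factor
   is not 1. *)
Record product_formula_structure (R : realType) (k : fieldType) := {
  pf_place : choiceType;
  pf_abs : pf_place -> absval R k;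
  pf_N : pf_place -> nat;
  pf_nontrivial : forall v, absv_nontrivial (pf_abs v);
  pf_inj : forall v w, absv_equivalent (pf_abs v) (pf_abs w) -> v = w;
  pf_N_gt0 : forall v, (0 < pf_N v)%N;
  pf_finite : forall z : k, z != 0 -> finite_set [set v | pf_abs v z != 1];
  pf_formula : forall z : k, z != 0 ->
    \big[*%R/1]_(v \in [set: pf_place]) pf_abs v z ^+ pf_N v = 1
}.

(* The tower k -> k_v -> closure of k_v -> C_v, together with an embedding into
   C_v, over k, of the algebraic closure kbar of k. *)
Record Cv_structure (R : realType) (k : fieldType) (kbar : closedFieldType)
    (i : {rmorphism k -> kbar}) (a : absval R k) := {
  kv : fieldType;
  kv_abs : absval R kv;
  kv_in : {rmorphism k -> kv};
  kv_completion : is_completion kv_in a kv_abs;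
  kvbar : closedFieldType;
  kvbar_abs : absval R kvbar;
  kvbar_in : {rmorphism kv -> kvbar};
  kvbar_closure : is_algebraic_closure kvbar_in;
  kvbar_extends : absv_extends kvbar_in kv_abs kvbar_abs;
  Cv :> fieldType;
  Cv_abs : absval R Cv;
  Cv_in : {rmorphism kvbar -> Cv};
  Cv_completion : is_completion Cv_in kvbar_abs Cv_abs;
  Cv_embed : {rmorphism kbar -> Cv};
  Cv_embed_compat : forall x : k, Cv_embed (i x) = Cv_in (kvbar_in (kv_in x))
}.

(* The projective line: [Some z] is [z : 1] and [None] is [1 : 0]. *)
Definition P1 (K : Type) : Type := option K.
HB.instance Definition _ (K : choiceType) := Choice.copy (P1 K) (option K).

Definition hcoord (K : fieldType) (z : P1 K) : K * K :=
  if z is Some x then (x, 1) else (1, 0).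

(* The point [x : y], for (x, y) <> (0, 0). *)
Definition hpoint (K : fieldType) (x y : K) : P1 K :=
  if y == 0 then None else Some (x / y).

Section Chordal.
Variables (R : realType) (K : fieldType) (a : absval R K).

Definition norm2 (p : K * K) : R :=
  if `[< absv_nonarchimedean a >] then Num.max (a p.1) (a p.2)
  else Num.sqrt (a p.1 ^+ 2 + a p.2 ^+ 2).

Definition chordal (z w : P1 K) : R :=
  a ((hcoord z).1 * (hcoord w).2 - (hcoord z).2 * (hcoord w).1)
    / (norm2 (hcoord z) * norm2 (hcoord w)).

Definition chordal_disk (w : P1 K) (r : R) : set (P1 K) :=
  [set z | chordal z w <= r].

End Chordal.

Definition ratfun_degree (k : fieldType) (f : {fraction {poly k}}) : nat :=
  let p := (frac (repr f)).1 in
  let q := (frac (repr f)).2 in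
  (maxn (size (p %/ gcdp p q)) (size (q %/ gcdp p q))).-1.

(* The value p(x, y), the coefficients of p being mapped by g. *)
Definition bieval (k S : nzRingType) (g : k -> S) (p : mpoly 2 k) (x y : S) : S :=
  mmap g (tnth [tuple x; y]) p.

Section Lifts.
Variables (k : fieldType) (kbar : closedFieldType) (i : {rmorphism k -> kbar}).

(* F is a lift of f; the last clause is f(z) = F_0(z, 1) / F_1(z, 1) in k(z). *)
Definition is_lift (f : {fraction {poly k}}) (F : mpoly 2 k * mpoly 2 k) : Prop :=
  [/\ F.1 \is ishomog1 (ratfun_degree f) mdeg,
      F.2 \is ishomog1 (ratfun_degree f) mdeg,
      forall x y : kbar, bieval i F.1 x y = 0 -> bieval i F.2 x y = 0 ->
        x = 0 /\ y = 0
    & tofrac (bieval polyC F.1 'X 1) = f * tofrac (bieval polyC F.2 'X 1)].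

Definition lift_comp (F G : mpoly 2 k * mpoly 2 k) : mpoly 2 k * mpoly 2 k :=
  (comp_mpoly [tuple G.1; G.2] F.1, comp_mpoly [tuple G.1; G.2] F.2).

Definition lift_iter (n : nat) (F : mpoly 2 k * mpoly 2 k) :
    mpoly 2 k * mpoly 2 k :=
  iter n (lift_comp F) (mpolyX k (mnm1 ord0), mpolyX k (mnm1 ord_max)).

(* The order of vanishing of a nonzero form H at w, computed in the affine chart
   [X : 1] for finite w and [1 : X] for w = [1 : 0]. *)
Definition form_ord (H : mpoly 2 k) (w : P1 kbar) : nat :=
  if w is Some x then mup x (bieval (polyC \o i) H 'X 1)
  else mup 0 (bieval (polyC \o i) H 1 'X).

(* The divisor [f^n = a]. *)
Definition coincidence_divisor (F A : mpoly 2 k * mpoly 2 k) (n : nat) :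
    P1 kbar -> nat :=
  form_ord ((lift_iter n F).1 * A.2 - (lift_iter n F).2 * A.1).

(* (E x E)(diag), for an effective divisor E (of finite support). *)
Definition diag_mass (E : P1 kbar -> nat) : nat :=
  (\sum_(w \in [set: P1 kbar]) (E w ^ 2)%N)%R.

End Lifts.

(* The action on P^1(K) of the rational function with lift F. *)
Definition P1_map (k K : fieldType) (j : k -> K) (F : mpoly 2 k * mpoly 2 k)
    (z : P1 K) : P1 K :=
  hpoint (bieval j F.1 (hcoord z).1 (hcoord z).2)
         (bieval j F.2 (hcoord z).1 (hcoord z).2).

(* Main.v *)
(** Write M = d^n, H = F^n_0 A_1 - F^n_1 A_0, a form of degree N = M + deg a,
    and let m_w be the multiplicity of its zero w, so that the diagonal mass is
    the sum of the m_w^2.  Let K_w be the coefficient of order m_w of the Taylor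
    expansion of H at w, and theta_w the factor with F^n(w) = theta_w A(w).  The
    products Delta = prod K_w^(m_w) and Theta = prod theta_w^(m_w) are symmetric
    in the zeros, hence lie in k.  At every place u, Taylor estimates for the
    iterates give |Delta|^(M - deg a) <= |Theta|^N C_u^(O(n diag (M - deg a))),
    with C_u = 1 for almost all u, and the product formula turns this into the
    reverse inequality at v.

    Suppose that |H| <= E |F^n| at t = d^j points p_l of the disk which are
    separated from each other and from the zeros of H by C^(-n).  Let
    U_l = prod_{l' <> l} (X - p_l') S_l, where S_l is the power of the larger
    coordinate of F^j at p_l that gives U_l degree less than N.  Let a matrix
    have as rows the U_l and the quotients of H by powers of X - w, and as
    columns the jets at the w; expanding its bordered determinant bounds |Delta|
    from above by E^t C^(O(n diag + t^2)).  Together with the lower bound for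
    Delta this yields E^t C^(n diag + t^2) >= 1.  Choosing t of the order of
    sqrt(n diag) gives log E >= - O(sqrt(n diag)).  When n diag exceeds M^2 the
    elementary bound log E >= - O(M), by Lagrange interpolation and Liouville's
    inequality for a coefficient of H, is enough.

    The points p_l are the roots of (X - c)^t = u pi^t, where the integer u is
    chosen by the pigeonhole principle. *)

Require Import Defs.
From mathcomp Require Import fingroup perm separable ring lra zify.
Set Implicit Arguments.
Unset Strict Implicit.
Unset Printing Implicit Defensive.
Import Order.TTheory GRing.Theory Num.Theory.
Open Scope classical_set_scope.
Open Scope ring_scope.

(** * Absolute values *)

(** The exponents M - deg a and N come from homogeneity: scaling the coordinates of w by s
    multiplies theta_w by s^(M - deg a) and |F^n(w)| |A(w)| by |s|^N. So (|F^n(w)| |A(w)|)^(M - deg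
    a) is bounded by |theta_w|^N up to constants, wherever w lies. The rows of the determinant at w
    carry the weight |F^n(w)| |A(w)|, which may be arbitrarily large; but the product of the weights
    is bounded through Theta, hence through Delta by the reverse inequality at v, and Delta then
    cancels from both sides. The factor n arises because each iteration multiplies a relative error
    by C: Taylor estimates for F^n hold at radius C^(-n), which costs C^(n m_w^2) at a zero w.
    Building S_l from F^j makes U_l comparable with F^n, above at every zero and below at p_l, with
    a loss of only C^O(t + d^(n-j)); t points lose C^O(t^2 + d^n). Characteristic 0 enters through
    the integers: 2 is nonzero, so almost all places are ultrametric; X^t - u is separable; nonzero
    integers are bounded below by Liouville's inequality. *)

Section PowerGrowth.
Variable R : realType.

(** Bernoulli's inequality raised to the power [k.+1]: along [n = m * k.+1] the left side grows like
    [m ^ k], the right side at least like [m ^ k.+1]. *)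
Lemma expr_growth (q C : R) k : 1 < q -> exists n, C * n.+1%:R ^+ k < q ^+ n.
Proof.
move=> q1.
have [h h0 qE] : exists2 h, 0 < h & q = 1 + h.
  by exists (q - 1); [rewrite subr_gt0 | rewrite addrC subrK].
have bern m : 1 + m%:R * h <= q ^+ m.
  elim: m => [|m IH]; first by rewrite mul0r addr0 expr0.
  rewrite exprS; apply: le_trans (ler_wpM2l _ IH); last by rewrite qE; lra.
  rewrite -natr1 qE.
  have : 0 <= m%:R * h * h by rewrite !mulr_ge0 // ltW.
  lra.
pose D := `|C| * (k.+2%:R) ^+ k.
have D0 : 0 <= D by rewrite mulr_ge0 // exprn_ge0.
pose m := (Num.truncn (D / h ^+ k.+1)).+1.
exists (m * k.+1)%N.
have mD : D < m%:R * h ^+ k.+1.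
  by rewrite -ltr_pdivrMr ?exprn_gt0 // /m; apply: truncnS_gt.
apply: (@le_lt_trans _ _ (D * m%:R ^+ k)).
  apply: (@le_trans _ _ (`|C| * (m * k.+1).+1%:R ^+ k)).
    by rewrite ler_wpM2r ?exprn_ge0 // ler_norm.
  rewrite /D -mulrA ler_wpM2l // -exprMn lerXn2r ?nnegrE ?mulr_ge0 //.
  by rewrite -natrM ler_nat /m; nia.
rewrite exprM; apply: (@lt_le_trans _ _ ((m%:R * h) ^+ k.+1)).
  rewrite exprMn exprS mulrAC mulrC [ltRHS]mulrC ltr_pM2l //.
  by rewrite exprn_gt0 // ltr0n.
rewrite lerXn2r ?nnegrE ?mulr_ge0 ?exprn_ge0 //; [exact: ltW| lra|].
by apply: le_trans (bern m); rewrite lerDr.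
Qed.

(** Otherwise [(x / y) ^+ n] would grow exponentially, against [expr_growth]. This is how n-th roots
    are taken to discard polynomial factors. *)
Lemma ler_of_expr (x y C : R) k : 0 <= x -> 0 <= y ->
  (forall n, x ^+ n <= C * n.+1%:R ^+ k * y ^+ n) -> x <= y.
Proof.
move=> x0 y0 H; rewrite leNgt; apply/negP => yx.
have [y_gt|y_le] := ltP 0 y.
  have q1 : 1 < x / y by rewrite ltr_pdivlMr // mul1r.
  have [n] := expr_growth C k q1.
  apply/negP.
  by rewrite -leNgt expr_div_n ler_pdivrMr ?exprn_gt0.
have yE : y = 0 by apply/eqP; rewrite eq_le y_le.
by move: (H 1%N); rewrite yE !expr1 mulr0 leNgt -{1}yE yx.
Qed.

End PowerGrowth.

Section AbsvalBasics.
Variables (R : realType) (K : fieldType) (a : absval R K).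

Lemma absv0 : a 0 = 0. Proof. exact/absv_eq0. Qed.

Lemma absv_neq0 x : x != 0 -> a x != 0.
Proof. by apply: contra => /eqP /absv_eq0 ->. Qed.

Lemma absv_gt0 x : x != 0 -> 0 < a x.
Proof. by move=> x0; rewrite lt_def absv_neq0 // absv_ge0. Qed.

Lemma absv1 : a 1 = 1.
Proof.
apply: (@mulfI _ (a 1)); first by apply: absv_neq0; exact: oner_neq0.
by rewrite -absvM !mulr1.
Qed.

Lemma absvX x n : a (x ^+ n) = a x ^+ n.
Proof. by elim: n => [|n IH]; rewrite ?expr0 ?absv1 // !exprS absvM IH. Qed.

Lemma absvN1 : a (-1) = 1.
Proof.
apply/eqP; rewrite -(@eqrXn2 _ 2) ?absv_ge0 //.
by rewrite -absvX sqrrN !expr1n absv1.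
Qed.

Lemma absvN x : a (- x) = a x.
Proof. by rewrite -mulN1r absvM absvN1 mul1r. Qed.

Lemma absvB x y : a (x - y) = a (y - x).
Proof. by rewrite -absvN opprB. Qed.

Lemma absvV x : a x^-1 = (a x)^-1.
Proof.
have [->|x0] := eqVneq x 0; first by rewrite invr0 absv0 invr0.
apply: (@mulfI _ (a x)); first exact: absv_neq0.
by rewrite -absvM !divff ?absv1 // absv_neq0.
Qed.

Lemma absv_prod (I : Type) (s : seq I) (P : pred I) (f : I -> K) :
  a (\prod_(i <- s | P i) f i) = \prod_(i <- s | P i) a (f i).
Proof. by elim/big_rec2: _ => [|i x y _ <-]; [exact: absv1|exact: absvM]. Qed.

Lemma absv_sum (I : Type) (s : seq I) (P : pred I) (f : I -> K) :
  a (\sum_(i <- s | P i) f i) <= \sum_(i <- s | P i) a (f i).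
Proof.
elim/big_rec2: _ => [|i x y _ H]; first by rewrite absv0.
by apply: le_trans (absvD _ _ _) _; rewrite lerD2l.
Qed.

Lemma absv_nat n : a n%:R <= n%:R.
Proof.
elim: n => [|n IH]; first by rewrite absv0.
by rewrite -!natr1 (le_trans (absvD _ _ _)) // absv1 lerD2r.
Qed.

(* The binary expansion bounds [a n%:R] logarithmically; take n-th roots in
   the binomial expansion of [(x + y) ^+ n]. *)
Lemma nonarchimedean_le2 : a 2%:R <= 1 -> absv_nonarchimedean a.
Proof.
move=> a2.
have nat_le m n : (n < 2 ^ m)%N -> a n%:R <= m%:R.
  elim: m n => [|m IH] n; first by rewrite expn0 ltnS leqn0 => /eqP ->; rewrite absv0.
  move=> nm; rewrite -[n in n%:R]odd_double_half natrD -mul2n natrM.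
  apply: le_trans (absvD _ _ _) _; rewrite -[m.+1%:R]nat1r; apply: lerD.
    by case: (odd n); rewrite ?absv1 ?absv0.
  rewrite absvM; apply: le_trans (IH n./2 _); first by rewrite ler_piMl ?absv_ge0.
  by rewrite expnS in nm; have := odd_double_half n; lia.
move=> x y; set M := Num.max _ _.
have M0 : 0 <= M by rewrite le_max absv_ge0.
apply: (@ler_of_expr _ _ _ 1 2) => //; first exact: absv_ge0.
move=> n; rewrite mul1r -absvX exprDn; apply: le_trans (absv_sum _ _ _) _.
apply: (@le_trans _ _ (\sum_(i < n.+1) n.+1%:R * M ^+ n)).
  apply: ler_sum => i _.
  rewrite -mulr_natl !absvM !absvX; apply: ler_pM; rewrite ?mulr_ge0 ?exprn_ge0 ?absv_ge0 //.
    apply: nat_le; rewrite expnS.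
    have : ('C(n, i) <= 2 ^ n)%N.
      have -> : (2 ^ n = (1 + 1) ^ n)%N by [].
      rewrite expnDn (bigD1 i) //= !exp1n !muln1; exact: leq_addr.
    have : (0 < 2 ^ n)%N by rewrite expn_gt0.
    lia.
  have -> : M ^+ n = M ^+ (n - i) * M ^+ i by rewrite -exprD subnK // -ltnS.
  by apply: ler_pM; rewrite ?exprn_ge0 ?absv_ge0 // lerXn2r ?nnegrE ?absv_ge0 // le_max lexx ?orbT.
by rewrite sumr_const card_ord -[leLHS]mulr_natl mulrA expr2.
Qed.

(** Writing the triangle inequality with a maximum treats both kinds of places alike. The constant
    is 1 at ultrametric places, so its powers may enter the adelic constants [C_u]. *)
Definition kap : R := if `[< absv_nonarchimedean a >] then 1 else 2.

Lemma kap_ge1 : 1 <= kap. Proof. by rewrite /kap; case: ifP => // _; rewrite ler1n. Qed.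

Lemma kap_le2 : kap <= 2. Proof. by rewrite /kap; case: ifP => // _; rewrite ler1n. Qed.

Lemma absvD_kap x y : a (x + y) <= kap * Num.max (a x) (a y).
Proof.
rewrite /kap; case: asboolP => na; first by rewrite mul1r.
apply: le_trans (absvD _ _ _) _; rewrite mulr_natl mulr2n.
by apply: lerD; rewrite le_max lexx ?orbT.
Qed.

End AbsvalBasics.

(** * Extension of absolute values to algebraic extensions *)

Lemma sum_enum_val (T : nmodType) (I : finType) (f : I -> T) :
  \sum_l f l = \sum_(q < #|I|) f (enum_val q).
Proof. by rewrite -big_enum_val; apply: eq_bigl => l; rewrite inE. Qed.

Section Extension.
Variables (R : realType) (K L : fieldType) (i : {rmorphism K -> L}).
Variable a : absval R K.
Hypothesis alg : forall y : L, algebraicOver i y.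

(* [x] is an eigenvalue of a matrix over [K] whose row sums are at most [r]. *)
Definition eigenbound (x : L) (r : R) : Prop :=
  exists (I : finType) (M : I -> I -> K) (u : I -> L),
    [/\ exists j, u j != 0,
        forall j, \sum_l i (M j l) * u l = x * u j
      & forall j, \sum_l a (M j l) <= r].

Lemma eigenbound_ge0 x r : eigenbound x r -> 0 <= r.
Proof.
move=> [I [M [u [[j _] _ H]]]]; apply: le_trans (H j).
by apply: sumr_ge0 => l _; exact: absv_ge0.
Qed.

(** Tensor product of the matrices and of the eigenvectors: eigenvalues multiply, and so do row
    sums. *)
Lemma eigenboundM x y r s :
  eigenbound x r -> eigenbound y s -> eigenbound (x * y) (r * s).
Proof.
move=> H1 H2; have r0 := eigenbound_ge0 H1; have s0 := eigenbound_ge0 H2.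
move: H1 H2 => [I [M [u [[j uj] Mu Mr]]]] [J [N [v [[l vl] Nv Ns]]]].
exists (I * J)%type, (fun p q => M p.1 q.1 * N p.2 q.2), (fun p => u p.1 * v p.2).
split=> [|p|p].
- by exists (j, l); rewrite mulf_neq0.
- transitivity (\sum_l \sum_m (i (M p.1 l) * u l) * (i (N p.2 m) * v m)).
    rewrite pair_bigA /=; apply: eq_bigr => q _; rewrite rmorphM; ring.
  under eq_bigr do rewrite -mulr_sumr Nv.
  by rewrite -mulr_suml Mu; ring.
- apply: (@le_trans _ _ (\sum_l \sum_m a (M p.1 l) * a (N p.2 m))).
    by rewrite pair_bigA /=; apply: ler_sum => q _; rewrite absvM.
  under eq_bigr do rewrite -mulr_sumr.
  rewrite -mulr_suml; apply: ler_pM => //; apply: sumr_ge0 => ? _; exact: absv_ge0.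
Qed.

(** The Kronecker sum of the two matrices acts on the tensor product of the eigenvectors by
    [x + y]. *)
Lemma eigenboundD x y r s :
  eigenbound x r -> eigenbound y s -> eigenbound (x + y) (r + s).
Proof.
move=> [I [M [u [[j uj] Mu Mr]]]] [J [N [v [[l vl] Nv Ns]]]].
have sumd (T : nmodType) (A : finType) (p : A) (f : A -> T) :
    \sum_q (if p == q then f q else 0) = f p.
  by rewrite -big_mkcond (big_pred1 p) // => q; rewrite eq_sym.
exists (I * J)%type, (fun p q => (if p.2 == q.2 then M p.1 q.1 else 0) +
  (if p.1 == q.1 then N p.2 q.2 else 0)), (fun p => u p.1 * v p.2).
split=> [|p|p].
- by exists (j, l); rewrite mulf_neq0.
- transitivity (\sum_l \sum_m (if p.2 == m then (i (M p.1 l) * u l) * v m else 0)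
     + \sum_m \sum_l (if p.1 == l then (i (N p.2 m) * v m) * u l else 0)).
    rewrite [X in _ + X]exchange_big /= -big_split /=.
    under [RHS]eq_bigr do rewrite -big_split.
    rewrite pair_bigA /=; apply: eq_bigr => q _; rewrite rmorphD.
    by do 2 case: eqP => _; rewrite ?rmorph0; ring.
  under eq_bigr do rewrite sumd.
  under [X in _ + X]eq_bigr do rewrite sumd.
  by rewrite -!mulr_suml Mu Nv; ring.
- apply: (@le_trans _ _ (\sum_l \sum_m (if p.2 == m then a (M p.1 l) else 0)
     + \sum_m \sum_l (if p.1 == l then a (N p.2 m) else 0))).
    rewrite [X in _ + X]exchange_big /= -big_split /=.
    under [leRHS]eq_bigr do rewrite -big_split.
    rewrite pair_bigA /=; apply: ler_sum => q _; apply: le_trans (absvD _ _ _) _.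
    by apply: lerD; case: eqP => _; rewrite ?absv0.
  under eq_bigr do rewrite sumd.
  under [X in _ + X]eq_bigr do rewrite sumd.
  exact: lerD.
Qed.

Lemma eigenbound_base c : eigenbound (i c) (a c).
Proof.
exists unit, (fun _ _ => c), (fun=> 1); split=> [|_|_].
- by exists tt; exact: oner_neq0.
- by rewrite (big_pred1 tt) // => -[].
- by rewrite (big_pred1 tt) // => -[].
Qed.

(** For the eigenvalue 1 the eigenvector equation has coefficients in [K], hence a nonzero solution
    over [K], where [a] is available. At its coordinate of largest absolute value the row sum must
    be at least 1. *)
Lemma eigenbound1 r : eigenbound 1 r -> 1 <= r.
Proof.
move=> [I [M [u [[j uj] Mu Mr]]]].
pose A : 'M[K]_#|I| := \matrix_(p, q) M (enum_val q) (enum_val p) - 1%:M.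
have detA : \det A = 0.
  apply: (fmorph_inj i); rewrite rmorph0 -det_map_mx; apply/eqP/det0P.
  exists (\row_p u (enum_val p)).
    apply/eqP => /rowP /(_ (enum_rank j)); rewrite !mxE enum_rankK => /eqP.
    by rewrite (negbTE uj).
  apply/rowP => p; rewrite !mxE.
  under eq_bigr do rewrite !mxE rmorphB mulrBr.
  rewrite sumrB; apply/eqP; rewrite subr_eq0; apply/eqP.
  transitivity (u (enum_val p)).
    rewrite -[RHS]mul1r -Mu [RHS]sum_enum_val.
    by apply: eq_bigr => q _; rewrite mulrC.
  rewrite (bigD1 p) //= eqxx rmorph1 mulr1 big1 ?addr0 // => q /negbTE qp.
  by rewrite qp rmorph0 mulr0.
move/eqP/det0P: detA => [w w0 wA].
have wE q : w 0 q = \sum_p M (enum_val q) (enum_val p) * w 0 p.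
  move/rowP: wA => /(_ q); rewrite !mxE.
  under eq_bigr do rewrite !mxE mulrBr.
  rewrite sumrB => /eqP; rewrite subr_eq0 => /eqP.
  rewrite [X in _ = X](bigD1 q) //= eqxx mulr1 [X in _ = _ + X]big1 ?addr0 => [<-|p /negbTE ->]; last by rewrite mulr0.
  by apply: eq_bigr => p _; rewrite mulrC.
have [q0 wq0] : exists q, w 0 q != 0.
  by apply/existsP; apply: contraNT w0 => /existsPn H; apply/eqP/rowP => q; rewrite mxE; apply/eqP; move: (H q); rewrite negbK.
pose q := [arg max_(q > q0) a (w 0 q)]%O.
have qmax p : a (w 0 p) <= a (w 0 q).
  by rewrite /q; case: arg_maxP => // p' _ H; exact: H.
have wq_gt : 0 < a (w 0 q) by apply: lt_le_trans (qmax q0); exact: absv_gt0.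
rewrite -(ler_pM2r wq_gt) mul1r {1}wE; apply: le_trans (absv_sum _ _ _ _) _.
apply: (@le_trans _ _ (\sum_p a (M (enum_val q) (enum_val p)) * a (w 0 q))).
  by apply: ler_sum => p _; rewrite absvM ler_wpM2l ?absv_ge0.
rewrite -mulr_suml ler_wpM2r ?absv_ge0 //; apply: le_trans (Mr (enum_val q)).
by rewrite [leRHS]sum_enum_val.
Qed.

(** Companion matrix of a polynomial vanishing at [x], with the powers of [x] as eigenvector. *)
Lemma eigenbound_exists x : exists r, eigenbound x r.
Proof.
have [q q0 qx] := alg x.
have sq : (1 < size q)%N.
  rewrite -(size_map_poly i); apply: root_size_gt1 qx; by rewrite map_poly_eq0.
pose n := (size q).-2.
have sqE : size q = n.+2 by rewrite /n; lia.
have lq0 : q`_n.+1 != 0 by have : lead_coef q != 0; [rewrite lead_coef_eq0 | rewrite lead_coefE sqE].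
pose M (j l : 'I_n.+1) : K := if (j == n :> nat) then - q`_l / q`_n.+1
  else (l == j.+1 :> nat)%:R.
exists (\sum_j \sum_l a (M j l)), 'I_n.+1, M, (fun l : 'I_n.+1 => x ^+ l); split.
- by exists ord0; rewrite expr0 oner_neq0.
- move=> j; rewrite -exprS /M; case: eqP => jn.
    move: qx; rewrite /root horner_coef size_map_poly sqE big_ord_recr /=.
    rewrite addrC addr_eq0 coef_map => /eqP H.
    have iq0 : i q`_n.+1 != 0 by rewrite fmorph_eq0.
    apply: (mulfI iq0); rewrite jn H mulr_sumr -sumrN; apply: eq_bigr => l _.
    rewrite coef_map fmorph_div rmorphN; field.
    exact: iq0.
  have jn' : (j.+1 < n.+1)%N by have := ltn_ord j; move/eqP: jn; lia.
  rewrite (bigD1 (Ordinal jn')) //= eqxx rmorph1 mul1r big1 ?addr0 // => l lj.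
  by case: eqP => [E|]; [case/eqP: lj; apply: val_inj | rewrite rmorph0 mul0r].
- move=> j; rewrite [leRHS](bigD1 j) //= lerDl; apply: sumr_ge0 => j' _.
  by apply: sumr_ge0 => ? _; exact: absv_ge0.
Qed.

(** [subnorm_ge1] excludes the zero function. On [K] only an inequality is imposed, which passes to
    infima; minimal elements turn out to be multiplicative and to extend [a] exactly. *)
Record subnorm (p : L -> R) : Prop := Subnorm {
  subnorm_ge0 : forall x, 0 <= p x;
  subnorm_ge1 : 1 <= p 1;
  subnormD : forall x y, p (x + y) <= p x + p y;
  subnormM : forall x y, p (x * y) <= p x * p y;
  subnorm_base : forall c, p (i c) <= a c
}.

Lemma inf_ler (S : set R) x : (forall z, S z -> 0 <= z) -> S x -> inf S <= x.
Proof. by move=> S0 Sx; apply: ge_inf => //; exists 0 => z /S0. Qed.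

Lemma ler_infD (A B : set R) r : A !=set0 -> B !=set0 ->
  (forall x y, A x -> B y -> r <= x + y) -> r <= inf A + inf B.
Proof.
move=> A0 B0 H; rewrite -lerBlDl; apply: lb_le_inf => // y By.
rewrite lerBlDl -lerBlDr; apply: lb_le_inf => // x Ax.
by rewrite lerBlDr; apply: H.
Qed.

Lemma ler_infM (A B : set R) r : A !=set0 -> B !=set0 ->
  (forall x, A x -> 0 <= x) -> (forall y, B y -> 0 <= y) ->
  (forall x y, A x -> B y -> r <= x * y) -> r <= inf A * inf B.
Proof.
move=> A0 B0 Ap Bp H.
have infA : 0 <= inf A by apply: lb_le_inf.
have H1 y : B y -> r <= inf A * y.
  move=> By; have [E|yN] := eqVneq y 0.
    by case: A0 => x Ax; rewrite E mulr0 -(mulr0 x) -E; apply: H.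
  have y0 : 0 < y by rewrite lt_def yN Bp.
  by rewrite -ler_pdivrMr //; apply: lb_le_inf => // x Ax; rewrite ler_pdivrMr //; exact: H.
have [E|AN] := eqVneq (inf A) 0.
  by case: B0 => y By; rewrite E mul0r -(mul0r y) -E; apply: H1.
have Agt : 0 < inf A by rewrite lt_def AN.
rewrite mulrC -ler_pdivrMr //; apply: lb_le_inf => // y By.
by rewrite ler_pdivrMr // mulrC; exact: H1.
Qed.

Lemma subnorm_exists : exists p, subnorm p.
Proof.
pose S x := [set r | eigenbound x r].
have S0 x : S x !=set0 by have [r] := eigenbound_exists x; exists r.
have Sp x z : S x z -> 0 <= z by exact: eigenbound_ge0.
exists (fun x => inf (S x)); split=> [x||x y|x y|c].
- by apply: lb_le_inf => // z /Sp.
- by apply: lb_le_inf => // z /eigenbound1.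
- by apply: ler_infD => // r s Hr Hs; apply: inf_ler; [exact: Sp | exact: eigenboundD].
- apply: ler_infM; [exact: S0|exact: S0|exact: Sp|exact: Sp|] => r s Hr Hs.
  by apply: inf_ler; [exact: Sp | exact: eigenboundM].
- by apply: inf_ler; [exact: Sp | exact: eigenbound_base].
Qed.

(** Zorn's lemma for the reversed order. The infimum of a chain is again a subnorm because the
    smaller of two members bounds the values of both. *)
Lemma subnorm_minimal : exists2 p, subnorm p &
  forall q, subnorm q -> (forall x, q x <= p x) -> q = p.
Proof.
have [p0 sp0] := subnorm_exists.
pose T := {p : L -> R | subnorm p}.
pose le (p q : T) : bool := `[< forall x, sval q x <= sval p x >].
have [||p q pq qp|C totC|p Hp] := @Zorn T le.
- by move=> p; apply/asboolP.
- by move=> q p s /asboolP H1 /asboolP H2; apply/asboolP => x; apply: le_trans (H2 x) (H1 x).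
- case: p q pq qp => [p sp] [q sq] /asboolP /= pq /asboolP /= qp.
  have E : p = q by apply/funext => x; apply/eqP; rewrite eq_le pq qp.
  by move: sp; rewrite E => sp; congr exist; exact: Prop_irrelevance.
- have [[q Cq]|C0] := pselect (C !=set0); last first.
    by exists (exist _ p0 sp0) => s Cs; case: C0; exists s.
  pose S x := [set r | exists2 s : T, C s & r = sval s x].
  have S0 x : S x !=set0 by exists (sval q x), q.
  have Sp x z : S x z -> 0 <= z by move=> [s _ ->]; apply: subnorm_ge0; exact: (svalP s).
  have sq : subnorm (fun x => inf (S x)).
    have dom x y r s : S x r -> S y s ->
        exists2 t : T, C t & sval t x <= r /\ sval t y <= s.
      move=> [t1 C1 ->] [t2 C2 ->]; case: (totC _ _ C1 C2) => /asboolP H.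
        by exists t2.
      by exists t1.
    split=> [x||x y|x y|c].
    + by apply: lb_le_inf => // z /Sp.
    + by apply: lb_le_inf => // z [s _ ->]; apply: subnorm_ge1; exact: (svalP s).
    + apply: ler_infD => // r s Hr Hs; have [t Ct [H1 H2]] := dom _ _ _ _ Hr Hs.
      apply: (@le_trans _ _ (sval t (x + y))); first by apply: inf_ler; [exact: Sp|exists t].
      by apply: le_trans (subnormD (svalP t) _ _) _; exact: lerD.
    + apply: ler_infM; [exact: S0|exact: S0|exact: Sp|exact: Sp|] => r s Hr Hs.
      have [t Ct [H1 H2]] := dom _ _ _ _ Hr Hs.
      apply: (@le_trans _ _ (sval t (x * y))); first by apply: inf_ler; [exact: Sp|exists t].
      apply: le_trans (subnormM (svalP t) _ _) _.
      by apply: ler_pM => //; apply: subnorm_ge0; exact: (svalP t).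
    + apply: (@le_trans _ _ (sval q (i c))); first by apply: inf_ler; [exact: Sp|exists q].
      exact: (subnorm_base (svalP q)).
  exists (exist _ _ sq) => s Cs; apply/asboolP => x /=.
  by apply: inf_ler; [exact: Sp | exists s].
- exists (sval p); first exact: (svalP p).
  move=> q sq qp; have /(Hp (exist _ q sq)) /(congr1 sval) //= : le p (exist _ q sq).
  exact/asboolP.
Qed.

Lemma subnorm1 p : subnorm p -> p 1 = 1.
Proof.
move=> sp; apply/eqP; rewrite eq_le (subnorm_ge1 sp) andbT.
by have := subnorm_base sp 1; rewrite rmorph1 absv1.
Qed.

Lemma subnorm_gt0 p x : subnorm p -> x != 0 -> 0 < p x.
Proof.
move=> sp x0; rewrite lt_def (subnorm_ge0 sp) andbT; apply/eqP => px.
have : p 1 <= p x * p x^-1 by rewrite -{1}(divff x0) (subnormM sp).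
by rewrite px mul0r leNgt (lt_le_trans ltr01 (subnorm_ge1 sp)).
Qed.

Lemma subnorm0 p : subnorm p -> p 0 = 0.
Proof.
move=> sp; apply/eqP; rewrite eq_le (subnorm_ge0 sp) andbT.
by have := subnorm_base sp 0; rewrite rmorph0 absv0.
Qed.

Lemma subnormX_le p x n : subnorm p -> p (x ^+ n) <= p x ^+ n.
Proof.
move=> sp; elim: n => [|n IH]; first by rewrite !expr0 subnorm1.
rewrite !exprS; apply: le_trans (subnormM sp _ _) _.
by rewrite ler_wpM2l // (subnorm_ge0 sp).
Qed.

Lemma subnorm_sum p (I : Type) (s : seq I) (P : pred I) (f : I -> L) : subnorm p ->
  p (\sum_(j <- s | P j) f j) <= \sum_(j <- s | P j) p (f j).
Proof.
move=> sp; elim/big_rec2: _ => [|j x y _ H]; first by rewrite subnorm0.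
by apply: le_trans (subnormD sp _ _) _; rewrite lerD2l.
Qed.

Lemma subnormMn p x n : subnorm p -> p (x *+ n) <= p x *+ n.
Proof.
move=> sp; elim: n => [|n IH]; first by rewrite !mulr0n subnorm0.
by rewrite !mulrS; apply: le_trans (subnormD sp _ _) _; rewrite lerD2l.
Qed.

Section Minimal.
Variable p : L -> R.
Hypothesis sp : subnorm p.
Hypothesis minp : forall q, subnorm q -> (forall x, q x <= p x) -> q = p.

(* The spectral radius is again a subnorm, so [p] equals it. *)
Lemma minimal_sqr x : p x ^+ 2 <= p (x ^+ 2).
Proof.
pose S x := [set r | 0 < r /\ exists C, forall n, p (x ^+ n) <= C * r ^+ n].
have Sp y z : S y z -> 0 <= z by move=> [/ltW].
have Sgt y r : p y < r -> S y r.
  move=> yr; split; first exact: le_lt_trans (subnorm_ge0 sp y) yr.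
  exists 1 => n; rewrite mul1r; apply: le_trans (subnormX_le _ _ sp) _.
  by rewrite lerXn2r ?nnegrE ?(subnorm_ge0 sp) ?ltW // (le_lt_trans (subnorm_ge0 sp y)).
have S0 y : S y !=set0 by exists (p y + 1); apply: Sgt; rewrite ltrDl.
have spS : subnorm (fun y => inf (S y)).
  split=> [y||y z|y z|c].
  - by apply: lb_le_inf => // z /Sp.
  - apply: lb_le_inf => // r [r0 [C H]].
    apply: (@ler_of_expr _ _ _ C 0) => // [|n]; first exact: ltW.
    by rewrite expr0 mulr1; have := H n; rewrite !expr1n (subnorm1 sp).
  - apply: ler_infD => // r s [r0 [C HC]] [s0 [D HD]]; apply: inf_ler; first exact: Sp.
    split; first exact: addr_gt0.
    exists (C * D) => n; rewrite exprDn; apply: le_trans (subnorm_sum _ _ _ sp) _.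
    rewrite exprDn mulr_sumr; apply: ler_sum => j _.
    apply: le_trans (subnormMn _ _ sp) _; rewrite mulrnAr lerMn2r; apply/orP; right.
    apply: le_trans (subnormM sp _ _) _.
    by rewrite mulrACA; apply: ler_pM; rewrite ?(subnorm_ge0 sp).
  - apply: ler_infM; [exact: S0|exact: S0|exact: Sp|exact: Sp|].
    move=> r s [r0 [C HC]] [s0 [D HD]]; apply: inf_ler; first exact: Sp.
    split; first exact: mulr_gt0.
    exists (C * D) => n; rewrite !exprMn; apply: le_trans (subnormM sp _ _) _.
    by rewrite mulrACA; apply: ler_pM; rewrite ?(subnorm_ge0 sp).
  - apply/ler_addgt0Pr => e e0; apply: inf_ler; first exact: Sp.
    by apply: Sgt; apply: le_lt_trans (subnorm_base sp c) _; rewrite ltrDl.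
have pE : (fun y => inf (S y)) = p.
  apply: minp spS _ => y; apply/ler_addgt0Pr => e e0; apply: inf_ler; first exact: Sp.
  by apply: Sgt; rewrite ltrDl.
rewrite -[X in _ <= X](congr1 (fun q => q (x ^+ 2)) pE).
apply: lb_le_inf => // r [r0 [C HC]].
have C0 : 0 <= C by apply: le_trans (_ : p (x ^+ 2 ^+ 0) <= _); [exact: subnorm_ge0|have := HC 0; rewrite [r ^+ _]expr0 mulr1].
rewrite -[r]sqr_sqrtr; last exact: ltW.
rewrite lerXn2r ?nnegrE ?(subnorm_ge0 sp) ?sqrtr_ge0 //.
rewrite -[X in X <= _](congr1 (fun q => q x) pE); apply: inf_ler; first exact: Sp.
have q0 : 0 < Num.sqrt r by rewrite sqrtr_gt0.
(* A bound on the powers of [x ^+ 2] controls the even powers of [x]; an odd power has one factor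
   [x] more, paid for by [p x / Num.sqrt r]. *)
split=> //; exists (C * (1 + p x / Num.sqrt r)) => n.
rewrite -(odd_double_half n) -mul2n exprD (exprD (Num.sqrt r)) !exprM sqr_sqrtr ?(ltW r0) //.
apply: le_trans (subnormM sp _ _) _.
rewrite [leLHS]mulrC; apply: (@le_trans _ _ (C * r ^+ n./2 * p (x ^+ odd n))).
  by rewrite ler_wpM2r ?(subnorm_ge0 sp).
rewrite -!mulrA ler_wpM2l // mulrA [leLHS]mulrC ler_wpM2r ?exprn_ge0 ?(ltW r0) //.
case: (odd n); rewrite ?expr1 ?expr0 ?(subnorm1 sp) ?mulr1.
  by rewrite mulrDl mul1r divfK ?gt_eqF // lerDr (ltW q0).
by rewrite lerDl divr_ge0 ?(subnorm_ge0 sp) ?(ltW q0).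
Qed.

(** Repeated squaring gives the exponents [2 ^ m]. For any [n], split [2 ^ n] as [n + (2 ^ n - n)]
    and cancel the second part by submultiplicativity. *)
Lemma minimalX x n : p (x ^+ n) = p x ^+ n.
Proof.
have pow2 m : p x ^+ (2 ^ m) <= p (x ^+ (2 ^ m)).
  elim: m => [|m IH]; first by rewrite expn0 !expr1.
  rewrite expnSr !exprM; apply: le_trans (minimal_sqr _).
  by rewrite lerXn2r ?nnegrE ?exprn_ge0 ?(subnorm_ge0 sp).
apply/eqP; rewrite eq_le subnormX_le //=.
have [->|x0] := eqVneq x 0.
  by rewrite (subnorm0 sp); case: n => [|n]; rewrite ?expr0 ?(subnorm1 sp) // exprS mul0r (subnorm_ge0 sp).
have px : 0 < p x ^+ (2 ^ n - n) by rewrite exprn_gt0 // subnorm_gt0.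
have nn : (n <= 2 ^ n)%N by rewrite ltnW // ltn_expl.
rewrite -(ler_pM2r px) -exprD subnKC //; apply: le_trans (pow2 n) _.
rewrite -{1}(subnKC nn) exprD; apply: le_trans (subnormM sp _ _) _.
by rewrite ler_wpM2l ?(subnorm_ge0 sp) // subnormX_le.
Qed.

(** For fixed [x], the infimum over [n] of [p (x ^+ n * y) / p x ^+ n] is a subnorm in [y] below
    [p], so it equals [p]; the term [n = 1] is the missing inequality. *)
Lemma minimalM x y : p (x * y) = p x * p y.
Proof.
have [->|x0] := eqVneq x 0; first by rewrite mul0r (subnorm0 sp) mul0r.
have px := subnorm_gt0 sp x0.
pose S y := [set r | 0 <= r /\ exists n, p (x ^+ n * y) <= r * p x ^+ n].
have Sp z r : S z r -> 0 <= r by case.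
have Sle z : S z (p z).
  split; [exact: subnorm_ge0 | exists 0; rewrite !expr0 mul1r mulr1 //].
have S0 z : S z !=set0 by exists (p z).
have spS : subnorm (fun y => inf (S y)).
  split=> [z||z w|z w|c].
  - by apply: lb_le_inf => // r /Sp.
  - apply: lb_le_inf => // r [r0 [n]]; rewrite mulr1 minimalX => H.
    by rewrite -(ler_pM2r (_ : 0 < p x ^+ n)) ?mul1r // exprn_gt0.
  - apply: ler_infD => // r s [r0 [n Hn]] [s0 [m Hm]]; apply: inf_ler; first exact: Sp.
    split; first exact: addr_ge0.
    exists (m + n)%N; rewrite mulrDr mulrDl; apply: le_trans (subnormD sp _ _) _.
    apply: lerD.
      rewrite exprD -mulrA; apply: le_trans (subnormM sp _ _) _.
      by rewrite minimalX exprD mulrCA ler_wpM2l // exprn_ge0 ?(subnorm_ge0 sp).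
    rewrite addnC exprD -mulrA; apply: le_trans (subnormM sp _ _) _.
    by rewrite minimalX exprD mulrCA ler_wpM2l // exprn_ge0 ?(subnorm_ge0 sp).
  - apply: ler_infM; [exact: S0|exact: S0|exact: Sp|exact: Sp|].
    move=> r s [r0 [n Hn]] [s0 [m Hm]]; apply: inf_ler; first exact: Sp.
    split; first exact: mulr_ge0.
    exists (n + m)%N; rewrite !exprD mulrACA; apply: le_trans (subnormM sp _ _) _.
    by rewrite mulrACA; apply: ler_pM; rewrite ?(subnorm_ge0 sp).
  - by apply: le_trans (subnorm_base sp c); apply: inf_ler; [exact: Sp|exact: Sle].
have pE : (fun y => inf (S y)) = p.
  by apply: minp spS _ => z; apply: inf_ler; [exact: Sp|exact: Sle].
apply/eqP; rewrite eq_le (subnormM sp) /= mulrC -ler_pdivlMr //.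
rewrite -[X in X <= _](congr1 (fun q => q y) pE); apply: inf_ler; first exact: Sp.
split; first by rewrite divr_ge0 ?(subnorm_ge0 sp) // ltW.
by exists 1%N; rewrite !expr1 divfK // gt_eqF.
Qed.

End Minimal.

Lemma absv_extension : exists b : absval R L, absv_extends i a b.
Proof.
have [p sp minp] := subnorm_minimal.
have p0 x : p x = 0 <-> x = 0.
  split=> [px|->]; last exact: subnorm0.
  by apply/eqP; apply: contraPT px => x0; apply/eqP; rewrite gt_eqF // subnorm_gt0.
exists (@AbsVal _ _ p (subnorm_ge0 sp) p0 (minimalM sp minp) (subnormD sp)) => c /=.
apply/eqP; rewrite eq_le (subnorm_base sp) /=.
have [->|c0] := eqVneq c 0; first by rewrite absv0 (subnorm_ge0 sp).
(* The inequality on [K], applied to [c^-1] as well, becomes an equality. *)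
have := subnorm_base sp c^-1; rewrite absvV fmorphV => H.
rewrite -[leLHS]mulr1 -ler_pdivlMl ?absv_gt0 // mulrC.
rewrite -(@ler_pM2r _ (p (i c)^-1)) ?subnorm_gt0 ?invr_eq0 ?fmorph_eq0 //.
rewrite mul1r mulrAC -(minimalM sp minp) divff ?fmorph_eq0 // (subnorm1 sp) mul1r.
exact: H.
Qed.

End Extension.

Lemma finite_set_seq (T : choiceType) (A : set T) : finite_set A ->
  exists s : seq T, uniq s /\ forall x, (x \in s) <-> A x.
Proof.
move=> /finite_seqP [s ->]; exists (undup s); split; first exact: undup_uniq.
by move=> x; rewrite mem_undup.
Qed.

(** * Lower bounds from the product formula *)

Section Adelic.
Variables (R : realType) (k : fieldType) (PF : product_formula_structure R k).

(* Liouville's inequality. *)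
Lemma product_formula_lower (C : pf_place PF -> R) :
  (forall u, 1 <= C u) -> finite_set [set u | C u != 1] ->
  exists2 G : R, 1 <= G & forall (D : k) X, D != 0 ->
    (forall u : pf_place PF, pf_abs u D <= C u ^+ X) -> forall v : pf_place PF, 1 <= G ^+ X * pf_abs v D.
Proof.
move=> C1 Cfin; have [B [uB BP]] := finite_set_seq Cfin.
have prod_ge1 (s : seq (pf_place PF)) (P : pred (pf_place PF)) :
    1 <= \prod_(u <- s | P u) C u ^+ pf_N u.
  elim/big_rec: _ => // u x _ x1.
  by rewrite -[leLHS]mulr1 ler_pM // exprn_ege1.
exists (\prod_(u <- B) C u ^+ pf_N u) => [|D X D0 DC v]; first exact: prod_ge1.
set G := \prod_(u <- B) _.
have [v1|v1] := leP 1 (pf_abs v D).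
  by rewrite -[leLHS]mulr1 ler_pM // exprn_ege1 // prod_ge1.
have Dfin := pf_finite PF D0.
(* [U] contains [v] and every place where [D] has absolute value different from 1, so the product
   formula becomes a product over [U]. *)
have Ufin : finite_set ([set v] `|` [set u : pf_place PF | pf_abs u D != 1]).
  by rewrite finite_setU; split.
have [U [uU UP]] := finite_set_seq Ufin.
have vU : v \in U by apply/UP; left.
have := pf_formula PF D0.
rewrite (@fsbigE _ _ _ _ _ U) //; last first.
  move=> u _ H; apply/eqP; apply: contraNT H => H; apply/UP; right => /=.
  by apply: contra H => /eqP ->; rewrite expr1n.
under eq_bigl do rewrite in_setT.
rewrite (bigD1_seq v) //= => PE.
have v0 : 0 < pf_abs v D by exact: absv_gt0.
have le1 : \prod_(u <- U | u != v) pf_abs u D ^+ pf_N u <= G ^+ X.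
  apply: (@le_trans _ _ (\prod_(u <- U | u != v) (C u ^+ pf_N u) ^+ X)).
    apply: ler_prod => u _; rewrite exprn_ge0 ?absv_ge0 //= exprAC.
    by rewrite lerXn2r ?nnegrE ?absv_ge0 // exprn_ge0 // (le_trans ler01).
  rewrite prodrXl lerXn2r ?nnegrE ?(le_trans ler01) ?prod_ge1 //.
  rewrite big_mkcond [leLHS](bigID (mem B)) /= [X in _ * X]big1 => [|u]; last first.
    move=> /negP H; have -> : C u = 1 by apply/eqP; apply: contra_notT H => H; apply/BP.
    by rewrite expr1n if_same.
  rewrite mulr1 -big_mkcondr /=.
  pose s := [seq u <- U | (u \in B) && (u != v)].
  have -> : \prod_(u <- U | (u \in B) && (u != v)) C u ^+ pf_N u = \prod_(u <- s) C u ^+ pf_N u.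
    by rewrite /s big_filter.
  have -> : \prod_(u <- s) C u ^+ pf_N u = \prod_(u <- B | u \in s) C u ^+ pf_N u.
    rewrite -[RHS]big_filter; apply: perm_big; apply: uniq_perm.
    - by rewrite filter_uniq.
    - by rewrite filter_uniq.
    move=> u; rewrite !mem_filter; case inB : (u \in B) => /=; rewrite ?andbF ?andbT //=.
  rewrite /G [leRHS](bigID (fun u => u \in s)) /= -[leLHS]mulr1.
  by rewrite ler_wpM2l // (le_trans ler01).
rewrite -PE [leLHS]mulrC; apply: ler_pM le1 _.
- by apply: prodr_ge0 => u _; rewrite exprn_ge0 ?absv_ge0.
- by rewrite exprn_ge0 ?absv_ge0.
(* Here [D] has absolute value less than 1 at [v], and the exponent [pf_N v >= 1] only decreases
   it. *)
rewrite -[leRHS]expr1; apply: ler_wiXn2l; rewrite ?absv_ge0 ?(ltW v1) //.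
exact: pf_N_gt0.
Qed.

Hypothesis k_char0 : [pchar k] =i pred0.

Lemma natr_char0_neq0 n : (0 < n)%N -> n%:R != 0 :> k.
Proof. by move=> n0; rewrite ((pcharf0P k).1 k_char0) -lt0n. Qed.

Lemma nonarch_nat (K : fieldType) (a : absval R K) n :
  absv_nonarchimedean a -> a n%:R <= 1.
Proof.
move=> na; elim: n => [|n IH]; first by rewrite absv0.
by rewrite -[n.+1%:R]natr1; apply: le_trans (na _ _) _; rewrite ge_max IH absv1 lexx.
Qed.

(** Liouville's inequality for integers. Where 2 has absolute value 1 the place is ultrametric and
    integers are at most 1; at the finitely many others [m <= 2 ^ X] is enough. [G] depends on
    neither [m] nor [X]. *)
Lemma absv_nat_lower (v : pf_place PF) : exists2 G : R, 1 <= G & forall m X, (0 < m)%N ->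
  (m <= 2 ^ X)%N -> 1 <= G ^+ X * pf_abs v (m%:R : k) :> R.
Proof.
pose C (u : pf_place PF) : R := if pf_abs u (2%:R : k) != 1 then 2 else 1.
have [||G G1 H] := @product_formula_lower C.
- by move=> u; rewrite /C; case: ifP => // _; rewrite ler1n.
- have fin2 : finite_set [set u : pf_place PF | pf_abs u (2%:R : k) != 1] by apply: pf_finite; exact: natr_char0_neq0.
  apply: sub_finite_set fin2 => u' /=; rewrite /C; case: ifP => //.
  by rewrite eqxx.
exists G => // m X m0 mX; apply: H => [|u]; first exact: natr_char0_neq0.
rewrite /C; case: eqP => u2 /=.
  by rewrite expr1n; apply: nonarch_nat; apply: nonarchimedean_le2; rewrite u2.
by apply: le_trans (absv_nat _ _) _; rewrite -natrX ler_nat.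
Qed.

End Adelic.

(** * Estimates for binary forms *)

(* [kappa = 1] is the ultrametric case; every norm satisfies this with
   [kappa = 2]. *)
Record qnorm (R : realType) (S : comNzRingType) (kappa : R) := QNorm {
  qn :> S -> R;
  qn_ge0 : forall x, 0 <= qn x;
  qn0 : qn 0 = 0;
  qn1 : qn 1 = 1;
  qnN : forall x, qn (- x) = qn x;
  qnM : forall x y, qn (x * y) <= qn x * qn y;
  qnD : forall x y, qn (x + y) <= kappa * Num.max (qn x) (qn y)
}.

Definition qnorm_absv (R : realType) (K : fieldType) (a : absval R K) : qnorm K (kap a).
Proof.
apply: (@QNorm _ _ _ a).
- exact: absv_ge0.
- exact: absv0.
- exact: absv1.
- exact: absvN.
- by move=> x y; rewrite absvM.
- exact: absvD_kap.
Defined.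

Section PolyNorm.
Variables (R : realType) (K : fieldType) (a : absval R K) (rho : R).
Hypothesis rho_ge0 : 0 <= rho.

Let op (x y : R) := if `[< absv_nonarchimedean a >] then Num.max x y else x + y.

(* The Gauss norm of radius [rho] if [a] is ultrametric, the l^1 norm
   otherwise. *)
Definition pnorm (p : {poly K}) : R := foldr (fun c x => op (a c) (rho * x)) 0 p.

Let op0 x : 0 <= x -> op x 0 = x.
Proof. by move=> x0; rewrite /op; case: ifP => _; rewrite ?addr0 // max_l. Qed.

Let op0l x : 0 <= x -> op 0 x = x.
Proof. by move=> x0; rewrite /op; case: ifP => _; rewrite ?add0r // max_r. Qed.

Let op_ge x y : 0 <= x -> 0 <= y -> (x <= op x y) * (y <= op x y).
Proof.
move=> x0 y0; rewrite /op; case: ifP => _; first by rewrite !le_max !lexx orbT.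
by rewrite lerDl lerDr.
Qed.

Let op_le x y u v : x <= u -> y <= v -> op x y <= op u v.
Proof.
move=> xu yv; rewrite /op; case: ifP => _; last exact: lerD.
by rewrite ge_max !le_max xu yv orbT.
Qed.

Let opACA x y u v : op (op x y) (op u v) = op (op x u) (op y v).
Proof. by rewrite /op; case: `[< _ >]; [exact: maxACA | exact: addrACA]. Qed.

Let opM c x y : 0 <= c -> op (c * x) (c * y) = c * op x y.
Proof. by move=> c0; rewrite /op; case: ifP => _; rewrite ?mulrDr ?maxr_pMr. Qed.

Let opMr c x y : 0 <= c -> op (x * c) (y * c) = op x y * c.
Proof. by move=> c0; rewrite mulrC (mulrC y) opM // mulrC. Qed.

Let op_kap x y : 0 <= x -> 0 <= y -> op x y <= kap a * Num.max x y.
Proof.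
move=> x0 y0; rewrite /op /kap; case: ifP => _; first by rewrite mul1r.
by rewrite mulr_natl mulr2n; apply: lerD; rewrite le_max lexx ?orbT.
Qed.

Let absv_op x y : a (x + y) <= op (a x) (a y).
Proof. by rewrite /op; case: asboolP => [|_]; [exact | exact: absvD]. Qed.

Lemma pnorm0 : pnorm 0 = 0. Proof. by rewrite /pnorm polyseq0. Qed.

Lemma pnorm_cons p c : pnorm (p * 'X + c%:P) = op (a c) (rho * pnorm p).
Proof.
rewrite -cons_poly_def /pnorm polyseq_cons; case: nilP => [p0|] //=.
by rewrite p0 /= mulr0 polyseqC op0 ?absv_ge0 //; case: eqP => [->|_] /=; rewrite ?absv0 // mulr0 op0 ?absv_ge0.
Qed.

Lemma pnormC c : pnorm c%:P = a c.
Proof. by rewrite -[c%:P]add0r -(mul0r 'X) pnorm_cons pnorm0 mulr0 op0 ?absv_ge0. Qed.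

Lemma pnorm_ge0 p : 0 <= pnorm p.
Proof.
elim/poly_ind: p => [|p c IH]; first by rewrite pnorm0.
rewrite pnorm_cons; apply: le_trans (op_ge _ _).1; rewrite ?absv_ge0 //.
exact: mulr_ge0.
Qed.

Lemma pnormMX p : pnorm (p * 'X) = rho * pnorm p.
Proof. by rewrite -[p * 'X]addr0 pnorm_cons absv0 op0l // mulr_ge0 ?pnorm_ge0. Qed.

Lemma pnormX : pnorm 'X = rho.
Proof. by rewrite -['X]mul1r pnormMX -[1]/1%:P pnormC absv1 mulr1. Qed.

Let pnorm_op p q : pnorm (p + q) <= op (pnorm p) (pnorm q).
Proof.
elim/poly_ind: p q => [|p c IH] q; first by rewrite add0r pnorm0 op0l ?pnorm_ge0.
elim/poly_ind: q => [|q d _]; first by rewrite addr0 pnorm0 op0 ?pnorm_ge0.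
have -> : p * 'X + c%:P + (q * 'X + d%:P) = (p + q) * 'X + (c + d)%:P.
  by rewrite polyCD; ring.
rewrite !pnorm_cons opACA; apply: op_le => //.
by rewrite opM //; apply: ler_wpM2l.
Qed.

Lemma pnormN p : pnorm (- p) = pnorm p.
Proof.
elim/poly_ind: p => [|p c IH]; first by rewrite oppr0.
by rewrite opprD -mulNr -polyCN !pnorm_cons IH absvN.
Qed.

Let pnormCM c p : pnorm (c%:P * p) = a c * pnorm p.
Proof.
elim/poly_ind: p => [|p d IH]; first by rewrite mulr0 pnorm0 mulr0.
by rewrite mulrDr mulrA -polyCM !pnorm_cons IH absvM -opM ?absv_ge0 // mulrCA.
Qed.

Lemma pnormM p q : pnorm (p * q) <= pnorm p * pnorm q.
Proof.
elim/poly_ind: p => [|p c IH]; first by rewrite mul0r pnorm0 mul0r.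
rewrite mulrDl addrC mulrAC; apply: le_trans (pnorm_op _ _) _.
rewrite pnormCM pnormMX pnorm_cons -opMr ?pnorm_ge0 //; apply: op_le => //.
by rewrite -mulrA; apply: ler_wpM2l.
Qed.

Lemma pnorm_coef (p : {poly K}) j : a p`_j * rho ^+ j <= pnorm p.
Proof.
elim/poly_ind: p j => [|p c IH] j; first by rewrite coef0 absv0 mul0r pnorm0.
have [H1 H2] := op_ge (absv_ge0 a c) (mulr_ge0 rho_ge0 (pnorm_ge0 p)).
rewrite pnorm_cons coefD coefMX coefC; case: j => [|j] /=.
  by rewrite add0r mulr1.
rewrite addr0 exprS mulrCA; apply: le_trans H2.
exact: ler_wpM2l.
Qed.

Definition qnorm_poly : qnorm {poly K} (kap a).
Proof.
apply: (@QNorm _ _ _ pnorm).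
- exact: pnorm_ge0.
- exact: pnorm0.
- by rewrite -[1]/1%:P pnormC absv1.
- exact: pnormN.
- exact: pnormM.
- by move=> x y; apply: le_trans (pnorm_op _ _) _; apply: op_kap; exact: pnorm_ge0.
Defined.

Lemma qnorm_polyE p : qnorm_poly p = pnorm p. Proof. by []. Qed.

End PolyNorm.

Definition hform (S : comNzRingType) (c : nat -> S) (d : nat) (X : S * S) : S :=
  \sum_(j < d.+1) c j * X.1 ^+ j * X.2 ^+ (d - j).

Section FormEstimates.
Variables (R : realType) (S : comNzRingType) (kappa : R) (nu : qnorm S kappa).
Hypothesis kappa1 : 1 <= kappa.
Let kappa_ge0 : 0 <= kappa. Proof. exact: le_trans kappa1. Qed.


Definition qmax (X : S * S) : R := Num.max (nu X.1) (nu X.2).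

Lemma qmax_ge0 X : 0 <= qmax X. Proof. by rewrite le_max qn_ge0. Qed.

Lemma qnX x n : nu (x ^+ n) <= nu x ^+ n.
Proof.
elim: n => [|n IH]; first by rewrite !expr0 qn1.
by rewrite !exprS; apply: le_trans (qnM _ _ _) _; rewrite ler_wpM2l // qn_ge0.
Qed.

Lemma qn_prod (I : Type) (s : seq I) (P : pred I) (f : I -> S) :
  nu (\prod_(j <- s | P j) f j) <= \prod_(j <- s | P j) nu (f j).
Proof.
elim/big_rec2: _ => [|j x y _ H]; first by rewrite qn1.
by apply: le_trans (qnM _ _ _) _; rewrite ler_wpM2l // qn_ge0.
Qed.

Lemma qn_sum m (f : nat -> S) B : (forall j, (j <= m)%N -> nu (f j) <= B) ->
  nu (\sum_(j < m.+1) f j) <= kappa ^+ m * B.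
Proof.
elim: m => [|m IH] H; first by rewrite big_ord_recl big_ord0 addr0 mul1r H.
have B0 : 0 <= B by apply: le_trans (H 0%N _); rewrite ?qn_ge0.
rewrite big_ord_recr /=; apply: le_trans (qnD _ _ _) _.
rewrite exprS -mulrA ler_wpM2l // ge_max IH => [|j jm]; last by apply: H; exact: leqW.
apply: le_trans (H _ _) _ => //.
by rewrite -[leLHS]mul1r ler_wpM2r // exprn_ege1.
Qed.

Lemma qn_hform c d C0 r X : (forall j, nu (c j) <= C0) -> qmax X <= r ->
  nu (hform c d X) <= kappa ^+ d * (C0 * r ^+ d).
Proof.
move=> cC; rewrite ge_max => /andP[X1 X2].
have r0 : 0 <= r by apply: le_trans X1; exact: qn_ge0.
rewrite /hform; apply: (@qn_sum _ (fun j => c j * X.1 ^+ j * X.2 ^+ (d - j))) => j jd; apply: le_trans (qnM _ _ _) _.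
have -> : C0 * r ^+ d = C0 * r ^+ j * r ^+ (d - j) by rewrite -mulrA -exprD subnKC.
apply: ler_pM; rewrite ?qn_ge0 //; last first.
  by apply: le_trans (qnX _ _) _; rewrite lerXn2r ?nnegrE ?qn_ge0.
apply: le_trans (qnM _ _ _) _; apply: ler_pM; rewrite ?qn_ge0 //.
by apply: le_trans (qnX _ _) _; rewrite lerXn2r ?nnegrE ?qn_ge0.
Qed.

(** One factor is split off at a time, each costing two quasi-triangle inequalities, whence
    [kappa ^+ (2 * n)]. The error stays proportional to [e], which makes the estimate fit for
    iteration. *)
Lemma qn_pow_diff x u (r e : R) n :
  nu x <= r -> nu u <= e * r -> 0 <= e <= 1 ->
  nu ((x + u) ^+ n - x ^+ n) <= kappa ^+ (2 * n) * (e * r ^+ n).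
Proof.
move=> xr ur /andP[e0 e1].
have r0 : 0 <= r by apply: le_trans xr; exact: qn_ge0.
elim: n => [|n IH].
  by rewrite !expr0 subrr qn0 mul1r mulr1.
have -> : (x + u) ^+ n.+1 - x ^+ n.+1 =
    (x + u) * ((x + u) ^+ n - x ^+ n) + u * x ^+ n by rewrite !exprS; ring.
apply: le_trans (qnD _ _ _) _.
have -> : kappa ^+ (2 * n.+1) * (e * r ^+ n.+1) =
  kappa * (kappa * r * (kappa ^+ (2 * n) * (e * r ^+ n))).
  by rewrite mulnS !exprS; ring.
apply: ler_wpM2l => //; rewrite ge_max; apply/andP; split.
  apply: le_trans (qnM _ _ _) _; apply: ler_pM; rewrite ?qn_ge0 //.
  apply: le_trans (qnD _ _ _) _; rewrite ler_wpM2l // ge_max xr /=.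
  by apply: le_trans ur _; rewrite ler_piMl.
have A : nu (x ^+ n) <= r ^+ n.
  by apply: le_trans (qnX _ _) _; rewrite lerXn2r ?nnegrE ?qn_ge0.
apply: le_trans (qnM _ _ _) _.
apply: le_trans (ler_pM (qn_ge0 _ _) (qn_ge0 _ _) ur A) _.
have k1 : 1 <= kappa ^+ (2 * n).+1 by exact: exprn_ege1.
have -> : kappa * r * (kappa ^+ (2 * n) * (e * r ^+ n)) =
   kappa ^+ (2 * n).+1 * (e * r * r ^+ n) by rewrite exprS; ring.
by rewrite -[leLHS]mul1r ler_wpM2r // !mulr_ge0 // exprn_ge0.
Qed.

Lemma qn_hform_diff c d C0 r e (X U : S * S) : (forall j, nu (c j) <= C0) ->
  qmax X <= r -> qmax U <= e * r -> 0 <= e <= 1 ->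
  nu (hform c d (X.1 + U.1, X.2 + U.2) - hform c d X) <=
    kappa ^+ (d + (2 * d).+1) * C0 * (e * r ^+ d).
Proof.
move=> cC; rewrite !ge_max => /andP[X1 X2] /andP[U1 U2] e01.
have [e0 e1] := andP e01.
have r0 : 0 <= r by apply: le_trans X1; exact: qn_ge0.
have C00 : 0 <= C0 by apply: le_trans (cC 0%N); exact: qn_ge0.
have -> : kappa ^+ (d + (2 * d).+1) * C0 * (e * r ^+ d) =
    kappa ^+ d * (C0 * (kappa ^+ (2 * d).+1 * (e * r ^+ d))) by rewrite exprD; ring.
rewrite /hform -sumrB /=.
apply: (@qn_sum _ (fun j => c j * (X.1 + U.1) ^+ j * (X.2 + U.2) ^+ (d - j) -
   c j * X.1 ^+ j * X.2 ^+ (d - j))) => j jd.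
rewrite -!mulrA -mulrBr; apply: le_trans (qnM _ _ _) _.
apply: ler_pM; rewrite ?qn_ge0 //.
have [l dE] : exists l, d = (j + l)%N by exists (d - j)%N; rewrite subnKC.
rewrite dE addKn.
have -> : (X.1 + U.1) ^+ j * (X.2 + U.2) ^+ l - X.1 ^+ j * X.2 ^+ l =
  (X.1 + U.1) ^+ j * ((X.2 + U.2) ^+ l - X.2 ^+ l) +
  ((X.1 + U.1) ^+ j - X.1 ^+ j) * X.2 ^+ l by ring.
apply: le_trans (qnD _ _ _) _; rewrite [kappa ^+ (2 * (j + l)).+1]exprS -!mulrA.
apply: ler_wpM2l => //.
have E m n : (m + n <= 2 * (j + l))%N ->
    kappa ^+ m * r ^+ j * (kappa ^+ n * (e * r ^+ l)) <= kappa ^+ (2 * (j + l)) * (e * r ^+ (j + l)).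
  move=> mn.
  have -> : kappa ^+ m * r ^+ j * (kappa ^+ n * (e * r ^+ l)) = kappa ^+ (m + n) * (e * r ^+ (j + l)).
    by rewrite !exprD; ring.
  by apply: ler_wpM2r; [rewrite mulr_ge0 // exprn_ge0 | exact: ler_weXn2l].
rewrite ge_max; apply/andP; split; apply: le_trans (qnM _ _ _) _.
  apply: le_trans (E j (2 * l)%N _); last by lia.
  apply: ler_pM; rewrite ?qn_ge0 //; last exact: qn_pow_diff.
  apply: le_trans (qnX _ _) _; rewrite -exprMn lerXn2r ?nnegrE ?qn_ge0 ?mulr_ge0 //.
  apply: le_trans (qnD _ _ _) _; rewrite ler_wpM2l // ge_max X1 /=.
  by apply: le_trans U1 _; rewrite ler_piMl.
apply: le_trans (E (2 * j)%N 0%N _); last by lia.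
have -> : kappa ^+ (2 * j) * r ^+ j * (kappa ^+ 0 * (e * r ^+ l)) =
  kappa ^+ (2 * j) * (e * r ^+ j) * r ^+ l by ring.
apply: ler_pM; rewrite ?qn_ge0 //; first exact: qn_pow_diff.
by apply: le_trans (qnX _ _) _; rewrite lerXn2r ?nnegrE ?qn_ge0.
Qed.

End FormEstimates.

(* The pair of forms of degree [d] whose dehomogenizations are [P.1], [P.2]. *)
Definition fmap (k S : comNzRingType) (g : k -> S) (d : nat)
    (P : {poly k} * {poly k}) (X : S * S) : S * S :=
  (hform (fun j => g P.1`_j) d X, hform (fun j => g P.2`_j) d X).

Definition wedge (S : comNzRingType) (X Y : S * S) : S := X.1 * Y.2 - X.2 * Y.1.

(** Substituting this line into a form gives the polynomial of its Taylor coefficients at [X] in the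
    direction [T]. *)
Definition lineP (L : comNzRingType) (X T : L * L) : {poly L} * {poly L} :=
  (X.1%:P + T.1 *: 'X, X.2%:P + T.2 *: 'X).

(** The same form of degree [d] read in the chart at infinity. The degree of [p] may be smaller than
    [d]; the difference is the order of vanishing at infinity. *)
Definition revp (k : nzRingType) (d : nat) (p : {poly k}) : {poly k} :=
  \poly_(j < d.+1) p`_(d - j).

Section HformBasics.
Variables (k : comNzRingType) (S : comNzRingType) (g : {rmorphism k -> S}).

Lemma hformZ (c : nat -> S) d x (X : S * S) :
  hform c d (x * X.1, x * X.2) = x ^+ d * hform c d X.
Proof.
rewrite /hform mulr_sumr; apply: eq_bigr => j _ /=.
have -> : x ^+ d = x ^+ j * x ^+ (d - j) by rewrite -exprD subnKC // -ltnS.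
by rewrite !exprMn; ring.
Qed.

Lemma hform_horner (p : {poly k}) d x : (size p <= d.+1)%N ->
  hform (fun j => g p`_j) d (x, 1) = (map_poly g p).[x].
Proof.
move=> sp; rewrite (@horner_coef_wide _ d.+1) ?(leq_trans (size_poly _ _)) //.
by apply: eq_bigr => j _; rewrite /= expr1n mulr1 coef_map.
Qed.

Lemma hform_horner_rev (p : {poly k}) d y :
  hform (fun j => g p`_j) d (1, y) = (map_poly g (revp d p)).[y].
Proof.
rewrite (@horner_coef_wide _ d.+1); last first.
  by apply: leq_trans (size_poly _ _) _; exact: size_poly.
rewrite /hform (reindex_inj rev_ord_inj) /=; apply: eq_bigr => j _.
rewrite expr1n mulr1 coef_map coef_poly ltn_ord !subSS subKn //.
by rewrite -ltnS.
Qed.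

End HformBasics.

Section FormBounds.
Variables (R : realType) (k : fieldType) (L : fieldType) (g : {rmorphism k -> L}).
Variable b : absval R L.

Notation nrm := (qmax (qnorm_absv b)).
Notation pnrm rho := (qmax (qnorm_poly b rho)).

(** All that is used about a lift at one place, with a single constant. [fb_taylor] is a relative
    estimate: moving [X0] by a fraction [e] of its size moves the image by at most a fraction
    [C * e] of its own size, and this form can be iterated. *)
Record form_bounds (P : {poly k} * {poly k}) (d : nat) (C : R) : Prop := {
  fb_ge1 : 1 <= C;
  fb_kap : kap b <= C;
  fb_ub : forall X, nrm (fmap g d P X) <= C * nrm X ^+ d;
  fb_pub : forall (rho : R) (rho0 : 0 <= rho) (X : {poly L} * {poly L}),
     pnrm rho0 (fmap (polyC \o g) d P X) <= C * pnrm rho0 X ^+ d;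
  fb_lb : forall X, nrm X ^+ d <= C * nrm (fmap g d P X);
  fb_taylor : forall (rho : R) (rho0 : 0 <= rho) X0 (X : {poly L} * {poly L}) (e : R),
     0 <= e <= 1 ->
     pnrm rho0 (X.1 - X0.1%:P, X.2 - X0.2%:P) <= e * nrm X0 ->
     let Y := fmap (polyC \o g) d P X in
     let Y0 := fmap g d P X0 in
     pnrm rho0 (Y.1 - Y0.1%:P, Y.2 - Y0.2%:P) <= C * e * nrm Y0
}.

Definition bezout_data (d : nat) (P : {poly k} * {poly k}) (u v : {poly k} * {poly k}) :=
  u.1 * P.1 + u.2 * P.2 = 1 /\ v.1 * revp d P.1 + v.2 * revp d P.2 = 1.

(** For the lower bound, scale the larger coordinate to 1 and evaluate the Bezout relation of that
    chart. The exponent of [kap b] is [d + (2 * d).+1] from the difference estimate plus [s.+1] from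
    the lower bound, which makes that estimate relative. *)
Lemma form_boundsP (P u v : {poly k} * {poly k}) d C0 s : (0 < d)%N -> 1 <= C0 ->
  (size P.1 <= d.+1)%N -> (size P.2 <= d.+1)%N ->
  (forall j, b (g P.1`_j) <= C0 /\ b (g P.2`_j) <= C0) ->
  (size u.1 <= s.+1)%N -> (size u.2 <= s.+1)%N ->
  (size v.1 <= s.+1)%N -> (size v.2 <= s.+1)%N ->
  (forall j, [/\ b (g u.1`_j) <= C0, b (g u.2`_j) <= C0,
      b (g v.1`_j) <= C0 & b (g v.2`_j) <= C0]) ->
  bezout_data d P u v ->
  form_bounds P d (kap b ^+ (s + 3 * d + 2) * C0 ^+ 2).
Proof.
move=> d0 C01 sP1 sP2 PC su1 su2 sv1 sv2 uvC [bz1 bz2].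
have k1 := kap_ge1 b; have k0 : 0 <= kap b by apply: le_trans k1.
have C00 : 0 <= C0 by apply: le_trans C01.
have kpow m n : (m <= n)%N -> kap b ^+ m <= kap b ^+ n by exact: ler_weXn2l.
have C0C : C0 <= C0 ^+ 2 by rewrite expr2 ler_peMr.
have nrm0 X : 0 <= nrm X by exact: qmax_ge0.
have chart (p1 p2 w1 w2 : {poly k}) z : w1 * p1 + w2 * p2 = 1 ->
    (size w1 <= s.+1)%N -> (size w2 <= s.+1)%N ->
    (forall j, b (g w1`_j) <= C0 /\ b (g w2`_j) <= C0) -> b z <= 1 ->
    1 <= kap b ^+ s.+1 * C0 * nrm ((map_poly g p1).[z], (map_poly g p2).[z]).
  move=> bz s1 s2 wC z1.
  have : (map_poly g (w1 * p1 + w2 * p2)).[z] = 1 by rewrite bz rmorph1 hornerC.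
  rewrite rmorphD !rmorphM hornerD !hornerM => /(congr1 b); rewrite absv1 => <-.
  apply: le_trans (absvD_kap _ _ _) _; rewrite exprS -!mulrA; apply: ler_wpM2l => //.
  have hw (w : {poly k}) : (size w <= s.+1)%N -> (forall j, b (g w`_j) <= C0) ->
      b (map_poly g w).[z] <= kap b ^+ s * C0.
    move=> sw wC'; rewrite -(hform_horner _ _ sw).
    have := @qn_hform _ _ _ (qnorm_absv b) k1 (fun j => g w`_j) s C0 1 (z, 1) wC'.
    rewrite expr1n mulr1; apply.
    by rewrite /qmax /= absv1 ge_max z1 lexx.
  rewrite ge_max !absvM mulrA; apply/andP; split; apply: ler_pM; rewrite ?absv_ge0 //.
  - by apply: hw => // j; case: (wC j).
  - by rewrite /qmax /= le_max lexx.
  - by apply: hw => // j; case: (wC j).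
  - by rewrite /qmax /= le_max lexx orbT.
have lb X : nrm X ^+ d <= kap b ^+ s.+1 * C0 * nrm (fmap g d P X).
  have key x (Y : L * L) : nrm Y = 1 -> 1 <= kap b ^+ s.+1 * C0 * nrm (fmap g d P Y) ->
     nrm (x * Y.1, x * Y.2) ^+ d <= kap b ^+ s.+1 * C0 * nrm (fmap g d P (x * Y.1, x * Y.2)).
    move=> Y1 H.
    have hom (Z : L * L) z : nrm (z * Z.1, z * Z.2) = b z * nrm Z.
      by rewrite /qmax /= !absvM maxr_pMr // absv_ge0.
    rewrite hom Y1 mulr1 /fmap !hformZ.
    rewrite (hom (hform _ d Y, hform _ d Y)) absvX mulrCA -[leLHS]mulr1.
    by rewrite ler_wpM2l // exprn_ge0 // absv_ge0.
  have [->|X0] := eqVneq X (0, 0).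
    have -> : nrm (0, 0) = 0 by rewrite /qmax /= absv0 maxxx.
    by rewrite expr0n eqn0Ngt d0 /= !mulr_ge0 // exprn_ge0.
  case: X X0 => x y X0; have [xy|/ltW yx] := leP (b x) (b y).
    have y0 : y != 0.
      apply: contraNneq X0 => yE; move: xy; rewrite yE absv0 => x0.
      by have /absv_eq0 -> : b x = 0 by apply/eqP; rewrite eq_le x0 absv_ge0.
    have z1 : b (x / y) <= 1 by rewrite absvM absvV ler_pdivrMr ?absv_gt0 // mul1r.
    have -> : (x, y) = (y * (x / y, 1 : L).1, y * (x / y, 1 : L).2).
      by rewrite /= mulr1 mulrC divfK.
    apply: key; first by rewrite /qmax /= absv1 max_r.
    rewrite /fmap !hform_horner //; apply: chart bz1 _ _ _ z1 => // j.
    by case: (uvC j).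
  have x0 : x != 0.
    apply: contraNneq X0 => xE; move: yx; rewrite xE absv0 => y0.
    by have /absv_eq0 -> : b y = 0 by apply/eqP; rewrite eq_le y0 absv_ge0.
  have z1 : b (y / x) <= 1 by rewrite absvM absvV ler_pdivrMr ?absv_gt0 // mul1r.
  have -> : (x, y) = (x * (1 : L, y / x).1, x * (1 : L, y / x).2).
    by rewrite /= mulr1 [X in _ = (_, X)]mulrC divfK.
  apply: key; first by rewrite /qmax /= absv1 max_l.
  rewrite /fmap !hform_horner_rev //; apply: chart bz2 _ _ _ z1 => // j.
  by case: (uvC j).
have cge m : (m <= s + 3 * d + 2)%N -> kap b ^+ m * C0 <= kap b ^+ (s + 3 * d + 2) * C0 ^+ 2.
  by move=> hm; apply: ler_pM => //; rewrite ?exprn_ge0 // kpow.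
split.
- by rewrite -[leLHS]mulr1 ler_pM // exprn_ege1.
- apply: (@le_trans _ _ (kap b ^+ (s + 3 * d + 2))).
    by rewrite -[leLHS]expr1; apply: kpow; lia.
  by rewrite ler_peMr ?exprn_ge0 // exprn_ege1.
- move=> X; apply: le_trans (_ : kap b ^+ d * C0 * nrm X ^+ d <= _); last first.
    by rewrite ler_wpM2r ?exprn_ge0 // cge //; lia.
  by rewrite ge_max -mulrA; apply/andP; split; apply: (@qn_hform _ _ _ (qnorm_absv b)) => // j; case: (PC j).
- move=> rho rho0 X; apply: le_trans (_ : kap b ^+ d * C0 * pnrm rho0 X ^+ d <= _); last first.
    by rewrite ler_wpM2r ?exprn_ge0 ?qmax_ge0 // cge //; lia.
  rewrite ge_max -mulrA; apply/andP; split; apply: (@qn_hform _ _ _ (qnorm_poly b rho0)) => // j.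
    by rewrite /= pnormC; case: (PC j).
  by rewrite /= pnormC; case: (PC j).
- move=> X; apply: le_trans (lb X) _; rewrite ler_wpM2r // cge //; lia.
- move=> rho rho0 X0 X e e01 XX0; cbv zeta; set Y0 := fmap g d P X0.
  have [e0 e1] := andP e01.
  have cC (p : {poly k}) : (forall j, b (g p`_j) <= C0) ->
      forall j, qnorm_poly b rho0 ((polyC \o g) p`_j) <= C0.
    by move=> H j /=; rewrite pnormC.
  pose U := (X.1 - X0.1%:P, X.2 - X0.2%:P).
  have hc (p : {poly k}) : (hform (fun j => g p`_j) d X0)%:P =
      hform (fun j => (polyC \o g) p`_j) d (X0.1%:P, X0.2%:P).
    by rewrite /hform rmorph_sum; apply: eq_bigr => j _; rewrite /= !rmorphM !rmorphXn.
  have one (p : {poly k}) : (forall j, b (g p`_j) <= C0) ->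
     qnorm_poly b rho0 (hform (fun j => (polyC \o g) p`_j) d X - (hform (fun j => g p`_j) d X0)%:P)
      <= kap b ^+ (d + (2 * d).+1) * C0 * (e * nrm X0 ^+ d).
    move=> pC; rewrite hc.
    have -> : X = ((X0.1%:P, X0.2%:P).1 + U.1, (X0.1%:P, X0.2%:P).2 + U.2).
      by rewrite /U /= !subrKC; case: (X).
    apply: (@qn_hform_diff _ _ _ (qnorm_poly b rho0)) => //; first exact: cC.
    by rewrite /qmax /= !pnormC.
  apply: (@le_trans _ _ (kap b ^+ (d + (2 * d).+1) * C0 * (e * nrm X0 ^+ d))).
    by rewrite ge_max; apply/andP; split; apply: one => j; case: (PC j).
  apply: (@le_trans _ _ (kap b ^+ (d + (2 * d).+1) * C0 * (e * (kap b ^+ s.+1 * C0 * nrm Y0)))).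
    by rewrite !ler_wpM2l ?mulr_ge0 ?exprn_ge0 //; exact: lb.
  have -> : kap b ^+ (s + 3 * d + 2) = kap b ^+ (d + (2 * d).+1) * kap b ^+ s.+1.
    by rewrite -exprD; congr (_ ^+ _); lia.
  rewrite le_eqVlt; apply/orP; left; apply/eqP; ring.
Qed.

End FormBounds.

(** * Growth and Taylor estimates for the iterates *)

Section Iterates.
Variables (R : realType) (k : fieldType) (L : fieldType) (g : {rmorphism k -> L}).
Variable b : absval R L.
Notation nrm := (qmax (qnorm_absv b)).
Notation pnrm rho := (qmax (qnorm_poly b rho)).
Variables (P Q : {poly k} * {poly k}) (d e : nat) (C : R).
Hypothesis (d2 : (1 < d)%N).
Hypotheses (hP : form_bounds g b P d C) (hQ : form_bounds g b Q e C).

Let C1 : 1 <= C := fb_ge1 hP.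
Let C0 : 0 <= C. Proof. exact: le_trans C1. Qed.
Let Cp : 0 < C. Proof. exact: lt_le_trans C1. Qed.
Let nrm0 X : 0 <= nrm X. Proof. exact: qmax_ge0. Qed.

(** The induction runs on [C * nrm], where [C * C <= C ^+ d] because [1 < d]; the constant is then
    [C ^+ (d ^ n)], with no factor [n] in the exponent. *)
Lemma iter_ub n X : nrm (iter n (fmap g d P) X) <= (C * nrm X) ^+ (d ^ n).
Proof.
apply: (@le_trans _ _ (C * nrm (iter n (fmap g d P) X))); first by rewrite ler_peMl.
elim: n => [|n IH]; first by rewrite expn0 expr1.
rewrite iterS expnSr exprM.
apply: (@le_trans _ _ ((C * nrm (iter n (fmap g d P) X)) ^+ d)); last first.
  by rewrite lerXn2r ?nnegrE ?mulr_ge0 // exprn_ge0 // mulr_ge0.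
apply: le_trans (ler_wpM2l C0 (fb_ub hP _)) _.
by rewrite exprMn mulrA -expr2 ler_wpM2r ?exprn_ge0 // ler_weXn2l.
Qed.

Lemma iter_pub n (rho : R) (rho0 : 0 <= rho) (X : {poly L} * {poly L}) :
  pnrm rho0 (iter n (fmap (polyC \o g) d P) X) <= (C * pnrm rho0 X) ^+ (d ^ n).
Proof.
have p0 (Y : {poly L} * {poly L}) : 0 <= pnrm rho0 Y by exact: qmax_ge0.
apply: (@le_trans _ _ (C * pnrm rho0 (iter n (fmap (polyC \o g) d P) X))); first by rewrite ler_peMl.
elim: n => [|n IH]; first by rewrite expn0 expr1.
rewrite iterS expnSr exprM.
apply: (@le_trans _ _ ((C * pnrm rho0 (iter n (fmap (polyC \o g) d P) X)) ^+ d)); last first.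
  by rewrite lerXn2r ?nnegrE ?mulr_ge0 // exprn_ge0 // mulr_ge0.
apply: le_trans (ler_wpM2l C0 (fb_pub hP _ _)) _.
by rewrite exprMn mulrA -expr2 ler_wpM2r ?exprn_ge0 // ler_weXn2l.
Qed.

Lemma iter_lb n X : nrm X ^+ (d ^ n) <= C ^+ (d ^ n) * nrm (iter n (fmap g d P) X).
Proof.
apply: (@le_trans _ _ (nrm X ^+ (d ^ n) * C)); first by rewrite ler_peMr // exprn_ge0.
elim: n => [|n IH]; first by rewrite expn0 !expr1 mulrC.
rewrite iterS expnSr !exprM; set Y := iter n _ _ in IH *.
have H : (nrm X ^+ (d ^ n) * C) ^+ d <= (C ^+ (d ^ n) * nrm Y) ^+ d.
  by rewrite lerXn2r ?nnegrE ?mulr_ge0 ?exprn_ge0.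
rewrite -(ler_pM2r Cp) -mulrA -expr2.
apply: (@le_trans _ _ ((nrm X ^+ (d ^ n) * C) ^+ d)).
  by rewrite exprMn ler_wpM2l ?exprn_ge0 // ler_weXn2l.
apply: le_trans H _; rewrite exprMn -!mulrA ler_wpM2l ?exprn_ge0 // mulrC.
exact: (fb_lb hP).
Qed.

(** Each iteration multiplies the relative error by [C], so the admissible radius shrinks like the
    inverse of [C ^+ n]. This is the origin of the factor [n] in the final bound. *)
Lemma iter_taylor n (rho : R) (rho0 : 0 <= rho) X0 (X : {poly L} * {poly L}) (t : R) :
  0 <= t -> C ^+ n * t <= 1 ->
  pnrm rho0 (X.1 - X0.1%:P, X.2 - X0.2%:P) <= t * nrm X0 ->
  let Y := iter n (fmap (polyC \o g) d P) X in
  let Y0 := iter n (fmap g d P) X0 in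
  pnrm rho0 (Y.1 - Y0.1%:P, Y.2 - Y0.2%:P) <= C ^+ n * t * nrm Y0.
Proof.
move=> t0; elim: n => [|n IH] Ct XX0; cbv zeta; first by rewrite mul1r.
have Ct' : C ^+ n * t <= 1.
  by apply: le_trans Ct; rewrite exprS ler_wpM2r // ler_peMl // exprn_ge0.
have := IH Ct' XX0; cbv zeta; rewrite !iterS => H.
have := fb_taylor hP (e := C ^+ n * t) _ H; cbv zeta.
rewrite mulrA -exprS; apply.
by rewrite mulr_ge0 ?exprn_ge0.
Qed.

Lemma pnrm_of_taylor (rho : R) (rho0 : 0 <= rho) (X0 : L * L) (X : {poly L} * {poly L}) (t : R) :
  pnrm rho0 (X.1 - X0.1%:P, X.2 - X0.2%:P) <= t * nrm X0 -> 1 <= t ->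
  pnrm rho0 X <= C * t * nrm X0.
Proof.
move=> H t1.
have t0 : 0 <= t by apply: le_trans t1.
have H1 (x : {poly L}) (x0 : L) : b x0 <= nrm X0 ->
    qnorm_poly b rho0 (x - x0%:P) <= t * nrm X0 -> qnorm_poly b rho0 x <= C * t * nrm X0.
  move=> hx0 hx; rewrite -[x](subrK x0%:P); apply: le_trans (qnD _ _ _) _.
  rewrite -mulrA; apply: ler_pM.
  - exact: le_trans (kap_ge1 b).
  - by rewrite le_max qn_ge0.
  - exact: fb_kap hP.
  - rewrite ge_max hx /= pnormC; apply: le_trans hx0 _.
    by rewrite ler_peMl.
move: H; rewrite /qmax !ge_max /= => /andP[h1 h2].
by apply/andP; split; [apply: H1 h1 | apply: H1 h2]; rewrite /qmax /= le_max lexx ?orbT.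
Qed.

Definition coinc (n : nat) (S : comNzRingType) (h : k -> S) (X : S * S) : S :=
  wedge (iter n (fmap h d P) X) (fmap h e Q X).

Variables (n : nat) (X0 T : L * L).
Hypotheses (X01 : 1 <= nrm X0) (T1 : nrm T <= 1).

Let rho := (C ^+ n)^-1.
Let rho0 : 0 <= rho. Proof. by rewrite invr_ge0 exprn_ge0. Qed.

Lemma line_bound m : (m <= n)%N ->
  pnrm rho0 (iter m (fmap (polyC \o g) d P) (lineP X0 T)) <= C * nrm (iter m (fmap g d P) X0).
Proof.
move=> mn.
have Cm : C ^+ m * rho <= 1.
  rewrite /rho ler_pdivrMr ?exprn_gt0 // mul1r.
  exact: ler_weXn2l.
have L0 : pnrm rho0 ((lineP X0 T).1 - X0.1%:P, (lineP X0 T).2 - X0.2%:P) <= rho * nrm X0.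
  apply: (@le_trans _ _ rho); last by rewrite ler_peMr.
  have one (c : L) (t : L) : b t <= 1 -> qnorm_poly b rho0 (c%:P + t *: 'X - c%:P) <= rho.
    move=> t1; rewrite addrAC subrr add0r -mul_polyC; apply: le_trans (qnM _ _ _) _.
    by rewrite !qnorm_polyE (pnormX b rho0) pnormC ler_piMl.
  by move: T1; rewrite /qmax /= !ge_max => /andP[h1 h2]; rewrite !one.
have := iter_taylor (rho0 := rho0) (n := m) rho0 Cm L0; cbv zeta => H.
have := pnrm_of_taylor (t := 1) (le_trans H _) (lexx _).
rewrite mulr1; apply.
by rewrite ler_wpM2r.
Qed.

Lemma line_bound_form :
  pnrm rho0 (fmap (polyC \o g) e Q (lineP X0 T)) <= C ^+ 2 * nrm (fmap g e Q X0).
Proof.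
have L0 : pnrm rho0 ((lineP X0 T).1 - X0.1%:P, (lineP X0 T).2 - X0.2%:P) <= 1 * nrm X0.
  rewrite mul1r; apply: le_trans X01.
  have one (c : L) (t : L) : b t <= 1 -> qnorm_poly b rho0 (c%:P + t *: 'X - c%:P) <= 1.
    move=> t1; rewrite addrAC subrr add0r -mul_polyC; apply: le_trans (qnM _ _ _) _.
    rewrite !qnorm_polyE (pnormX b rho0) pnormC mulr_ile1 ?absv_ge0 // /rho invf_le1 ?exprn_gt0 //.
    exact: exprn_ege1.
  by move: T1; rewrite /qmax /= !ge_max => /andP[h1 h2]; rewrite !one.
have h := fb_taylor hQ (e := 1) _ L0; cbv zeta in h.
rewrite mulr1 in h; rewrite expr2.
by apply: pnrm_of_taylor => //; apply: h; rewrite lexx ler01.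
Qed.

(** Cauchy's estimate at radius [rho]: order [j] costs [C ^+ (n * j)]. The remaining power of [C]
    collects the two norm bounds along the line and a quasi-triangle inequality. *)
Lemma coinc_taylor j :
  b (coinc n (polyC \o g) (lineP X0 T))`_j <=
    C ^+ (5 + n * j) * (nrm (iter n (fmap g d P) X0) * nrm (fmap g e Q X0)).
Proof.
have Cj : 0 < C ^+ (n * j) by rewrite exprn_gt0.
have := pnorm_coef b rho0 (coinc n (polyC \o g) (lineP X0 T)) j.
rewrite /rho exprVn -exprM ler_pdivrMr // => H; apply: le_trans H _.
rewrite exprD mulrAC ler_wpM2r ?(ltW Cj) //.
apply: le_trans (qnD (qnorm_poly b rho0) _ _) _.
rewrite exprS -mulrA; apply: ler_pM.
- exact: le_trans (kap_ge1 b).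
- by rewrite le_max qn_ge0.
- exact: fb_kap hP.
rewrite qnN.
have B1 := line_bound (leqnn n); have B2 := line_bound_form.
have C34 : C * C ^+ 2 <= C ^+ 4 by rewrite -exprS ler_weXn2l.
have step (x y : {poly L}) : qnorm_poly b rho0 x <= C * nrm (iter n (fmap g d P) X0) ->
    qnorm_poly b rho0 y <= C ^+ 2 * nrm (fmap g e Q X0) ->
    qnorm_poly b rho0 (x * y) <= C ^+ 4 * (nrm (iter n (fmap g d P) X0) * nrm (fmap g e Q X0)).
  move=> hx hy; apply: le_trans (qnM _ _ _) _.
  apply: le_trans (ler_pM (qn_ge0 _ _) (qn_ge0 _ _) hx hy) _.
  by rewrite mulrACA ler_wpM2r // mulr_ge0.
move: B1 B2; rewrite /qmax !ge_max => /andP[x1 x2] /andP[y1 y2].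
by apply/andP; split; apply: step.
Qed.

(** Both sides have degree [(d ^ n) ^ 2 - e ^ 2] in [X0]. Powers of [nrm X0] are absorbed by
    [theta], whose absolute value is at least [nrm X0 ^+ q] up to constants. The hypothesis
    [2 * e <= d ^ n] gives [d ^ n + 1 <= 3 * q], whence the exponent of [C]. *)
Lemma weight_bound theta : (2 * e <= d ^ n)%N ->
  iter n (fmap g d P) X0 = (theta * (fmap g e Q X0).1, theta * (fmap g e Q X0).2) ->
  (nrm (iter n (fmap g d P) X0) * nrm (fmap g e Q X0)) ^+ (d ^ n - e) <=
    b theta ^+ (d ^ n + e) * C ^+ ((d ^ n - e) * (2 + 6 * e)).
Proof.
move=> en FE; set q := (d ^ n - e)%N; set M := (d ^ n)%N in en *.
have M0 : (0 < M)%N by rewrite expn_gt0 (ltn_trans _ d2).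
have Mq : M = (q + e)%N by rewrite /q; lia.
have nF : nrm (iter n (fmap g d P) X0) = b theta * nrm (fmap g e Q X0).
  by rewrite FE /qmax /= !absvM maxr_pMr // absv_ge0.
have t0 := absv_ge0 b theta.
have nX0 : 0 < nrm X0 by exact: lt_le_trans X01.
have hA := fb_ub hQ X0.
have hX : nrm X0 ^+ q <= C ^+ M.+1 * b theta.
  rewrite -(ler_pM2r (_ : 0 < nrm X0 ^+ e)) ?exprn_gt0 // -exprD -Mq.
  apply: le_trans (iter_lb n X0) _; rewrite -/M nF exprS.
  have : C ^+ M * (b theta * nrm (fmap g e Q X0)) <= C ^+ M * (b theta * (C * nrm X0 ^+ e)).
    by rewrite !ler_wpM2l // exprn_ge0.
  by move=> H; apply: le_trans H _; rewrite le_eqVlt; apply/orP; left; apply/eqP; ring.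
rewrite nF -mulrA -expr2.
apply: (@le_trans _ _ (b theta ^+ q * (C ^+ (2 * q) * (nrm X0 ^+ q) ^+ (2 * e)))).
  rewrite exprMn ler_wpM2l ?exprn_ge0 // -!exprM.
  have -> : C ^+ (2 * q) * nrm X0 ^+ (q * (2 * e)) = (C * nrm X0 ^+ e) ^+ (2 * q).
    by rewrite exprMn -exprM; congr (_ * _ ^+ _); lia.
  by rewrite lerXn2r ?nnegrE ?mulr_ge0 ?exprn_ge0.
have hX2 : (nrm X0 ^+ q) ^+ (2 * e) <= (C ^+ M.+1 * b theta) ^+ (2 * e).
  by rewrite lerXn2r ?nnegrE ?mulr_ge0 ?exprn_ge0.
apply: (@le_trans _ _ (b theta ^+ q * (C ^+ (2 * q) * (C ^+ M.+1 * b theta) ^+ (2 * e)))).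
  by rewrite ler_wpM2l ?exprn_ge0 // ler_wpM2l ?exprn_ge0.
have -> : b theta ^+ q * (C ^+ (2 * q) * (C ^+ M.+1 * b theta) ^+ (2 * e)) =
    b theta ^+ (M + e) * C ^+ (2 * q + M.+1 * (2 * e)).
  have -> : (M + e = q + 2 * e)%N by lia.
  rewrite exprMn -exprM (exprD (b theta)) (exprD C).
  by move: (b theta ^+ q) (C ^+ (2 * q)) (C ^+ _) (b theta ^+ _) => *; ring.
rewrite ler_wpM2l ?exprn_ge0 //; apply: ler_weXn2l => //.
by nia.
Qed.

End Iterates.

(** * The auxiliary determinant *)

Section DetBounds.
Variables (R : realType) (K : fieldType) (a : absval R K).

(** With the bound on an entry split into a row and a column factor, all permutations contribute at
    most the same product. *)
Lemma absv_det_le n (M : 'M[K]_n) (r s : 'I_n -> R) :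
  (forall i j, a (M i j) <= r i * s j) ->
  a (\det M) <= n`!%:R * (\prod_i r i * \prod_j s j).
Proof.
move=> H; apply: le_trans (absv_sum _ _ _ _) _.
rewrite -card_Sn -sum1_card natr_sum mulr_suml; apply: ler_sum => sg _.
rewrite mul1r absvM absvX absvN1 expr1n mul1r absv_prod.
rewrite [X in _ <= _ * X](reindex_inj (@perm_inj _ sg)) -big_split /=.
by apply: ler_prod => i _; rewrite absv_ge0 H.
Qed.

(** A permutation with nonzero product never raises the rank and preserves the sum of the ranks, so
    it moves nothing. The ranking replaces an explicit ordering of the indices. *)
Lemma det_ranked n (M : 'M[K]_n) (rank : 'I_n -> nat) :
  (forall i j, M i j != 0 -> i = j \/ (rank j < rank i)%N) ->
  \det M = \prod_i M i i.
Proof.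
move=> H; rewrite /determinant (bigD1 (1%g : {perm 'I_n})) //= odd_perm1 expr0 mul1r.
rewrite [X in _ + X]big1 ?addr0 => [|sg sg1].
  by apply: eq_bigr => i _; rewrite perm1.
suff [i /eqP Mi] : exists i, M i (sg i) == 0 by rewrite (bigD1 i) //= Mi mul0r mulr0.
apply/existsP; apply: contraNT sg1 => /existsPn Mn.
have le i : (rank (sg i) <= rank i)%N.
  by have [<-|/ltnW] := H _ _ (Mn i).
have sumE : \sum_i rank (sg i) = \sum_i rank i.
  by rewrite [RHS](reindex_inj (@perm_inj _ sg)).
apply/eqP/permP => i; rewrite perm1; have [//|lt] := H _ _ (Mn i).
have : (\sum_i rank (sg i) < \sum_i rank i)%N.
  rewrite (bigD1 i) //= [X in (_ < X)%N](bigD1 i) //= -addSn; apply: leq_add => //.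
  by apply: leq_sum => j _.
by rewrite sumE ltnn.
Qed.

(** Schur complement: [XM *m invmx BM *m PM] is diagonal by the third hypothesis, which describes
    [invmx BM *m PM] as the solution of a linear system. So the bordered determinant is the product
    of two known ones, and its Leibniz expansion bounds that product. *)
Lemma block_det_bound (I : finType) (t : nat) (B : I -> I -> K) (P : I -> 'I_t -> K)
    (X : 'I_t -> I -> K) (D : 'I_t -> K) (rank : I -> nat) (r s : I -> R) (sg : R) :
  (forall i j, B i j != 0 -> i = j \/ (rank j < rank i)%N) ->
  (forall i, B i i != 0) ->
  (forall c : I -> 'I_t -> K, (forall i u, \sum_j B i j * c j u = P i u) ->
     forall u v, \sum_j X u j * c j v = if u == v then D v else 0) ->
  (forall i j, a (B i j) <= r i * s j) ->
  (forall i u, a (P i u) <= r i * sg) ->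
  (forall u j, a (X u j) <= s j) ->
  (forall i, 0 <= r i) -> (forall i, 0 <= s i) -> 0 <= sg ->
  \prod_i a (B i i) * \prod_u a (D u) <=
    (#|I| + t)`!%:R * (\prod_i r i * \prod_i s i * sg ^+ t).
Proof.
move=> Btri Bd sol Bb Pb Xb r0 s0 sg0.
pose BM : 'M[K]_#|I| := \matrix_(i, j) B (enum_val i) (enum_val j).
pose PM : 'M[K]_(#|I|, t) := \matrix_(i, u) P (enum_val i) u.
pose XM : 'M[K]_(t, #|I|) := \matrix_(u, j) X u (enum_val j).
have prodE (T : comNzRingType) (f : I -> T) : \prod_(i < #|I|) f (enum_val i) = \prod_i f i.
  by rewrite -[LHS]big_enum_val; apply: eq_bigl => i; rewrite inE.
have detB : \det BM = \prod_i B i i.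
  rewrite (@det_ranked _ _ (fun i => rank (enum_val i))) => [|i j].
    by rewrite -prodE; apply: eq_bigr => i _; rewrite mxE.
  by rewrite mxE => /Btri [/enum_val_inj|]; [left|right].
have Bu : BM \in unitmx.
  by rewrite unitmxE unitfE detB; apply/prodf_neq0 => i _.
pose CM := invmx BM *m PM.
have XC : XM *m CM = diag_mx (\row_u D u).
  apply/matrixP => u v; rewrite !mxE.
  have := sol (fun j v => CM (enum_rank j) v) _ u v.
  rewrite sum_enum_val; under eq_bigr do rewrite enum_valK.
  move=> H; transitivity (if u == v then D v else 0); last by case: eqP => [->|].
  rewrite -H; first by apply: eq_bigr => j _; rewrite mxE.
  move=> i w; rewrite sum_enum_val; under eq_bigr do rewrite enum_valK.
  have /matrixP /(_ (enum_rank i) w) : BM *m CM = PM by rewrite /CM mulKVmx.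
  by rewrite !mxE enum_rankK => <-; apply: eq_bigr => j _; rewrite [BM _ _]mxE enum_rankK.
have detM : \det (block_mx BM PM XM 0) = \det BM * \det (- diag_mx (\row_u D u)).
  have -> : block_mx BM PM XM 0 = block_mx 1%:M 0 (XM *m invmx BM) 1%:M *m
      block_mx BM PM 0 (- diag_mx (\row_u D u)).
    rewrite mulmx_block !mul1mx !mul0mx !addr0 mulmxKV // -mulmxA -/CM XC.
    by rewrite addrN.
  by rewrite det_mulmx det_lblock !det1 !mul1r det_ublock.
have -> : \prod_i a (B i i) * \prod_u a (D u) = a (\det (block_mx BM PM XM 0)).
  rewrite detM absvM detB absv_prod; congr (_ * _).
  rewrite -scaleN1r detZ absvM absvX absvN1 expr1n mul1r det_diag absv_prod.
  by apply: eq_bigr => u _; rewrite mxE.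
pose rr (i : 'I_(#|I| + t)) := match fintype.split i with inl j => r (enum_val j) | inr _ => 1 end.
pose ss (i : 'I_(#|I| + t)) := match fintype.split i with inl j => s (enum_val j) | inr _ => sg end.
have := @absv_det_le _ (block_mx BM PM XM 0) rr ss.
rewrite !big_split_ord /=.
have -> : \prod_(i < #|I|) rr (lshift t i) = \prod_i r i.
  by rewrite -prodE; apply: eq_bigr => i _; rewrite /rr (unsplitK (inl i)).
have -> : \prod_(i < #|I|) ss (lshift t i) = \prod_i s i.
  by rewrite -prodE; apply: eq_bigr => i _; rewrite /ss (unsplitK (inl i)).
have -> : \prod_(i < t) rr (rshift #|I| i) = 1.
  by apply: big1 => i _; rewrite /rr (unsplitK (inr i)).
have -> : \prod_(i < t) ss (rshift #|I| i) = sg ^+ t.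
  by under eq_bigr do rewrite /ss (unsplitK (inr _)); rewrite prodr_const card_ord.
rewrite mulr1 (mulrA (\prod_i r i)); apply => i j.
rewrite -[i]splitK -[j]splitK.
case: (fintype.split i) => i'; case: (fintype.split j) => j' /=; rewrite /rr /ss
  ?(unsplitK (inl _)) ?(unsplitK (inr _)).
- by rewrite block_mxEul mxE.
- by rewrite block_mxEur mxE.
- by rewrite block_mxEdl mxE mul1r.
- by rewrite block_mxEdr mxE absv0 mul1r.
Qed.

End DetBounds.

Section Jets.
Variable K : fieldType.
Implicit Types (Q : {poly K}) (x : K).

Lemma jet_dvdp Q x m :
  (forall j, (j < m)%N -> (Q \Po ('X + x%:P))`_j = 0) <-> ('X - x%:P) ^+ m %| Q.
Proof.
split=> [H|].
  set T := Q \Po ('X + x%:P) in H.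
  have TE : T = drop_poly m T * 'X^m.
    rewrite -[LHS](poly_take_drop m); have -> : take_poly m T = 0.
      by apply/polyP => j; rewrite coef_take_poly coef0; case: ltnP => // /H.
    by rewrite add0r.
  have -> : Q = T \Po ('X - x%:P) by rewrite /T comp_polyXaddC_K.
  by rewrite TE rmorphM /= rmorphXn /= comp_polyX dvdp_mull.
move=> /dvdpP [S ->] j jm; rewrite rmorphM rmorphXn /= comp_polyB comp_polyX comp_polyC.
by rewrite addrK coefMXn jm.
Qed.

Lemma prod_XsubC_dvdp (I : eqType) (s : seq I) (w : I -> K) (m : I -> nat) Q :
  uniq s -> injective w -> (forall o, o \in s -> ('X - (w o)%:P) ^+ m o %| Q) ->
  \prod_(o <- s) ('X - (w o)%:P) ^+ m o %| Q.
Proof.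
move=> us winj; elim: s us => [|o s IH] /=; first by rewrite big_nil dvd1p.
move=> /andP[os us] H; rewrite big_cons Gauss_dvdp.
  by rewrite H ?mem_head // IH // => o' o's; apply: H; rewrite inE o's orbT.
elim: s os us {IH H} => [|o' s IH]; first by rewrite big_nil coprimep1.
rewrite inE negb_or => /andP[oo' os] /andP[_ us].
rewrite big_cons coprimepMr IH // andbT coprimep_expl // coprimep_expr //.
by rewrite coprimep_XsubC2 // subr_eq0; apply: contra oo' => /eqP /winj ->.
Qed.

(** Local expansion at [z] of a form of degree [D]; the degree matters only at infinity. *)
Definition jet (D : nat) (z : option K) Q : {poly K} :=
  if z is Some x then Q \Po ('X + x%:P) else revp D Q.

Lemma jet_sum D z (I : finType) (f : I -> {poly K}) (c : I -> K) j :
  (jet D z (\sum_i c i *: f i))`_j = \sum_i c i * (jet D z (f i))`_j.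
Proof.
case: z => [x|] /=.
  by rewrite raddf_sum coef_sum; apply: eq_bigr => i _; rewrite /= comp_polyZ coefZ.
rewrite coef_poly; case: ifP => jD.
  by rewrite coef_sum; apply: eq_bigr => i _; rewrite coefZ coef_poly jD.
by rewrite big1 // => i _; rewrite coef_poly jD mulr0.
Qed.

Lemma jetB D z P Q j : (jet D z (P - Q))`_j = (jet D z P)`_j - (jet D z Q)`_j.
Proof.
case: z => [x|] /=; first by rewrite raddfB coefB.
by rewrite !coef_poly coefB; case: ifP; rewrite ?subr0.
Qed.

End Jets.

Section DetInequality.
Variables (R : realType) (K : fieldType) (a : absval R K).
Variables (r t : nat) (w : 'I_r -> K) (m : option 'I_r -> nat) (lc : K).
Hypothesis (winj : injective w) (lc0 : lc != 0).

Let pt (o : option 'I_r) : option K := omap w o.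
Let eta : {poly K} := lc *: \prod_(o < r) ('X - (w o)%:P) ^+ m (Some o).
Let N : nat := (\sum_o m o)%N.

Let NE : N = (m None + \sum_(o < r) m (Some o))%N.
Proof.
rewrite /N (bigD1 None) //=; congr (_ + _)%N.
rewrite (reindex_omap Some id) /=; last by case.
by apply: eq_bigl => o; rewrite eqxx.
Qed.

Let size_eta : size eta = (\sum_(o < r) m (Some o)).+1.
Proof.
rewrite size_scale // size_prod => [|o _]; last by rewrite expf_neq0 // polyXsubC_eq0.
under eq_bigr do rewrite size_exp_XsubC -addn1.
by rewrite big_split /= sum1_card -addSn addnK.
Qed.

Let eta0 : eta != 0. Proof. by rewrite -size_poly_eq0 size_eta. Qed.

Let coef_w (o : 'I_r) : {poly K} := lc *: \prod_(o' < r | o' != o) ('X - (w o')%:P) ^+ m (Some o').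

Let eta_w o : eta = ('X - (w o)%:P) ^+ m (Some o) * coef_w o.
Proof. by rewrite /eta (bigD1 o) //= scalerAr. Qed.

Let I := {o : option 'I_r & 'I_(m o)}.

(** Quotients of [eta] by powers of [X - w], and multiples of [eta] by powers of [X] for the zero at
    infinity: up to the factor [eta], these are the principal parts at all the zeros. *)
Let bas (i : I) : {poly K} := match tag i with
  | Some o => ('X - (w o)%:P) ^+ (tagged i) * coef_w o
  | None => eta * 'X^(m None - (tagged i).+1) end.

Let cardI : #|{: I}| = N.
Proof.
rewrite /N card_tagged sumnE big_map big_enum /=.
by apply: eq_bigr => o _; rewrite card_ord.
Qed.

Let jetb (o : option 'I_r) (j : 'I_(m o)) (i : I) : K := (jet N.-1 (pt o) (bas i))`_j.

Let bas_Some_dvd (o o' : 'I_r) (k : 'I_(m (Some o'))) : o != o' ->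
  ('X - (w o)%:P) ^+ m (Some o) %| bas (Tagged (fun o => 'I_(m o)) (k : 'I_(m (Some o')))).
Proof.
move=> oo'; rewrite /bas /= dvdp_mull // /coef_w dvdpZr //.
by rewrite (bigD1 o) //= dvdp_mulr.
Qed.

Let size_coef_w o : (size (coef_w o) + m (Some o) = size eta)%N.
Proof.
have c0 : coef_w o != 0.
  by apply: contraNneq eta0 => H; rewrite (eta_w o) H mulr0.
rewrite (eta_w o) size_mul // ?expf_neq0 ?polyXsubC_eq0 // size_exp_XsubC.
by rewrite addnC.
Qed.

Let size_bas (i : I) : (size (bas i) <= N)%N.
Proof.
case: i => [ [ o|] k]; rewrite /bas /=.
  have := size_coef_w o; rewrite size_eta => E; have kl := ltn_ord k.
  apply: leq_trans (size_polyMleq _ _) _; rewrite size_exp_XsubC NE.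
  by move: E kl; set x := size _; set y := (\sum_(_ < _) _)%N; lia.
rewrite size_mulXn // size_eta NE.
by have := ltn_ord k; set y := (\sum_(_ < _) _)%N; lia.
Qed.

(* With the opposite order on the poles, the matrix of jets is triangular. *)
Let jetb_same (o : option 'I_r) (j k : 'I_(m o)) :
  jetb j (Tagged (fun o => 'I_(m o)) k) =
    if (k <= j)%N then (jet N (pt o) eta)`_(m o + j - k) else 0.
Proof.
rewrite /jetb /bas /=; case: o j k => [ o|] j k /=.
  rewrite (eta_w o) !rmorphM !rmorphXn /= !comp_polyB !comp_polyX !comp_polyC !addrK.
  rewrite !coefXnM; have kl := ltn_ord k; case: ltnP => jk //.
  by rewrite ifF; [congr (_`_ _) |]; lia.
have kl := ltn_ord k; have jl := ltn_ord j.
have mN : (m None <= N)%N by rewrite NE leq_addr.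
rewrite !coef_poly ifT; last by lia.
rewrite coefMXn; case: (leqP k j) => kj.
  case: (ltnP _ (m None - k.+1)) => h1.
    by rewrite ifF //; lia.
  by rewrite ifT; [congr (_`_ _) |]; lia.
case: ifP => // _; apply/nth_default; rewrite size_eta.
by move: mN; rewrite NE; set y := (\sum_(_ < _) _)%N; lia.
Qed.

Let jetb_diff (o o' : option 'I_r) (j : 'I_(m o)) (k : 'I_(m o')) : o != o' ->
  jetb j (Tagged (fun o => 'I_(m o)) k) = 0.
Proof.
rewrite /jetb; case: o j => [ o|] j /=; case: o' k => [ o'|] k oo'; last by [].
- apply: (jet_dvdp _ _ _).2 (ltn_ord j); apply: bas_Some_dvd.
  by apply: contra oo' => /eqP ->.
- apply: (jet_dvdp _ _ _).2 (ltn_ord j).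
  by rewrite /bas /= dvdp_mulr // (eta_w o) dvdp_mulr.
- rewrite coef_poly; case: ifP => // jN; apply/nth_default.
  rewrite /bas /=; have := size_coef_w o'; rewrite size_eta => E.
  apply: leq_trans (size_polyMleq _ _) _; rewrite size_exp_XsubC.
  have kl := ltn_ord k; have jl := ltn_ord j.
  by move: E; rewrite NE; set x := size _; set y := (\sum_(_ < _) _)%N; lia.
Qed.

Variables (p : 'I_t -> K) (U : 'I_t -> {poly K}).
Hypothesis sU : forall u, (size (U u) <= N)%N.
Hypothesis Up : forall u v, u != v -> (U u).[p v] = 0.
Hypothesis eta_p : forall u, eta.[p u] != 0.

(** A form of degree [N - 1] cannot have [N] zeros with multiplicity; infinity is accounted for by
    the degree. Hence a solution of the linear system of jets is an identity of polynomials. *)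
Let zero_of_jets (Q : {poly K}) : (size Q <= N)%N ->
  (forall o (j : 'I_(m o)), (jet N.-1 (pt o) Q)`_j = 0) -> Q = 0.
Proof.
move=> sQ H; apply/eqP; apply: contraT => Q0.
have dv : eta %| Q.
  rewrite dvdpZl //; apply: prod_XsubC_dvdp => // [|o _]; first exact: index_enum_uniq.
  by apply/jet_dvdp => j jm; exact: (H (Some o) (Ordinal jm)).
have := dvdp_leq Q0 dv; rewrite size_eta.
set y := (\sum_(_ < _) _)%N => yQ.
have nm j : (j < m None)%N -> Q`_(N.-1 - j) = 0.
  by move=> jm; have := H None (Ordinal jm); rewrite /= coef_poly ifT //; move: NE; lia.
have lead : Q`_(size Q).-1 != 0 by rewrite -lead_coefE lead_coef_eq0.
have yN : N = (m None + y)%N by exact: NE.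
have := nm (N - size Q)%N; have -> : (N.-1 - (N - size Q) = (size Q).-1)%N by lia.
have lt : (N - size Q < m None)%N.
  suff gen (s N0 m0 y0 : nat) : (y0 < s)%N -> (s <= N0)%N -> N0 = (m0 + y0)%N -> (N0 - s < m0)%N.
    exact: gen yQ sQ yN.
  lia.
by move=> /(_ lt)/eqP; rewrite (negbTE lead).
Qed.

Variables (h : option 'I_r -> R) (rho sg : R).
Hypotheses (rho01 : 0 < rho <= 1) (sg0 : 0 <= sg) (h0 : forall o, 0 <= h o).
Hypothesis eta_jet : forall o j, a (jet N (pt o) eta)`_j <= h o * rho^-1 ^+ j.
Hypothesis U_jet : forall u o j, a (jet N.-1 (pt o) (U u))`_j <= h o * rho^-1 ^+ j * sg.
Hypotheses (p_w : forall u o, rho <= a (p u - w o)) (p_rho : forall u, a (p u) <= rho^-1).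
Hypothesis K0 : forall o, (0 < m o)%N -> (jet N (pt o) eta)`_(m o) != 0.

Lemma det_inequality :
  \prod_o a (jet N (pt o) eta)`_(m o) ^+ m o * \prod_u (a (U u).[p u] / a eta.[p u]) <=
  (N + t)`!%:R * (\prod_o h o ^+ m o * rho^-1 ^+ (\sum_o m o ^ 2)%N * sg ^+ t).
Proof.
have [rho0 rho1] := andP rho01.
have ri0 : 0 <= rho^-1 by rewrite invr_ge0 ltW.
have ri1 : 1 <= rho^-1 by rewrite invf_ge1.
pose B (i i' : I) := jetb (tagged i) i'.
pose P (i : I) u := (jet N.-1 (pt (tag i)) (U u))`_(tagged i).
pose X u (i : I) := (bas i).[p u] / eta.[p u].
pose D u := (U u).[p u] / eta.[p u].
(* Row [j] costs [rho^-1 ^+ j] and column [k] costs [rho^-1 ^+ (m o - k)]. At equal indices this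
   makes [m o], for each of the [m o] indices at [o]: the squares of the multiplicities arise
   here. *)
pose rr (i : I) := h (tag i) * rho^-1 ^+ tagged i.
pose ss (i : I) := rho^-1 ^+ (m (tag i) - tagged i).
have prod_sig (T : comNzRingType) (F : I -> T) :
    \prod_i F i = \prod_o \prod_(j < m o) F (Tagged (fun o => 'I_(m o)) j).
  by rewrite sig_big_dep /=; apply: eq_bigr => -[].
have := @block_det_bound R K a I t B P X D (fun i => tagged i) rr ss sg.
have -> : \prod_i a (B i i) = \prod_o a (jet N (pt o) eta)`_(m o) ^+ m o.
  rewrite prod_sig; apply: eq_bigr => o _.
  under eq_bigr do rewrite /B jetb_same leqnn addnK.
  by rewrite /= prodr_const card_ord.
have -> : \prod_i rr i * \prod_i ss i = \prod_o h o ^+ m o * rho^-1 ^+ (\sum_o m o ^ 2)%N.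
  rewrite -big_split /= expr_sum -big_split /= prod_sig.
  apply: eq_bigr => o _; rewrite -mulnn exprM -exprMn.
  transitivity (\prod_(j < m o) (h o * rho^-1 ^+ m o)); last by rewrite prodr_const card_ord.
  apply: eq_bigr => j _.
  by rewrite /rr /ss /= -mulrA -exprD subnKC // ltnW.
have -> : \prod_u a (D u) = \prod_u (a (U u).[p u] / a eta.[p u]).
  by apply: eq_bigr => u _; rewrite absvM absvV.
rewrite cardI; apply.
- move=> [ o j] [ o' k]; rewrite /B /=; have [E|oo'] := eqVneq o o'; last first.
    by rewrite jetb_diff // eqxx.
  subst o'; rewrite jetb_same; case: (leqP k j) => [kj|]; last by rewrite eqxx.
  move=> _; move: kj; rewrite leq_eqVlt => /orP[/eqP kj|]; last by right.
  by left; congr existT; apply: val_inj.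
- move=> [ o j]; rewrite /B jetb_same leqnn addnK.
  by apply: K0; exact: leq_ltn_trans (ltn_ord j).
- move=> c Hc u v.
  have Q0 : U v - \sum_i c i v *: bas i = 0.
    apply: zero_of_jets => [|o j].
      apply: leq_trans (size_polyD _ _) _; rewrite geq_max sU size_polyN.
      apply: leq_trans (size_sum _ _ _) _; apply/bigmax_leqP => i _.
      by apply: leq_trans (size_scale_leq _ _) _; exact: size_bas.
    rewrite jetB jet_sum; apply/eqP; rewrite subr_eq0; apply/eqP.
    rewrite -[LHS](Hc (Tagged (fun o => 'I_(m o)) j) v); apply: eq_bigr => i _.
    by rewrite mulrC.
  move/eqP: Q0; rewrite subr_eq0 => /eqP Q0.
  (* [U v] is now a combination of the [bas i]; evaluation at [p u] vanishes off the diagonal since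
     [U v] vanishes at the other points. *)
  have -> : \sum_j X u j * c j v = (U v).[p u] / eta.[p u].
    rewrite Q0 horner_sum mulr_suml; apply: eq_bigr => i _.
    by rewrite hornerZ /X [LHS]mulrC mulrA.
  have [->|uv] := eqVneq u v; first by [].
  by rewrite Up ?mul0r // eq_sym.
- move=> [ o j] [ o' k]; rewrite /B /rr /ss /=.
  have [E|oo'] := eqVneq o o'; last first.
    by rewrite jetb_diff // absv0 !mulr_ge0 // exprn_ge0.
  subst o'; rewrite jetb_same; case: (leqP k j) => [kj|_]; last by rewrite absv0 !mulr_ge0 // exprn_ge0.
  apply: le_trans (eta_jet _ _) _; rewrite -mulrA ler_wpM2l // -exprD.
  by apply: ler_weXn2l => //; have := ltn_ord k; lia.
- by move=> [ o j] u; rewrite /P /rr /=; apply: U_jet.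
- move=> u [ [ o|] k]; rewrite /X /ss /bas /=.
    have e0 := eta_p u; have kl := ltn_ord k.
    have pw : p u - w o != 0.
      by apply/eqP => E; have := p_w u o; rewrite E absv0 leNgt rho0.
    have -> : (('X - (w o)%:P) ^+ k * coef_w o).[p u] / eta.[p u] = (p u - w o)^-1 ^+ (m (Some o) - k).
      move: e0; rewrite (eta_w o) !hornerM !horner_exp !hornerXsubC mulf_eq0 negb_or => /andP[_ c0].
      rewrite -[X in _ / (_ ^+ X * _)](subnK (ltnW kl)) exprD exprVn; field.
      by rewrite c0 !expf_neq0.
    rewrite absvX absvV lerXn2r ?nnegrE ?invr_ge0 ?absv_ge0 //; first exact: ltW.
    by rewrite lef_pV2 ?posrE ?absv_gt0 //; apply: p_w.
  rewrite hornerM hornerXn mulrAC divff ?mul1r // absvX.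
  apply: (@le_trans _ _ (rho^-1 ^+ (m None - k.+1))).
    by rewrite lerXn2r ?nnegrE ?absv_ge0.
  by apply: ler_weXn2l => //; rewrite /=; lia.
- by move=> i; rewrite mulr_ge0 // exprn_ge0.
- by move=> i; rewrite exprn_ge0.
- by [].
Qed.

End DetInequality.

(** * Symmetric functions of the zeros; forms as polynomials *)

Lemma rmorph_mmap n (k S T : comNzRingType) (f : k -> S) (phi : {rmorphism S -> T})
    (h : 'I_n -> S) (p : mpoly n k) :
  phi (mmap f h p) = mmap (phi \o f) (phi \o h) p.
Proof.
rewrite /mmap rmorph_sum; apply: eq_bigr => m _.
rewrite rmorphM rmorph_prod; congr (_ * _).
by apply: eq_bigr => j _; rewrite rmorphXn.
Qed.

Lemma eq_mmap n (k S : comNzRingType) (f : k -> S) (h h' : 'I_n -> S) (p : mpoly n k) :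
  h =1 h' -> mmap f h p = mmap f h' p.
Proof.
move=> hh; rewrite /mmap; apply: eq_bigr => m _; congr (_ * _).
by apply: eq_bigr => j _; rewrite hh.
Qed.

Lemma eq_mmapl n (k S : comNzRingType) (f f' : k -> S) (h : 'I_n -> S) (p : mpoly n k) :
  f =1 f' -> mmap f h p = mmap f' h p.
Proof. by move=> ff; rewrite /mmap; apply: eq_bigr => m _; rewrite ff. Qed.

Lemma mmap_comp_mpoly n m (k S : comNzRingType) (f : {rmorphism k -> S}) (h : 'I_m -> S)
    (lq : n.-tuple (mpoly m k)) (p : mpoly n k) :
  mmap f h (comp_mpoly lq p) = mmap f (fun j => mmap f h (tnth lq j)) p.
Proof.
rewrite /comp_mpoly rmorph_mmap; apply: eq_mmapl => c /=; exact: mmapC.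
Qed.

Section RootProducts.
Variables (k L : fieldType) (i : {rmorphism k -> L}).

Lemma mmap_mesym n (S T : comNzRingType) (f : {rmorphism S -> T}) (h : 'I_n -> T) j :
  mmap f h (mesym n S j) = \sum_(A : {set 'I_n} | #|A| == j) \prod_(l in A) h l.
Proof.
rewrite /mesym raddf_sum /=; apply: eq_bigr => A _; rewrite rmorph_prod /=.
by apply: eq_bigr => l _; rewrite mmapX mmap1U.
Qed.

(* A product over all roots of a polynomial over [k] is a symmetric function of
   them, hence is defined over [k]. *)
Lemma root_product_rational (eta : {poly k}) (rs : seq L) (Q : {poly {poly k}}) :
  eta != 0 -> map_poly i eta = i (lead_coef eta) *: \prod_(z <- rs) ('X - z%:P) ->
  exists P : {poly k}, map_poly i P =
    \prod_(z <- rs) (map_poly (map_poly i) Q).[z%:P].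
Proof.
move=> eta0 etaE; pose r := size rs.
(* The coefficients stay in [{poly k}]: the inner indeterminate is a spare parameter, later the
   local coordinate of a Taylor expansion or the variable of a pencil. *)
pose f : mpoly r {poly k} :=
  \prod_(j < r) (map_poly (@mpolyC r _) Q).[mpolyX _ (mnm1 j)].
have fsym : f \is @symmetric r {poly k}.
  apply/issymP => s; rewrite /f rmorph_prod /= [RHS](reindex_inj (@perm_inj _ s)) /=.
  apply: eq_bigr => j _; rewrite -horner_map /=; congr (_.[_]); last first.
    by rewrite /msym mmapX mmap1U.
  by rewrite -map_poly_comp; apply: eq_map_poly => c /=; rewrite /msym mmapC.
have [t [tE _]] := sym_fundamental fsym.
pose cs := map_tuple (@polyC L) (in_tuple rs).
pose E := mmap (map_poly i) (tnth cs) : mpoly r {poly k} -> {poly L}.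
have Ef : E f = \prod_(z <- rs) (map_poly (map_poly i) Q).[z%:P].
  rewrite /E /f rmorph_prod /= [RHS](big_nth 0) big_mkord; apply: eq_bigr => j _.
  rewrite -horner_map /=; congr (_.[_]); last first.
    rewrite mmapX mmap1U tnth_map; congr (_%:P).
    by rewrite (tnth_nth 0).
  by rewrite -map_poly_comp; apply: eq_map_poly => c /=; rewrite mmapC.
(* Vieta's formulas: up to sign and leading coefficient these are coefficients of [eta]. *)
have Es j : (j <= r)%N -> exists c : k, E (mesym r _ j) = (i c)%:P.
  move=> jr; exists ((-1) ^+ j * (lead_coef eta)^-1 * eta`_(r - j)).
  have jr' : (j < r.+1)%N by [].
  have := mroots_coeff cs (Ordinal jr') => /=.
  have -> : \prod_(c <- cs) ('X - c%:P) = map_poly polyC (\prod_(z <- rs) ('X - z%:P)).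
    rewrite rmorph_prod /= big_map; apply: eq_bigr => z _.
    by rewrite rmorphB /= map_polyX map_polyC.
  have -> : \prod_(z <- rs) ('X - z%:P) = (i (lead_coef eta))^-1 *: map_poly i eta.
    by rewrite etaE scalerA mulVf ?scale1r // fmorph_eq0 lead_coef_eq0.
  rewrite coef_map coefZ coef_map /E /meval !mmap_mesym => H.
  transitivity ((-1) ^+ j * ((i (lead_coef eta))^-1 * i eta`_(r - j))%:P : {poly L}).
    by rewrite H mulrA -exprMn mulrNN mulr1 expr1n mul1r.
  have -> : i ((-1) ^+ j * (lead_coef eta)^-1 * eta`_(r - j)) =
      (-1) ^+ j * ((i (lead_coef eta))^-1 * i eta`_(r - j)).
    by rewrite !rmorphM rmorphXn rmorphN1 fmorphV mulrA.
  by rewrite [in RHS]polyCM polyC_exp polyCN.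
have [c cE] : exists c : 'I_r -> k, forall j : 'I_r, E (mesym r _ j.+1) = (i (c j))%:P.
  have H (j : 'I_r) : exists c : k, E (mesym r _ j.+1) = (i c)%:P by exact: Es.
  by have [c cE] := choice H; exists c.
exists (mmap idfun (fun j => (c j)%:P) t).
rewrite -Ef -tE /E mmap_comp_mpoly rmorph_mmap.
rewrite (eq_mmap _ (h' := fun j => (i (c j))%:P)); last by move=> j /=; rewrite map_polyC.
by apply: eq_mmap => j; rewrite tnth_mktuple -cE.
Qed.

End RootProducts.

Section Bieval.
Variables (k : fieldType).

Definition dehom (p : mpoly 2 k) : {poly k} := bieval polyC p 'X 1.

Definition dehom2 (F : mpoly 2 k * mpoly 2 k) := (dehom F.1, dehom F.2).

Lemma bievalE (S : comNzRingType) (g : k -> S) (p : mpoly 2 k) x y :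
  bieval g p x y = \sum_(m <- msupp p) g (mcoeff m p) * (x ^+ m ord0 * y ^+ m ord_max).
Proof.
rewrite /bieval /mmap; apply: eq_bigr => m _; congr (_ * _).
by rewrite /mmap1 !big_ord_recl big_ord0 mulr1 /=; congr (_ ^+ _ * _ ^+ _); congr (m _); apply: val_inj.
Qed.

Lemma mdeg2 (m : multinom 2) : mdeg m = (m ord0 + m ord_max)%N.
Proof.
by rewrite mdegE !big_ord_recl big_ord0 addn0; congr (_ + m _)%N; apply: val_inj.
Qed.

Lemma homog2P d (p : mpoly 2 k) : p \is ishomog1 d mdeg ->
  forall m, m \in msupp p -> (m ord0 + m ord_max)%N = d.
Proof. by move=> /dhomogP H m mp; rewrite -mdeg2; exact: H. Qed.

Lemma dehom_size d (p : mpoly 2 k) : p \is ishomog1 d mdeg -> (size (dehom p) <= d.+1)%N.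
Proof.
move=> /homog2P H; rewrite /dehom bievalE.
rewrite big_seq; elim/big_rec: _ => [|m q mp IH]; first by rewrite size_poly0.
apply: leq_trans (size_polyD _ _) _; rewrite geq_max IH andbT.
rewrite expr1n mulr1 mul_polyC; apply: leq_trans (size_scale_leq _ _) _.
by rewrite size_polyXn ltnS -(H m mp) leq_addr.
Qed.

Lemma bieval_hform (S : comNzRingType) (g : {rmorphism k -> S}) d (p : mpoly 2 k) x y :
  p \is ishomog1 d mdeg -> bieval g p x y = hform (fun j => g (dehom p)`_j) d (x, y).
Proof.
move=> /homog2P H; rewrite bievalE /hform /dehom bievalE /=.
under [RHS]eq_bigr do rewrite coef_sum rmorph_sum -mulrA mulr_suml.
rewrite exchange_big /= big_seq [RHS]big_seq; apply: eq_bigr => m mp.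
have md : (m ord0 < d.+1)%N by rewrite ltnS -(H m mp) leq_addr.
rewrite (bigD1 (Ordinal md)) //= [X in _ + X]big1 ?addr0 => [|j jm].
  rewrite expr1n mulr1 coefCM coefXn eqxx mulr1.
  by congr (_ * (_ * _ ^+ _)); rewrite -(H m mp) addKn.
rewrite expr1n mulr1 coefCM coefXn; case: eqP => [E|]; last by rewrite mulr0 rmorph0 mul0r.
by case/eqP: jm; apply: val_inj.
Qed.

Lemma comp_homog d D (p q1 q2 : mpoly 2 k) : p \is ishomog1 d mdeg ->
  q1 \is ishomog1 D mdeg -> q2 \is ishomog1 D mdeg ->
  comp_mpoly [tuple q1; q2] p \is ishomog1 (d * D) mdeg.
Proof.
move=> /homog2P Hp H1 H2; rewrite comp_mpolyE big_seq; apply: rpred_sum => m mp.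
apply: rpredZ; rewrite !big_ord_recl big_ord0 mulr1 -(Hp m mp) mulnDl.
rewrite !(tnth_nth 0) /=.
have HX q n : q \is ishomog1 D mdeg -> q ^+ n \is ishomog1 (n * D) mdeg.
  move=> Hq; elim: n => [|n IH]; first by rewrite expr0 dhomog1.
  by rewrite exprS mulSn; apply: dhomogM.
have -> : lift ord0 ord0 = ord_max :> 'I_2 by apply: val_inj.
by apply: dhomogM; apply: HX.
Qed.

Lemma lift_iter_homog d (F : mpoly 2 k * mpoly 2 k) n :
  F.1 \is ishomog1 d mdeg -> F.2 \is ishomog1 d mdeg ->
  (lift_iter n F).1 \is ishomog1 (d ^ n) mdeg /\ (lift_iter n F).2 \is ishomog1 (d ^ n) mdeg.
Proof.
move=> H1 H2; elim: n => [|n [IH1 IH2]].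
  by rewrite /lift_iter /= expn0; split; rewrite dhomogX; apply/eqP; exact: mdeg1.
by rewrite /lift_iter iterS /= expnS; split; apply: comp_homog.
Qed.

Lemma bieval_lift_iter (S : comNzRingType) (g : {rmorphism k -> S}) d
    (F : mpoly 2 k * mpoly 2 k) n x y :
  F.1 \is ishomog1 d mdeg -> F.2 \is ishomog1 d mdeg ->
  (bieval g (lift_iter n F).1 x y, bieval g (lift_iter n F).2 x y) =
   iter n (fmap g d (dehom2 F)) (x, y).
Proof.
move=> H1 H2; elim: n => [|n IH].
  rewrite /lift_iter /bieval /= !mmapX !mmap1U; congr pair.
rewrite iterS -IH /fmap /dehom2 /= -!bieval_hform // /lift_iter /=.
rewrite /bieval !mmap_comp_mpoly; congr pair; apply: eq_mmap => j;
  by rewrite !(tnth_nth 0); case: j => [ [|[]] ].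
Qed.

Lemma bievalM_wedge (S : comNzRingType) (g : {rmorphism k -> S}) (F A : mpoly 2 k * mpoly 2 k) x y :
  bieval g (F.1 * A.2 - F.2 * A.1) x y =
  wedge (bieval g F.1 x y, bieval g F.2 x y) (bieval g A.1 x y, bieval g A.2 x y).
Proof. by rewrite /bieval rmorphB !rmorphM. Qed.

End Bieval.

(** * Separated points in a disk *)

Lemma expr1Dinv_le (R : realType) t : (0 < t)%N -> (1 + t%:R^-1) ^+ t <= t.+1%:R :> R.
Proof.
move=> t0; have T0 : 0 < t%:R :> R by rewrite ltr0n.
(* [1 + 1 / t] is the inverse of [1 - x], and Bernoulli's inequality bounds [(1 - x) ^+ t] below by
   [1 - t * x = x]. *)
pose x : R := t.+1%:R^-1.
have x1 : 0 <= x <= 1 by rewrite invr_ge0 ler0n invf_le1 ?ltr0n // ler1n.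
have bern m : 1 - m%:R * x <= (1 - x) ^+ m.
  elim: m => [|m IH]; first by rewrite mul0r subr0 expr0.
  rewrite exprS; apply: le_trans (ler_wpM2l _ IH); last by rewrite subr_ge0; case/andP: x1.
  rewrite -natr1; have : 0 <= m%:R * x * x by rewrite !mulr_ge0 //; case/andP: x1.
  lra.
have xE : 1 - t%:R * x = x by rewrite /x -natr1; field; rewrite natr1 pnatr_eq0.
have e1 : 1 + t%:R^-1 = (1 - x)^-1 :> R.
  have h1 : 1 - x = t%:R * x by move: xE; lra.
  by rewrite h1 invfM /x invrK -natr1 mulrDr mulVf ?mulr1 // pnatr_eq0 -lt0n.
rewrite e1 exprVn -[leRHS]invrK lef_pV2 ?posrE ?invr_gt0 ?exprn_gt0 //; last first.
  by rewrite subr_gt0 /x invf_lt1 ?ltr0n // ltr1n ltnS.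
by rewrite -/x -{1}xE.
Qed.

Section Points.
Variables (R : realType) (K : fieldType) (a : absval R K) (G : R).
Hypothesis G1 : 1 <= G.
Hypothesis natG : forall m X, (0 < m)%N -> (m <= 2 ^ X)%N -> 1 <= G ^+ X * a m%:R.
Hypothesis roots : forall u t, (0 < u)%N -> (0 < t)%N ->
  exists z : 'I_t -> K, injective z /\ 'X^t - (u%:R)%:P = \prod_l ('X - (z l)%:P) :> {poly K}.

Let G0 : 0 < G. Proof. exact: lt_le_trans G1. Qed.

Lemma absv_expB (x y : K) (M : R) t : a x <= M -> a y <= M -> 0 <= M ->
  a (x ^+ t.+1 - y ^+ t.+1) <= a (x - y) * (t.+1%:R * M ^+ t).
Proof.
move=> xM yM M0; rewrite subrXX absvM ler_wpM2l ?absv_ge0 //.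
apply: le_trans (absv_sum _ _ _ _) _.
apply: le_trans (_ : \sum_(j < t.+1) M ^+ t <= _); last first.
  by rewrite sumr_const card_ord mulr_natl.
apply: ler_sum => j _; rewrite absvM !absvX.
have -> : M ^+ t = M ^+ (t.+1.-1 - j) * M ^+ j by rewrite -exprD /= subnK // -ltnS.
by apply: ler_pM; rewrite ?exprn_ge0 ?absv_ge0 // lerXn2r ?nnegrE ?absv_ge0.
Qed.

(** The difference of the [t]-th powers is at most [|x - y|] times [t * M ^+ t.-1], a factor that
    must not become exponential in [t]. It is [2 ^ O(X)] when [M] is within a factor [1 + 1 / t] of
    [max 1 |y|], as [|y| ^ t <= u]; if [|x - y|] is at least [1 / t] the claim is immediate. *)
Lemma far_from_powers (x y : K) t X (u : nat) : (0 < t)%N -> (0 < u)%N ->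
  (t <= 2 ^ X)%N -> (u <= 2 ^ X)%N -> y ^+ t = u%:R ->
  1 <= 2 * G ^+ X * a (x ^+ t - u%:R) -> 1 <= (32 * G) ^+ X.+1 * a (x - y).
Proof.
case: t => // t _ u0 tX uX yu H.
have xy0 := absv_ge0 a (x - y).
have T0 : 0 < t.+1%:R :> R by rewrite ltr0n.
have tX' : t.+1%:R <= 2 ^+ X :> R by rewrite -natrX ler_nat.
have uX' : u%:R <= 2 ^+ X :> R by rewrite -natrX ler_nat.
have GX : 1 <= G ^+ X by exact: exprn_ege1.
have X1 : 1 <= 2 ^+ X :> R by rewrite exprn_ege1 // ler1n.
have [far|near] := leP (t.+1%:R^-1) (a (x - y)).
  apply: (@le_trans _ _ (2 ^+ X * t.+1%:R^-1)); first by rewrite ler_pdivlMr // mul1r.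
  apply: ler_pM => //; rewrite ?exprn_ge0 ?invr_ge0 // exprMn.
  apply: (@le_trans _ _ (32 ^+ X.+1)).
    rewrite exprS; apply: (@le_trans _ _ (32 ^+ X)).
      by rewrite lerXn2r ?nnegrE //; lra.
    by rewrite ler_peMl ?exprn_ge0 //; lra.
  by rewrite ler_peMr ?exprn_ge0 // exprn_ege1.
pose Y := Num.max 1 (a y); pose M := Y * (1 + t.+1%:R^-1).
have Y1 : 1 <= Y by rewrite le_max lexx.
have YM : Y <= M by rewrite ler_peMr // ?lerDl ?invr_ge0 // (le_trans ler01).
have M0 : 0 <= M by apply: le_trans YM; apply: le_trans Y1.
have yM : a y <= M by apply: le_trans YM; rewrite le_max lexx orbT.
have xM : a x <= M.
  have -> : x = (x - y) + y by rewrite subrK.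
  apply: le_trans (absvD _ _ _) _; rewrite /M mulrDr mulr1 addrC lerD //.
    by rewrite le_max lexx orbT.
  by apply: le_trans (ltW near) _; rewrite ler_peMl // invr_ge0.
have Yt : Y ^+ t.+1 <= 2 ^+ X.
  rewrite /Y; case: (leP 1 (a y)) => _; last by rewrite expr1n.
  by rewrite -absvX yu; apply: le_trans (absv_nat _ _) _.
have Mt : M ^+ t <= 2 ^+ X * 2 ^+ X.+1.
  apply: (@le_trans _ _ (M ^+ t.+1)).
    by rewrite ler_weXn2l //; exact: le_trans YM.
  rewrite exprMn; apply: ler_pM => //; rewrite ?exprn_ge0 ?addr_ge0 ?invr_ge0 ?(le_trans ler01 Y1) //.
  apply: le_trans (expr1Dinv_le _ _) _ => //.
  rewrite -natrX ler_nat expnS mul2n -addnn -[t.+2]addn1; apply: leq_add => //.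
  by rewrite expn_gt0.
have := absv_expB t xM yM M0; rewrite yu => H2.
apply: le_trans H _; apply: le_trans (_ : 2 * G ^+ X * (a (x - y) * (2 ^+ X * (2 ^+ X * 2 ^+ X.+1))) <= _).
  rewrite ler_wpM2l ?mulr_ge0 ?exprn_ge0 ?(ltW G0) //; apply: le_trans H2 _.
  by rewrite ler_wpM2l //; apply: ler_pM => //; rewrite exprn_ge0.
rewrite mulrCA mulrC ler_wpM2r //.
have -> : 2 * G ^+ X * (2 ^+ X * (2 ^+ X * 2 ^+ X.+1)) = 4 * (8 * G) ^+ X :> R.
  by rewrite exprMn (_ : 8 = 2 ^+ 3 :> R) ?[2 ^+ X.+1]exprS -?exprM ?(mulnC 3) ?exprM; ring.
rewrite [(32 * G) ^+ _]exprS; apply: ler_pM.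
- by [].
- by rewrite exprn_ge0 // mulr_ge0 // ltW.
- by apply: (@le_trans _ _ 32); [lra | rewrite ler_peMr].
by rewrite lerXn2r ?nnegrE ?mulr_ge0 ?(ltW G0) // ler_wpM2r ?(ltW G0) //; lra.
Qed.

(* Two integers near the same number would be near each other. *)
Lemma integer_avoiding (ys : seq K) X : (size ys < 2 ^ X)%N ->
  exists u, [/\ (0 < u)%N, (u <= 2 ^ X)%N &
    forall y, y \in ys -> 1 <= 2 * G ^+ X * a (y - u%:R)].
Proof.
move=> sy; pose M := (size ys).+1.
have GX : 0 < 2 * G ^+ X by rewrite mulr_gt0 // exprn_gt0.
pose bad (u : 'I_M) (y : K) := 2 * G ^+ X * a (y - u.+1%:R) < 1.
(* There is one candidate more than there are points: if every candidate were close to some point,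
   two of them would share one. *)
have [/existsP [u ux]|/existsPn H] := boolP [exists u : 'I_M, ~~ has (bad u) ys].
  exists u.+1; split=> //; first by apply: leq_trans sy; exact: ltn_ord.
  move=> y yy; rewrite leNgt; apply: contra ux => b; apply/hasP; exists y => //.
pose f (u : 'I_M) : 'I_(size ys) + unit :=
  if insub (find (bad u) ys) is Some j then inl j else inr tt.
have fE (u : 'I_M) : exists j : 'I_(size ys), val j = find (bad u) ys.
  have := H u; rewrite negbK has_find => lt; by exists (Ordinal lt).
have [j jE] : exists j : 'I_M -> 'I_(size ys), forall u, val (j u) = find (bad u) ys.
  by have [j jE] := choice fE; exists j.
have jinj : injective j.
  move=> u v uv; apply/eqP; apply: contraT => neq.
  have bu : bad u (nth 0 ys (j u)) by rewrite jE nth_find //; have := H u; rewrite negbK.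
  have bv : bad v (nth 0 ys (j u)) by rewrite uv jE nth_find //; have := H v; rewrite negbK.
  set y := nth _ _ _ in bu bv.
  have key (u1 v1 : 'I_M) : (u1 < v1)%N -> bad u1 y -> bad v1 y -> false.
    move=> lt b1 b2.
    have := @natG (v1.+1 - u1.+1)%N X; rewrite subn_gt0 ltnS => /(_ lt).
    have le : (v1.+1 - u1.+1 <= 2 ^ X)%N.
      by apply: leq_trans (leq_subr _ _) _; apply: leq_trans sy; exact: ltn_ord.
    move=> /(_ le); rewrite natrB ?ltnS ?(ltnW lt) //.
    have -> : v1.+1%:R - u1.+1%:R = (y - u1.+1%:R) - (y - v1.+1%:R) :> K by ring.
    have := absvD a (y - u1.+1%:R) (- (y - v1.+1%:R)); rewrite absvN => tri h.
    have GX' : 0 < G ^+ X by rewrite exprn_gt0.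
    have := le_trans h (ler_wpM2l (ltW GX') tri).
    rewrite mulrDr; move: b1 b2; rewrite /bad -!mulrA.
    set p := G ^+ X * _; set q := G ^+ X * _; lra.
  by have [/key|/key|/val_inj E] := ltngtP u v; [apply|move=> h; apply: h | rewrite E eqxx in neq].
have := leq_card _ jinj; rewrite !card_ord /M; lia.
Qed.

(** For [z ^+ t = u]: from [u <= 2 ^ X <= 2 ^ t] one has [|z| <= 2]; the product of the differences
    is the derivative [t * z ^+ t.-1] of [X^t - u], bounded below by Liouville's inequality; and [z]
    stays away from [(w - c) / pi] because [u] avoids its [t]-th power. *)
Lemma good_points (c pi : K) (ws : seq K) t X : pi != 0 -> (0 < t)%N ->
  (X <= t)%N -> (t <= 2 ^ X)%N -> (size ws < 2 ^ X)%N ->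
  exists p : 'I_t -> K, [/\ injective p,
    forall l, a (p l - c) <= 2 * a pi,
    forall l w, w \in ws -> a pi <= (32 * G) ^+ X.+1 * a (p l - w) &
    forall l, a pi ^+ t.-1 <= G ^+ (2 * t) * a (\prod_(v | v != l) (p l - p v))].
Proof.
move=> pi0 t0 Xt tX wX.
have api : 0 < a pi by exact: absv_gt0.
pose ys := [seq ((w - c) / pi) ^+ t | w <- ws].
have sys : (size ys < 2 ^ X)%N by rewrite size_map.
have [u [u0 uX Hu]] := integer_avoiding sys.
have [z [zinj zE]] := roots u0 t0.
have zt l : z l ^+ t = u%:R.
  have := congr1 (fun q => q.[z l]) zE; rewrite hornerD hornerXn hornerN hornerC.
  rewrite (bigD1 l) //= hornerM hornerXsubC subrr mul0r => /eqP.
  by rewrite subr_eq0 => /eqP.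
have pE l v : c + pi * z l - (c + pi * z v) = pi * (z l - z v) by ring.
exists (fun l => c + pi * z l); split.
- by move=> l v /addrI /(mulfI pi0) /zinj.
- move=> l; rewrite addrC addKr absvM mulrC ler_pM2r //.
  rewrite -(@ler_pXn2r _ t) ?nnegrE ?absv_ge0 // -absvX zt.
  apply: le_trans (absv_nat _ _) _; rewrite -natrX ler_nat.
  by apply: leq_trans uX _; rewrite leq_exp2l.
- move=> l w wws.
  have yin : ((w - c) / pi) ^+ t \in ys by apply/mapP; exists w.
  have := @far_from_powers ((w - c) / pi) (z l) t X u t0 u0 tX uX (zt l) (Hu _ yin).
  rewrite -(ler_pM2l api) mulr1 mulrCA -absvM => H.
  apply: le_trans H _; rewrite absvB le_eqVlt; apply/orP; left; apply/eqP; congr (_ * a _).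
  by field.
- move=> l.
  have -> : \prod_(v | v != l) (c + pi * z l - (c + pi * z v)) = pi ^+ t.-1 * (t%:R * z l ^+ t.-1).
    rewrite (eq_bigr (fun v => pi * (z l - z v))) // big_split /= prodr_const.
    rewrite cardC1 card_ord; congr (_ * _).
    have -> : t%:R * z l ^+ t.-1 = (\prod_l ('X - (z l)%:P))^`().[z l].
      by rewrite -zE derivB derivXn derivC subr0 hornerMn hornerXn mulr_natl.
    rewrite [in RHS](bigD1 l) //= derivM derivXsubC mul1r hornerD !hornerM hornerXsubC subrr mul0r addr0.
    by rewrite horner_prod; apply: eq_bigr => v _; rewrite hornerXsubC.
  rewrite absvM !absvX absvM mulrCA ler_peMr ?exprn_ge0 ?absv_ge0 //.
  have zG : 1 <= G * a (z l).
    rewrite -(@ler_pXn2r _ t) ?nnegrE ?mulr_ge0 ?absv_ge0 ?(ltW G0) // expr1n exprMn.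
    rewrite -absvX zt; apply: le_trans (natG u0 uX) _.
    by rewrite ler_wpM2r ?absv_ge0 // ler_weXn2l.
  have zGt : 1 <= G ^+ t * a (z l) ^+ t.-1.
    apply: (@le_trans _ _ ((G * a (z l)) ^+ t.-1)); first exact: exprn_ege1.
    rewrite exprMn ler_wpM2r ?exprn_ge0 ?absv_ge0 // ler_weXn2l //.
    exact: leq_pred.
  rewrite mul2n -addnn exprD absvX mulrACA -[leLHS]mulr1; apply: ler_pM => //.
  apply: le_trans (natG t0 tX) _.
  by rewrite ler_wpM2r ?absv_ge0 // ler_weXn2l.
Qed.

Lemma separated_points (c pi : K) (ws : seq K) t X (Z : R) : pi != 0 -> (0 < t)%N ->
  (X <= t)%N -> (t <= 2 ^ X)%N -> (size ws < 2 ^ X)%N -> 32 * G <= Z -> (a pi)^-1 <= Z ->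
  exists p : 'I_t -> K, [/\ injective p,
    forall l, a (p l - c) <= 2 * a pi,
    forall l w, w \in ws -> (Z ^+ X.+2)^-1 <= a (p l - w) &
    forall l, (Z ^+ (3 * t))^-1 <= a (\prod_(v | v != l) (p l - p v))].
Proof.
move=> pi0 t0 Xt tX wX ZG Zpi.
have [p [pinj pc pw plam]] := good_points c pi0 t0 Xt tX wX.
have api : 0 < a pi by exact: absv_gt0.
have GZ : G <= Z by apply: le_trans ZG; move: G1; lra.
have Z0 : 0 < Z by exact: lt_le_trans GZ.
have Z1 : 1 <= Z by exact: le_trans GZ.
have Vpi : Z^-1 <= a pi by rewrite -[leRHS]invrK lef_pV2 ?posrE ?invr_gt0.
exists p; split=> // [l w wws|l].
  rewrite -[leLHS]mul1r ler_pdivrMr ?exprn_gt0 //.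
  rewrite exprS mulrCA -ler_pdivrMl // mulr1; apply: le_trans Vpi _; apply: le_trans (pw l w wws) _.
  rewrite mulrC ler_wpM2l ?absv_ge0 // lerXn2r ?nnegrE //; last exact: ltW.
  by rewrite mulr_ge0 // ltW.
rewrite -[leLHS]mul1r ler_pdivrMr ?exprn_gt0 //.
have -> : (3 * t = 2 * t + t)%N by rewrite -mulSnr.
rewrite exprD mulrCA mulrA -ler_pdivrMr ?exprn_gt0 // mul1r.
apply: (@le_trans _ _ (Z ^+ t.-1)^-1).
  by rewrite lef_pV2 ?posrE ?exprn_gt0 //; apply: ler_weXn2l => //; exact: leq_pred.
rewrite -exprVn; apply: (@le_trans _ _ (a pi ^+ t.-1)).
  by rewrite lerXn2r ?nnegrE ?absv_ge0 // invr_ge0 ltW.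
apply: le_trans (plam l) _; rewrite ler_wpM2r ?absv_ge0 // lerXn2r ?nnegrE //; exact: ltW.
Qed.

End Points.

(** * Jets of products and of forms *)

Definition tangent (L : fieldType) (z : P1 L) : L * L := if z is Some _ then (1, 0) else (0, 1).

Section JetProducts.
Variable K : fieldType.
Implicit Types p q : {poly K}.

Lemma revp_sum (I : finType) (f : I -> {poly K}) D : revp D (\sum_j f j) = \sum_j revp D (f j).
Proof.
apply/polyP => l; rewrite coef_sum coef_poly coef_sum.
case: ifP => lD; first by apply: eq_bigr => j _; rewrite coef_poly lD.
by rewrite big1 // => j _; rewrite coef_poly lD.
Qed.

Lemma revpZ c p D : revp D (c *: p) = c *: revp D p.
Proof.
by apply/polyP => l; rewrite coefZ !coef_poly; case: ifP; rewrite ?coefZ ?mulr0.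
Qed.

Lemma revpXn j D : (j <= D)%N -> revp D 'X^j = 'X^(D - j) :> {poly K}.
Proof.
move=> jD; apply/polyP => l; rewrite coef_poly !coefXn; case: ltnP => lD.
  by congr (_%:R); congr nat_of_bool; apply/eqP/eqP; lia.
by case: eqP => // ?; lia.
Qed.

Lemma revpM D1 D2 p q : (size p <= D1.+1)%N -> (size q <= D2.+1)%N ->
  revp (D1 + D2) (p * q) = revp D1 p * revp D2 q.
Proof.
move=> sp sq.
have E (D : nat) (f : {poly K}) : (size f <= D.+1)%N -> f = \sum_(j < D.+1) f`_j *: 'X^j.
  by move=> sf; rewrite -poly_def; apply/polyP => l; rewrite coef_poly; case: ltnP => // lD; rewrite nth_default // (leq_trans sf).
rewrite [in LHS](E _ _ sp) [in LHS](E _ _ sq) [in RHS](E _ _ sp) [in RHS](E _ _ sq).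
rewrite mulr_suml !revp_sum mulr_suml; apply: eq_bigr => j _.
rewrite mulr_sumr revp_sum mulr_sumr; apply: eq_bigr => l _.
have jD := ltn_ord j; have lD := ltn_ord l.
rewrite -scalerAl -scalerAr !revpZ -exprD !revpXn; try by lia.
rewrite -scalerAl -scalerAr; congr (_ *: (_ *: _)); rewrite -exprD; congr ('X^_); lia.
Qed.

Lemma jetM D1 D2 z p q : (size p <= D1.+1)%N -> (size q <= D2.+1)%N ->
  jet (D1 + D2) z (p * q) = jet D1 z p * jet D2 z q.
Proof. by case: z => [x|] sp sq /=; [rewrite rmorphM | exact: revpM]. Qed.

Lemma size_expr_leq p D n : (size p <= D.+1)%N -> (size (p ^+ n) <= (n * D).+1)%N.
Proof.
move=> sp; elim: n => [|n IH]; first by rewrite expr0 size_poly1.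
rewrite exprS; apply: leq_trans (size_polyMleq _ _) _; rewrite mulSn; lia.
Qed.

Lemma jetX D z p n : (size p <= D.+1)%N -> jet (n * D) z (p ^+ n) = jet D z p ^+ n.
Proof.
move=> sp; elim: n => [|n IH].
  rewrite !expr0 mul0n; case: z => [x|] /=; first by rewrite rmorph1.
  by have := @revpXn 0 0 (leqnn 0); rewrite expr0.
by rewrite !exprS mulSn jetM ?IH // size_expr_leq.
Qed.

Lemma jet_prod_XsubC z (s : seq K) :
  jet (size s) z (\prod_(x <- s) ('X - x%:P)) = \prod_(x <- s) jet 1 z ('X - x%:P).
Proof.
elim: s => [|x s IH]; first by rewrite !big_nil; have := @jetX 0 z 1 0; rewrite expr0 size_poly1; apply.
by rewrite !big_cons -IH -(@jetM 1) ?size_XsubC ?size_prod_XsubC.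
Qed.

End JetProducts.

Section JetForms.
Variables (k L : fieldType) (g : {rmorphism k -> L}).

Lemma map_revp (p : {poly k}) D : map_poly g (revp D p) = revp D (map_poly g p).
Proof.
apply/polyP => j; transitivity (g (revp D p)`_j); first exact: coef_map.
rewrite !coef_poly; case: ifP => _; last exact: rmorph0.
by case: ltnP => // h; rewrite nth_default ?rmorph0.
Qed.

(** In the direction [tangent z] the parameter of the line is the local coordinate of the chart.
    This joins the norm estimates along lines to the jets of the determinant. *)
Lemma jet_hform (p : {poly k}) D (z : P1 L) : (size p <= D.+1)%N ->
  hform (fun j => (polyC \o g) p`_j) D (lineP (hcoord z) (tangent z)) =
  jet D z (map_poly g p).
Proof.
move=> sp; case: z => [x|] /=.
  have -> : lineP (x, 1) (1, 0) = ('X + x%:P, 1).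
    by rewrite /lineP /= scale1r scale0r addr0 addrC.
  by rewrite (hform_horner (polyC \o g) _ sp) (map_poly_comp polyC).
have -> : lineP (1, 0) (0, 1) = (1, 'X) :> {poly L} * {poly L}.
  by rewrite /lineP /= scale1r scale0r addr0 add0r.
rewrite (hform_horner_rev (polyC \o g)) (map_poly_comp polyC).
rewrite -/(comp_poly 'X _) comp_polyXr.
exact: map_revp.
Qed.

Variables (F A : mpoly 2 k * mpoly 2 k) (d e : nat).
Hypotheses (F1 : F.1 \is ishomog1 d mdeg) (F2 : F.2 \is ishomog1 d mdeg).
Hypotheses (A1 : A.1 \is ishomog1 e mdeg) (A2 : A.2 \is ishomog1 e mdeg).

Definition coinc_form n := (lift_iter n F).1 * A.2 - (lift_iter n F).2 * A.1.

Lemma coinc_form_homog n : coinc_form n \is ishomog1 (d ^ n + e) mdeg.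
Proof.
have [H1 H2] := lift_iter_homog n F1 F2.
by rewrite /coinc_form rpredB // dhomogM.
Qed.

Lemma coinc_jet n (z : P1 L) :
  coinc (dehom2 F) (dehom2 A) d e n (polyC \o g) (lineP (hcoord z) (tangent z)) =
  jet (d ^ n + e) z (map_poly g (dehom (coinc_form n))).
Proof.
have Hn := coinc_form_homog n.
rewrite -jet_hform ?dehom_size // -(bieval_hform (polyC \o g) _ _ Hn).
rewrite bievalM_wedge (bieval_lift_iter (polyC \o g) n _ _ F1 F2) /coinc.
by rewrite (bieval_hform _ _ _ A1) (bieval_hform _ _ _ A2).
Qed.

Lemma coinc_eval n (x : L) :
  (map_poly g (dehom (coinc_form n))).[x] =
  coinc (dehom2 F) (dehom2 A) d e n g (x, 1).
Proof.
have Hn := coinc_form_homog n.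
rewrite -(hform_horner g x (dehom_size Hn)) -(bieval_hform g _ _ Hn).
rewrite bievalM_wedge (bieval_lift_iter g n _ _ F1 F2) /coinc.
by rewrite (bieval_hform _ _ _ A1) (bieval_hform _ _ _ A2).
Qed.

Lemma iter_jet n (z : P1 L) :
  iter n (fmap (polyC \o g) d (dehom2 F)) (lineP (hcoord z) (tangent z)) =
  (jet (d ^ n) z (map_poly g (dehom (lift_iter n F).1)),
   jet (d ^ n) z (map_poly g (dehom (lift_iter n F).2))).
Proof.
have [H1 H2] := lift_iter_homog n F1 F2.
rewrite -!jet_hform ?dehom_size // -(bieval_hform (polyC \o g) _ _ H1) -(bieval_hform (polyC \o g) _ _ H2).
by rewrite (bieval_lift_iter (polyC \o g) n _ _ F1 F2).
Qed.

Lemma iter_eval n (x : L) :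
  iter n (fmap g d (dehom2 F)) (x, 1) =
  ((map_poly g (dehom (lift_iter n F).1)).[x],
   (map_poly g (dehom (lift_iter n F).2)).[x]).
Proof.
have [H1 H2] := lift_iter_homog n F1 F2.
rewrite -(hform_horner g x (dehom_size H1)) -(hform_horner g x (dehom_size H2)).
rewrite -(bieval_hform g _ _ H1) -(bieval_hform g _ _ H2).
by rewrite (bieval_lift_iter g n _ _ F1 F2).
Qed.

End JetForms.

Lemma hcoord_norm (R : realType) (L : fieldType) (a : absval R L) (z : P1 L) :
  1 <= qmax (qnorm_absv a) (hcoord z) /\ qmax (qnorm_absv a) (tangent z) <= 1.
Proof.
case: z => [x|]; rewrite /qmax /= ?absv1 ?absv0.
  by rewrite le_max lexx orbT ge_max lexx ler01.
by rewrite le_max lexx ge_max lexx ler01.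
Qed.

Lemma pred_degree t T e : (0 < t)%N -> (0 < T)%N ->
  (t.-1 + T.-1 * t + e = (t * T + e).-1)%N.
Proof. by case: t => // t; case: T => // T _ _; rewrite [(t.+1 * _)%N]mulnC mulSn !addSn. Qed.

(** * The determinant inequality for the coincidence form *)

Section AuxiliaryInequality.
Variables (R : realType) (k L : fieldType) (g : {rmorphism k -> L}) (a : absval R L).
Variables (F A : mpoly 2 k * mpoly 2 k) (d e : nat) (C : R).
Hypotheses (F1 : F.1 \is ishomog1 d mdeg) (F2 : F.2 \is ishomog1 d mdeg).
Hypotheses (A1 : A.1 \is ishomog1 e mdeg) (A2 : A.2 \is ishomog1 e mdeg).
Hypotheses (d2 : (1 < d)%N).
Hypotheses (hF : form_bounds g a (dehom2 F) d C) (hA : form_bounds g a (dehom2 A) e C).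
Variables (n i0 : nat).
Hypothesis i0n : (i0 <= n)%N.

Notation nrm := (qmax (qnorm_absv a)).
Notation FF j := (iter j (fmap g d (dehom2 F))).
Notation AA := (fmap g e (dehom2 A)).

Let t := (d ^ i0)%N.
Let T := (d ^ (n - i0))%N.
Let N := (d ^ n + e)%N.
Let eta : {poly L} := map_poly g (dehom (coinc_form F A n)).

Variables (r : nat) (w : 'I_r -> L) (m : option 'I_r -> nat) (lc : L).
Hypotheses (winj : injective w) (lc0 : lc != 0).
Hypothesis etaE : eta = lc *: \prod_(o < r) ('X - (w o)%:P) ^+ m (Some o).
Hypothesis mN : (\sum_o m o)%N = N.
Let pt (o : option 'I_r) : P1 L := omap w o.
Hypothesis K0 : forall o, (0 < m o)%N -> (jet N (pt o) eta)`_(m o) != 0.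

Variables (p : 'I_t -> L) (B rho lam E : R).
Hypotheses (pinj : injective p) (B1 : 1 <= B) (pB : forall u, a (p u) <= B).
Hypotheses (rho01 : 0 < rho <= 1) (rhoC : C ^+ n <= rho^-1) (rhoB : B <= rho^-1).
Hypothesis (pw : forall u o, rho <= a (p u - w o)).
Hypotheses (lam0 : 0 < lam) (lamp : forall u, lam <= a (\prod_(v | v != u) (p u - p v))).
Hypothesis (E0 : 0 < E).
Hypothesis (small : forall u, a eta.[p u] <= E * nrm (FF n (p u, 1))).

Let C1 : 1 <= C := fb_ge1 hF.
Let Cp : 0 < C. Proof. exact: lt_le_trans C1. Qed.
Let C0 : 0 <= C. Proof. exact: ltW. Qed.
Let B0 : 0 <= B. Proof. exact: le_trans B1. Qed.
Let nrm0 X : 0 <= nrm X. Proof. exact: qmax_ge0. Qed.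
Let t0 : (0 < t)%N. Proof. by rewrite expn_gt0 (ltn_trans _ d2). Qed.
Let T0 : (0 < T)%N. Proof. by rewrite expn_gt0 (ltn_trans _ d2). Qed.
Let tT : (t * T = d ^ n)%N. Proof. by rewrite -expnD subnKC. Qed.
Let rhoC0 : 0 <= (C ^+ n)^-1. Proof. by rewrite invr_ge0 exprn_ge0. Qed.

Let weight (o : option 'I_r) : R :=
  C ^+ 5 * (nrm (FF n (hcoord (pt o))) * nrm (AA (hcoord (pt o)))).

(** The larger coordinate attains the full norm of [F^i0] at [p u], while its jets are bounded by
    the norm of [F^i0] at every zero. The [T]-th power of that norm is comparable with the norm of
    [F^n]. *)
Let big_coord (u : 'I_t) : {poly L} :=
  map_poly g (dehom (if a (FF i0 (p u, 1)).2 <= a (FF i0 (p u, 1)).1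
                     then (lift_iter i0 F).1 else (lift_iter i0 F).2)).

(** The exponent [T.-1] leaves room in degree for the linear factors; at a zero these make up for
    the missing power of [F^i0], since [|w| ^ t] is at most [|F^i0(w)|] up to constants. *)
Let U (u : 'I_t) : {poly L} :=
  \prod_(v | v != u) ('X - (p v)%:P) * big_coord u ^+ T.-1.

Let size_big u : (size (big_coord u) <= t.+1)%N.
Proof.
have [H1 H2] := lift_iter_homog i0 F1 F2.
by rewrite size_map_poly; case: ifP => _; apply: dehom_size.
Qed.

Let pset u := [seq p v | v <- enum (predC1 u)].

Let size_pset u : size (pset u) = t.-1.
Proof. by rewrite size_map -cardE cardC1 card_ord. Qed.

Let prod_pset u : \prod_(v | v != u) ('X - (p v)%:P) = \prod_(x <- pset u) ('X - x%:P).
Proof. by rewrite big_map big_enum. Qed.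

Let size_L u : (size (\prod_(v | v != u) ('X - (p v)%:P))%R <= t.-1.+1)%N.
Proof. by rewrite prod_pset size_prod_XsubC size_pset. Qed.

Let degE : (t.-1 + T.-1 * t + e = N.-1)%N.
Proof. by rewrite /N -tT pred_degree. Qed.

Let size_Ut u : (size (U u) <= (t.-1 + T.-1 * t).+1)%N.
Proof.
apply: leq_trans (size_polyMleq _ _) _.
have := size_expr_leq T.-1 (size_big u); have := size_L u.
by move=> h1 h2; rewrite -subn1 leq_subLR; apply: leq_trans (leq_add h1 h2) _; rewrite addSn addnS.
Qed.

Let N0 : (0 < N)%N. Proof. by rewrite /N -tT addn_gt0 muln_gt0 t0 T0. Qed.

Let size_U u : (size (U u) <= N)%N.
Proof. by apply: leq_trans (size_Ut u) _; rewrite -(prednK N0) ltnS -degE leq_addr. Qed.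

(** The factor [jet e z 1] pads the degree to [N.-1]; at infinity it is the power ['X^e] of the
    local coordinate. *)
Let jetU u z : jet N.-1 z (U u) =
  \prod_(x <- pset u) jet 1 z ('X - x%:P) * jet t z (big_coord u) ^+ T.-1 * jet e z 1.
Proof.
rewrite -degE -[U u]mulr1 jetM ?size_poly1 //.
by rewrite jetM ?size_expr_leq // prod_pset jetX // -(size_pset u) jet_prod_XsubC.
Qed.

Let sg : R := (C ^+ 3 * B) ^+ t * C ^+ (2 * T).

Let coef_le (q : {poly L}) j : a q`_j <= pnorm a (C ^+ n)^-1 q * (rho^-1) ^+ j.
Proof.
have h := pnorm_coef a rhoC0 q j.
have cj : 0 < (C ^+ n)^-1 ^+ j by rewrite exprn_gt0 // invr_gt0 exprn_gt0.
rewrite -ler_pdivlMr // in h; apply: le_trans h _.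
rewrite ler_wpM2l ?pnorm_ge0 // -exprVn invrK lerXn2r ?nnegrE ?exprn_ge0 //.
by rewrite invr_ge0 ltW //; case/andP: rho01.
Qed.

Let line_factor u z : qnorm_poly a rhoC0 (jet 1 z ('X - (p u)%:P)) <= C ^+ 2 * B * nrm (hcoord z).
Proof.
have [h1 h2] := hcoord_norm a z.
have r1 : (C ^+ n)^-1 <= 1 by rewrite invf_le1 ?exprn_gt0 // exprn_ege1.
have CC : C <= C ^+ 2 by rewrite expr2 ler_peMr.
case: z h1 h2 => [x|] h1 _.
  rewrite /jet comp_polyB comp_polyX comp_polyC -addrA -polyCB.
  apply: le_trans (qnD _ _ _) _; rewrite !qnorm_polyE (pnormX a rhoC0) pnormC.
  rewrite expr2 -!mulrA; apply: ler_pM.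
  - exact: le_trans (kap_ge1 a).
  - by rewrite le_max rhoC0.
  - exact: fb_kap hF.
  rewrite ge_max; apply/andP; split.
    apply: le_trans r1 _; rewrite -[leLHS]mulr1 ler_pM // -[leLHS]mulr1 ler_pM //.
  apply: le_trans (absvD_kap _ _ _) _; rewrite absvN; apply: ler_pM.
  - exact: le_trans (kap_ge1 a).
  - by rewrite le_max absv_ge0.
  - exact: fb_kap hF.
  rewrite ge_max; apply/andP; split.
    by apply: le_trans (ler_peMl _ B1) => //; rewrite /qmax /= le_max lexx.
  by apply: le_trans (pB u) _; rewrite ler_peMr.
have -> : jet 1 None ('X - (p u)%:P) = 1 + (- p u)%:P * 'X.
  apply/polyP => j; rewrite coef_poly !coefD coefMX coefC coefX coefN !coefC.
  by case: j => [|[|j]] /=; rewrite ?coefC /= ?subr0 ?sub0r ?addr0 ?add0r ?oppr0.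
apply: le_trans (qnD _ _ _) _; rewrite expr2 -!mulrA; apply: ler_pM.
- exact: le_trans (kap_ge1 a).
- by rewrite le_max qn_ge0.
- exact: fb_kap hF.
have CB : 1 <= C * B by rewrite -[leLHS]mulr1 ler_pM.
rewrite qn1 mulrA ge_max; apply/andP; split; first by rewrite -[leLHS]mulr1 ler_pM.
apply: le_trans (qnM _ _ _) _; rewrite !qnorm_polyE (pnormX a rhoC0) pnormC absvN.
apply: (@le_trans _ _ (B * 1)); first by apply: ler_pM; rewrite ?absv_ge0.
rewrite mulr1; apply: (@le_trans _ _ (C * B)); first by rewrite ler_peMl.
by rewrite ler_peMr // mulr_ge0.
Qed.

Let big_jet u z : qnorm_poly a rhoC0 (jet t z (big_coord u)) <= C * nrm (FF i0 (hcoord z)).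
Proof.
have [h1 h2] := hcoord_norm a z.
have := line_bound hF h1 h2 i0n; rewrite iter_jet //.
rewrite /qmax ge_max => /andP[x1 x2]; rewrite /big_coord.
by case: ifP.
Qed.

Let U_jet u o j : a (jet N.-1 (pt o) (U u))`_j <= weight o * rho^-1 ^+ j * sg.
Proof.
have [h1 h2] := hcoord_norm a (pt o).
have rj : 0 <= rho^-1 ^+ j.
  by rewrite exprn_ge0 // invr_ge0 ltW //; case/andP: rho01.
apply: le_trans (coef_le _ _) _; rewrite mulrAC ler_wpM2r //.
rewrite -(qnorm_polyE a rhoC0) jetU; set nu := qnorm_poly a rhoC0; set X := hcoord (pt o) in h1 *.
have e1 : nu (jet e (pt o) 1) <= 1.
  case: (pt o) => [x|]; first by rewrite /jet comp_polyC qn1.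
  rewrite /jet -(expr0 'X) revpXn // subn0; apply: le_trans (qnX _ _ _) _.
  rewrite /nu qnorm_polyE (pnormX a rhoC0) exprn_ile1 // invf_le1 ?exprn_gt0 //.
  exact: exprn_ege1.
have l1 : nu (\prod_(x <- pset u) jet 1 (pt o) ('X - x%:P)) <= (C ^+ 2 * B * nrm X) ^+ t.-1.
  apply: le_trans (qn_prod _ _ _ _) _; rewrite -(size_pset u) /pset big_map size_map.
  rewrite -[X in _ <= _ ^+ X](count_predT) -iter_mulr_1 -big_const_seq.
  by apply: ler_prod => v _; rewrite qn_ge0 line_factor.
have b1 : nu (jet t (pt o) (big_coord u) ^+ T.-1) <= (C * nrm (FF i0 X)) ^+ T.-1.
  apply: le_trans (qnX _ _ _) _; rewrite lerXn2r ?nnegrE ?qn_ge0 ?mulr_ge0 //.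
apply: le_trans (qnM _ _ _) _.
apply: (@le_trans _ _ ((C ^+ 2 * B * nrm X) ^+ t.-1 * (C * nrm (FF i0 X)) ^+ T.-1)).
  rewrite -[leRHS]mulr1; apply: ler_pM; rewrite ?qn_ge0 //.
  apply: le_trans (qnM _ _ _) _; apply: ler_pM; rewrite ?qn_ge0 //.
have CB1 : 1 <= C ^+ 2 * B by rewrite -[leLHS]mulr1 ler_pM // exprn_ege1.
have s1 : (C ^+ 2 * B * nrm X) ^+ t.-1 <= (C ^+ 3 * B) ^+ t * nrm (FF i0 X).
  apply: (@le_trans _ _ ((C ^+ 2 * B * nrm X) ^+ t)).
    by rewrite ler_weXn2l ?leq_pred // -[leLHS]mulr1 ler_pM.
  have -> : C ^+ 3 * B = C ^+ 2 * B * C by ring.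
  rewrite !(exprMn _ (C ^+ 2 * B)) -[leRHS]mulrA ler_wpM2l ?exprn_ge0 ?mulr_ge0 ?exprn_ge0 //.
  exact: iter_lb.
apply: (@le_trans _ _ ((C ^+ 3 * B) ^+ t * nrm (FF i0 X) * (C * nrm (FF i0 X)) ^+ T.-1)).
  by rewrite ler_wpM2r // exprn_ge0 // mulr_ge0.
have s2 : nrm (FF i0 X) * (C * nrm (FF i0 X)) ^+ T.-1 <= C ^+ T * (C ^+ T * nrm (FF n X)).
  apply: (@le_trans _ _ ((C * nrm (FF i0 X)) ^+ T)).
    by rewrite -[in leRHS](prednK T0) exprS ler_wpM2r ?exprn_ge0 ?mulr_ge0 // ler_peMl.
  rewrite exprMn ler_wpM2l ?exprn_ge0 //.
  by have := iter_lb d2 hF (n - i0) (FF i0 X); rewrite -iterD subnK.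
rewrite -mulrA; apply: le_trans (ler_wpM2l _ s2) _.
  by rewrite exprn_ge0 // mulr_ge0 // exprn_ge0.
have -> : weight o * sg = (C ^+ 3 * B) ^+ t * (C ^+ T * (C ^+ T * weight o)).
  by rewrite /sg mul2n -addnn exprD; ring.
do 3 (rewrite ler_wpM2l ?exprn_ge0 ?mulr_ge0 ?exprn_ge0 //).
rewrite /weight -/X mulrCA -[leLHS]mulr1 ler_wpM2l //.
(* [weight] also contains the norm of [A]. At normalized coordinates this is bounded below, so [U u]
   obeys the same row bound as [eta]. *)
have hx : 1 <= C * nrm (AA X).
  by apply: le_trans (fb_lb hA X); apply: exprn_ege1.
apply: le_trans hx _; rewrite ler_wpM2r //.
by rewrite -[leLHS]expr1 ler_weXn2l.
Qed.

(** At [p u] the numerator has one power of [|F^i0|] less than [|F^n|], a loss of at most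
    [(C * B) ^+ t]; the smallness of [eta] puts [E] into the denominator. *)
Let U_lower u : lam / E * (C ^+ T * (C * B) ^+ t)^-1 <= a (U u).[p u] / a eta.[p u].
Proof.
have epos : 0 < a eta.[p u].
  rewrite etaE absv_gt0 // hornerZ mulf_neq0 // horner_prod; apply/prodf_neq0 => o _.
  rewrite horner_exp hornerXsubC expf_neq0 //; apply/eqP => h.
  by have := pw u o; rewrite h absv0 leNgt; case/andP: rho01 => ->.
set X := (p u, 1 : L).
have X1 : nrm X <= B by rewrite /qmax /= ge_max pB absv1 B1.
have bc : a (big_coord u).[p u] = nrm (FF i0 X).
  rewrite /qmax /= /big_coord; case: ifP => h.
    by rewrite max_l // /X iter_eval.
  by rewrite max_r; [rewrite /X iter_eval | rewrite ltW // ltNge h].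
have Fn : nrm (FF n X) <= (C * nrm (FF i0 X)) ^+ T.
  by have := iter_ub d2 hF (n - i0) (FF i0 X); rewrite -iterD subnK.
have Fi : nrm (FF i0 X) <= (C * B) ^+ t.
  apply: le_trans (iter_ub d2 hF i0 X) _.
  by rewrite lerXn2r ?nnegrE ?mulr_ge0 // ler_wpM2l.
have Ue : a (U u).[p u] = a (\prod_(v | v != u) (p u - p v)) * nrm (FF i0 X) ^+ T.-1.
  rewrite /U hornerM horner_exp absvM absvX bc; congr (a _ * _).
  by rewrite horner_prod; apply: eq_bigr => v _; rewrite hornerXsubC.
have CT : 0 < C ^+ T * (C * B) ^+ t.
  by rewrite mulr_gt0 ?exprn_gt0 // mulr_gt0 // (lt_le_trans ltr01).
rewrite ler_pdivlMr // mulrAC ler_pdivrMr //.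
apply: (@le_trans _ _ (lam / E * (E * nrm (FF n X)))).
  by apply: ler_wpM2l; [rewrite divr_ge0 // ltW | exact: small].
rewrite mulrA divfK ?gt_eqF // Ue -mulrA; apply: ler_pM => //; first exact: ltW.
apply: le_trans Fn _; rewrite exprMn mulrCA ler_wpM2l ?exprn_ge0 //.
by rewrite -[in leLHS](prednK T0) exprS mulrC ler_wpM2l ?exprn_ge0.
Qed.

(** Each of the [t] points contributes a factor [E^-1] through [U_lower]. The losses at one point
    have exponent [O(t + T)], in total [O(t ^ 2 + d ^ n)] since [t * T = d ^ n]. *)
Lemma auxiliary_inequality :
  lam ^+ t * \prod_o a (jet N (pt o) eta)`_(m o) ^+ m o <=
  E ^+ t * ((N + t)`!%:R * \prod_o weight o ^+ m o * rho^-1 ^+ (\sum_o m o ^ 2)%N *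
    ((C ^+ 4 * B ^+ 2) ^+ t * C ^+ (3 * T)) ^+ t).
Proof.
have w0 o : 0 <= weight o by rewrite mulr_ge0 ?exprn_ge0 // mulr_ge0.
have eta_p u : eta.[p u] != 0.
  rewrite etaE hornerZ mulf_neq0 // horner_prod; apply/prodf_neq0 => o _.
  rewrite horner_exp hornerXsubC expf_neq0 //; apply/eqP => h.
  by have := pw u o; rewrite h absv0 leNgt; case/andP: rho01 => ->.
have Up u v : u != v -> (U u).[p v] = 0.
  move=> uv; rewrite hornerM horner_prod (bigD1 v) /=; last by rewrite eq_sym.
  by rewrite hornerXsubC subrr !mul0r.
have eta_jet o j : a (jet N (pt o) eta)`_j <= weight o * rho^-1 ^+ j.
  have [h1 h2] := hcoord_norm a (pt o).
  have := coinc_taylor hF hA n h1 h2 j; rewrite coinc_jet // -/eta -/N => H.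
  apply: le_trans H _; rewrite /weight exprD mulrAC ler_wpM2l ?mulr_ge0 ?exprn_ge0 //.
  by rewrite exprM lerXn2r ?nnegrE ?exprn_ge0 // invr_ge0 ltW //; case/andP: rho01.
have sg0 : 0 <= sg by rewrite /sg mulr_ge0 ?exprn_ge0 // mulr_ge0 // exprn_ge0.
have := @det_inequality R L a r t w m lc winj lc0 p U.
rewrite -etaE mN => /(_ size_U Up eta_p weight rho sg rho01 sg0 w0 eta_jet U_jet pw).
move=> /(_ (fun u => le_trans (pB u) rhoB) K0) H.
set Pk := \prod_o a _ ^+ _ in H *.
have Pk0 : 0 <= Pk by apply: prodr_ge0 => o _; rewrite exprn_ge0 ?absv_ge0.
set V := C ^+ T * (C * B) ^+ t.
have V0 : 0 < V by rewrite mulr_gt0 ?exprn_gt0 // mulr_gt0 // (lt_le_trans ltr01).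
have low : (lam / E * V^-1) ^+ t <= \prod_u (a (U u).[p u] / a eta.[p u]).
  rewrite -[X in _ ^+ X]card_ord -prodr_const; apply: ler_prod => u _.
  by rewrite U_lower !mulr_ge0 ?invr_ge0 ?ltW.
have H2 := le_trans (ler_wpM2l Pk0 low) H.
have Et : 0 < (E * V) ^+ t by rewrite exprn_gt0 // mulr_gt0.
have -> : lam ^+ t * Pk = (E * V) ^+ t * (Pk * (lam / E * V^-1) ^+ t).
  rewrite mulrCA -exprMn mulrC; congr (_ * _ ^+ _); field.
  by rewrite !gt_eqF.
apply: le_trans (ler_wpM2l (ltW Et) H2) _.
rewrite le_eqVlt; apply/orP; left; apply/eqP.
have -> : (C ^+ 4 * B ^+ 2) ^+ t * C ^+ (3 * T) = V * sg.
  have -> : C ^+ 4 * B ^+ 2 = (C * B) * (C ^+ 3 * B) by ring.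
  rewrite /V /sg (exprMn _ (C * B)) (mulSn 2) (exprD C T (2 * T)); ring.
rewrite !exprMn; ring.
Qed.

End AuxiliaryInequality.

(** * Leading coefficients at the zeros *)

Section CoincidenceData.
Variables (k : fieldType) (kbar : closedFieldType) (i : {rmorphism k -> kbar}).
Variables (F A : mpoly 2 k * mpoly 2 k) (d e : nat).
Hypotheses (F1 : F.1 \is ishomog1 d mdeg) (F2 : F.2 \is ishomog1 d mdeg).
Hypotheses (A1 : A.1 \is ishomog1 e mdeg) (A2 : A.2 \is ishomog1 e mdeg).

Definition nonvanishing (P : mpoly 2 k * mpoly 2 k) := forall x y : kbar,
  bieval i P.1 x y = 0 -> bieval i P.2 x y = 0 -> x = 0 /\ y = 0.

Hypotheses (F0 : nonvanishing F) (A0 : nonvanishing A).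

Lemma coprimep_no_common_root (p q : {poly k}) :
  (forall z, (map_poly i p).[z] = 0 -> (map_poly i q).[z] = 0 -> False) -> coprimep p q.
Proof.
move=> H; rewrite -(coprimep_map i); apply/Pdiv.ClosedField.coprimepP => z /rootP pz.
by apply/eqP => qz; exact: H pz qz.
Qed.

Lemma nonvanishing_coprime P D : P.1 \is ishomog1 D mdeg -> P.2 \is ishomog1 D mdeg ->
  nonvanishing P -> coprimep (dehom P.1) (dehom P.2) /\
  coprimep (revp D (dehom P.1)) (revp D (dehom P.2)).
Proof.
move=> H1 H2 P0; split; apply: coprimep_no_common_root => z.
  rewrite -(hform_horner i z (dehom_size H1)) -(hform_horner i z (dehom_size H2)).
  rewrite -(bieval_hform i _ _ H1) -(bieval_hform i _ _ H2) => h1 h2.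
  by have [_ /eqP] := P0 _ _ h1 h2; rewrite oner_eq0.
rewrite -!hform_horner_rev.
rewrite -(bieval_hform i _ _ H1) -(bieval_hform i _ _ H2) => h1 h2.
by have [/eqP] := P0 _ _ h1 h2; rewrite oner_eq0.
Qed.

Lemma bezout_exists P D : P.1 \is ishomog1 D mdeg -> P.2 \is ishomog1 D mdeg ->
  nonvanishing P -> exists u v, bezout_data D (dehom2 P) u v.
Proof.
move=> H1 H2 P0; have [/Bezout_eq1_coprimepP [u Hu] /Bezout_eq1_coprimepP [v Hv]] :=
  nonvanishing_coprime H1 H2 P0.
by exists u, v.
Qed.

Lemma nonvanishing_iter n : nonvanishing (lift_iter n F).
Proof.
elim: n => [|n IH] x y; first by rewrite /lift_iter /bieval /= !mmapX !mmap1U.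
have E := bieval_lift_iter i n.+1 x y F1 F2.
have En := bieval_lift_iter i n x y F1 F2.
rewrite iterS -En in E; move/(congr1 fst): (E) => /= E1; move/(congr1 snd): E => /= E2.
rewrite E1 E2 /dehom2 /= -(bieval_hform i _ _ F1) -(bieval_hform i _ _ F2) => h1 h2.
by have [h3 h4] := F0 h1 h2; exact: IH.
Qed.

Section FixedOrder.
Variable n : nat.
Hypothesis en : (e < d ^ n)%N.

Let f0 := dehom (lift_iter n F).1.
Let f1 := dehom (lift_iter n F).2.
Let a0 := dehom A.1.
Let a1 := dehom A.2.
Let N := (d ^ n + e)%N.
Let eta := dehom (coinc_form F A n).
Let etab := map_poly i eta.

Let L1 := (lift_iter_homog n F1 F2).1.
Let L2 := (lift_iter_homog n F1 F2).2.
Let HN := coinc_form_homog F1 F2 A1 A2 n.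

Let etaE : eta = f0 * a1 - f1 * a0.
Proof. by rewrite /eta /dehom /coinc_form bievalM_wedge. Qed.

Let size_a0 : (size a0 <= e.+1)%N. Proof. exact: dehom_size. Qed.
Let size_a1 : (size a1 <= e.+1)%N. Proof. exact: dehom_size. Qed.

(* At [n] with [e < d ^ n] the maps [f^n] and [a] differ, having different
   degrees. *)
Lemma coinc_neq0 : eta != 0.
Proof.
apply/eqP => eta0.
have [cf _] := nonvanishing_coprime L1 L2 (@nonvanishing_iter n).
have E : f0 * a1 = f1 * a0 by apply/eqP; rewrite -subr_eq0 -etaE eta0.
have A00 : a0 = 0 -> a1 = 0 -> False.
  move=> h0 h1; have [||_ /eqP] := A0 (x := 0) (y := 1).
  - rewrite (bieval_hform i _ _ A1) hform_horner ?dehom_size // -/a0 h0 rmorph0 horner0 //.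
  - rewrite (bieval_hform i _ _ A2) hform_horner ?dehom_size // -/a1 h1 rmorph0 horner0 //.
  by rewrite oner_eq0.
have d0 : f0 %| a0.
  by rewrite -(Gauss_dvdpr _ cf) -E dvdp_mulr.
have d1 : f1 %| a1.
  by rewrite -(@Gauss_dvdpr _ a1 f0 f1) 1?coprimep_sym // E dvdp_mulr.
have top : f0`_(d ^ n) != 0 \/ f1`_(d ^ n) != 0.
  have [h0|] := eqVneq f0`_(d ^ n) 0; last by left.
  have [h1|] := eqVneq f1`_(d ^ n) 0; last by right.
  have rev0 (p : {poly k}) D : p`_D = 0 -> (map_poly i (revp D p)).[0] = 0.
    by move=> pD; rewrite horner_coef0 coef_map coef_poly /= subn0 pD rmorph0.
  have [||/eqP] := @nonvanishing_iter n 1 0.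
  - by rewrite (bieval_hform i _ _ L1) hform_horner_rev rev0.
  - by rewrite (bieval_hform i _ _ L2) hform_horner_rev rev0.
  by rewrite oner_eq0.
have big (p q : {poly k}) : p`_(d ^ n) != 0 -> p %| q -> (size q <= e.+1)%N -> q = 0.
  move=> pn pq sq; apply/eqP; apply: contraT => q0.
  have := leq_trans (dvdp_leq q0 pq) sq.
  have : (d ^ n < size p)%N by rewrite ltnNge; apply: contra pn => h; rewrite nth_default.
  by move=> h1 h2; have := leq_trans h1 h2; rewrite ltnS leqNgt en.
case: top => top.
  have a00 := big _ _ top d0 size_a0; apply: A00 => //.
  move/eqP: E; rewrite a00 mulr0 mulf_eq0 => /orP[/eqP f00|/eqP //].
  by rewrite f00 coef0 eqxx in top.
have a10 := big _ _ top d1 size_a1; apply: A00 => //.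
move/eqP: E; rewrite a10 mulr0 eq_sym mulf_eq0 => /orP[/eqP f10|/eqP //].
by rewrite f10 coef0 eqxx in top.
Qed.

Let etab0 : etab != 0. Proof. by rewrite map_poly_eq0 coinc_neq0. Qed.

Let size_etab : (size etab <= N.+1)%N.
Proof. by rewrite size_map_poly; exact: dehom_size. Qed.

Let fz (z : P1 kbar) := iter n (fmap i d (dehom2 F)) (hcoord z).
Let az (z : P1 kbar) := fmap i e (dehom2 A) (hcoord z).

Let fzE z : fz z = (bieval i (lift_iter n F).1 (hcoord z).1 (hcoord z).2,
                   bieval i (lift_iter n F).2 (hcoord z).1 (hcoord z).2).
Proof. by rewrite (bieval_lift_iter i n _ _ F1 F2) -surjective_pairing. Qed.

Let azE z : az z = (bieval i A.1 (hcoord z).1 (hcoord z).2, bieval i A.2 (hcoord z).1 (hcoord z).2).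
Proof. by rewrite (bieval_hform i _ _ A1) (bieval_hform i _ _ A2) -surjective_pairing. Qed.

Let hcoord0 (z : P1 kbar) : ~ ((hcoord z).1 = 0 /\ (hcoord z).2 = 0).
Proof.
by case: z => [x|] /= [h1 h2]; [move/eqP: h2 | move/eqP: h1]; rewrite oner_eq0.
Qed.

Let theta_exists z : wedge (fz z) (az z) = 0 ->
  exists2 th, th != 0 & fz z = (th * (az z).1, th * (az z).2).
Proof.
rewrite /wedge => /eqP; rewrite subr_eq0 => /eqP W.
have fn0 : ~ ((fz z).1 = 0 /\ (fz z).2 = 0).
  by rewrite fzE /= => -[h1 h2]; apply: (@hcoord0 z); exact: (@nonvanishing_iter n).
have an0 : ~ ((az z).1 = 0 /\ (az z).2 = 0).
  by rewrite azE /= => -[h1 h2]; apply: (@hcoord0 z); exact: A0.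
suff [th H] : exists th, fz z = (th * (az z).1, th * (az z).2).
  exists th => //; apply/eqP => th0; apply: fn0.
  by rewrite H th0 /= !mul0r.
have [h1|h1] := eqVneq (az z).1 0.
  have h2 : (az z).2 != 0 by apply/eqP => h2; apply: an0.
  exists ((fz z).2 / (az z).2); rewrite [LHS]surjective_pairing h1 mulr0 divfK //; congr pair.
  by apply: (mulIf h2); rewrite W h1 mulr0 mul0r.
exists ((fz z).1 / (az z).1); rewrite [LHS]surjective_pairing divfK //; congr pair.
by rewrite mulrAC W mulfK.
Qed.

(** The values of a pair are encoded as a linear polynomial, nonzero as soon as the pair is. The
    factor [th] is a quotient of first or of second coordinates depending on the zero; this pencil
    avoids the choice. *)
Let form_polys (z : P1 kbar) (P : mpoly 2 k * mpoly 2 k) D : {poly kbar} :=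
  let c p := if z is Some x then (map_poly i (dehom p)).[x] else i (dehom p)`_D in
  (c P.1)%:P + 'X * (c P.2)%:P.

Let bieval_hcoord (p : mpoly 2 k) D z : p \is ishomog1 D mdeg ->
  bieval i p (hcoord z).1 (hcoord z).2 =
  if z is Some x then (map_poly i (dehom p)).[x] else i (dehom p)`_D.
Proof.
move=> Hp; rewrite (bieval_hform i _ _ Hp); case: z => [x|] /=.
  by rewrite hform_horner ?dehom_size.
by rewrite hform_horner_rev horner_coef0 coef_map coef_poly subn0.
Qed.

Let form_polys_theta z th : fz z = (th * (az z).1, th * (az z).2) ->
  form_polys z (lift_iter n F) (d ^ n) = th *: form_polys z A e.
Proof.
rewrite fzE azE /= !(bieval_hcoord z L1) !(bieval_hcoord z L2) !(bieval_hcoord z A1) !(bieval_hcoord z A2).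
move=> [E1 E2]; rewrite /form_polys E1 E2 scalerDr -!mul_polyC !polyCM.
by rewrite [X in _ + X]mulrCA.
Qed.

Let jetc (z : P1 kbar) : {poly kbar} := jet N z etab.

Let jet0E z : (jetc z)`_0 = wedge (fz z) (az z).
Proof.
rewrite fzE azE -bievalM_wedge -/(coinc_form F A n) (bieval_hcoord z HN) /jetc /jet.
case: z => [x|].
  by rewrite -horner_coef0 horner_comp hornerD hornerX hornerC add0r.
by rewrite coef_poly subn0 coef_map.
Qed.

Lemma coinc_divisorE z : coincidence_divisor i F A n z =
  if z is Some x then mup x etab else mup 0 (revp N etab).
Proof.
rewrite /coincidence_divisor /form_ord -/(coinc_form F A n).
case: z => [x|].
  rewrite (bieval_hform (polyC \o i) _ _ HN) (hform_horner (polyC \o i) _ (dehom_size HN)).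
  by rewrite (map_poly_comp polyC) -/(comp_poly 'X _) comp_polyXr.
rewrite (bieval_hform (polyC \o i) _ _ HN) (hform_horner_rev (polyC \o i)).
by rewrite (map_poly_comp polyC) -/(comp_poly 'X _) comp_polyXr map_revp.
Qed.

Lemma coincidence_data : exists (r : nat) (w : 'I_r -> kbar) (m : option 'I_r -> nat)
    (th : option 'I_r -> kbar) (Delta Theta : k),
  (r <= N)%N /\
  [/\ injective w, etab = lead_coef etab *: \prod_(o < r) ('X - (w o)%:P) ^+ m (Some o),
      lead_coef etab != 0,
      (\sum_o m o)%N = N &
      diag_mass (coincidence_divisor i F A n) = (\sum_o m o ^ 2)%N] /\
  [/\ i Delta = \prod_o (jetc (omap w o))`_(m o) ^+ m o, Delta != 0,
      i Theta = \prod_o th o ^+ m o, Theta != 0 &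
      forall o, (0 < m o)%N -> (jetc (omap w o))`_(m o) != 0 /\
        fz (omap w o) = (th o * (az (omap w o)).1, th o * (az (omap w o)).2)].
Proof.
have [rs rsE] := closed_field_poly_normal etab.
pose lc := lead_coef etab.
have lc0 : lc != 0 by rewrite lead_coef_eq0.
pose r := size (undup rs).
pose w (o : 'I_r) := (undup rs)`_o.
have winj : injective w.
  by move=> o o' /eqP; rewrite nth_uniq ?undup_uniq // => /eqP /val_inj.
pose m (o : option 'I_r) := if o is Some o then count_mem (w o) rs else (N - size rs)%N.
have prod_w (T : comNzRingType) (f : kbar -> T) :
    \prod_(z <- rs) f z = \prod_(o < r) f (w o) ^+ m (Some o).
  rewrite -(big_undup_iterop_count _ rs) (big_nth 0) big_mkord.
  by apply: eq_bigr => o _; rewrite /m /GRing.exp.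
have etabE : etab = lc *: \prod_(o < r) ('X - (w o)%:P) ^+ m (Some o).
  by rewrite {1}rsE (prod_w _ (fun z => 'X - z%:P)).
have sz_rs : size etab = (size rs).+1.
  by rewrite rsE size_scale // size_prod_XsubC.
have rsN : (size rs <= N)%N by rewrite -ltnS -sz_rs.
have big_opt (T : nmodType) (f : option 'I_r -> T) :
    \sum_o f o = f None + \sum_(o < r) f (Some o).
  rewrite (bigD1 None) //=; congr (_ + _).
  rewrite (reindex_omap Some id) /=; last by case.
  by apply: eq_bigl => o; rewrite eqxx.
have big_optM (T : comNzRingType) (f : option 'I_r -> T) :
    \prod_o f o = f None * \prod_(o < r) f (Some o).
  rewrite (bigD1 None) //=; congr (_ * _).
  rewrite (reindex_omap Some id) /=; last by case.
  by apply: eq_bigl => o; rewrite eqxx.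
have mN : (\sum_o m o)%N = N.
  transitivity (m None + \sum_(o < r) m (Some o))%N; first exact: (big_opt nat m).
  have : (\sum_(o < r) m (Some o))%N = size rs.
    have := congr1 (fun p : {poly kbar} => (size p).-1) etabE.
    rewrite sz_rs size_scale // size_prod => [|o _]; last by rewrite expf_neq0 // polyXsubC_eq0.
    under eq_bigr do rewrite size_exp_XsubC -addn1.
    by rewrite big_split /= sum1_card -addSn addnK.
  by move=> ->; rewrite /m /= subnK.
have jetSome (o : 'I_r) : exists T : {poly kbar}, jetc (Some (w o)) = 'X^(m (Some o)) * T /\ T`_0 != 0.
  have [q qroot qE] : exists2 q : {poly kbar}, q.[w o] != 0 & etab = ('X - (w o)%:P) ^+ m (Some o) * q.
    exists (lc *: \prod_(o' < r | o' != o) ('X - (w o')%:P) ^+ m (Some o')); last first.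
      by rewrite etabE (bigD1 o) //= scalerAr.
    rewrite hornerZ mulf_neq0 // horner_prod; apply/prodf_neq0 => o' oo'.
    rewrite horner_exp hornerXsubC expf_neq0 // subr_eq0; apply: contra oo' => /eqP /winj ->.
    exact: eqxx.
  exists (q \Po ('X + (w o)%:P)); split.
    by rewrite /jetc /jet qE rmorphM rmorphXn /= comp_polyB comp_polyX comp_polyC addrK.
  by rewrite -horner_coef0 horner_comp hornerD hornerX hornerC add0r.
have jetNone : (jetc None)`_(m None) = lc.
  by rewrite /jetc /jet coef_poly ltnS leq_subr subKn // /lc lead_coefE sz_rs.
have jetm o : (jetc (omap w o))`_(m o) != 0.
  case: o => [ o|]; last by rewrite jetNone.
  by have [T [TE T0]] := jetSome o; rewrite /omap /obind /oapp TE coefXnM ltnn subnn.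
have wedge0 o : (0 < m o)%N -> wedge (fz (omap w o)) (az (omap w o)) = 0.
  move=> mo; rewrite -jet0E; case: o mo => [ o|] mo.
    by have [T [TE T0]] := jetSome o; rewrite (_ : omap w _ = Some (w o)) // TE coefXnM mo.
  by rewrite /jetc /jet coef_poly subn0 nth_default // sz_rs -subn_gt0.
have [th thP] : exists th : option 'I_r -> kbar, forall o, th o != 0 /\ ((0 < m o)%N ->
    fz (omap w o) = (th o * (az (omap w o)).1, th o * (az (omap w o)).2)).
  have H o : exists t, t != 0 /\ ((0 < m o)%N ->
     fz (omap w o) = (t * (az (omap w o)).1, t * (az (omap w o)).2)).
    (* The value 1 at an index of multiplicity 0 is a placeholder: [th o] only occurs to the power
       [m o] in [Theta]. *)
    case: (posnP (m o)) => mo; first by exists 1; split; first exact: oner_neq0.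
    by have [t t0 E] := theta_exists (wedge0 o mo); exists t.
  by have [th thP] := choice H; exists th.
have etaP : map_poly i eta = i (lead_coef eta) *: \prod_(z <- rs) ('X - z%:P).
  by rewrite -/etab [LHS]rsE /etab lead_coef_map.
have rat Q := root_product_rational Q coinc_neq0 etaP.
(* At [z] this is the Taylor expansion of [eta] at [z]. The product over the roots with multiplicity
   starts at order [S], the sum of the squares of the finite multiplicities, with the finite part of
   [Delta] as coefficient. *)
pose QD : {poly {poly k}} := (map_poly polyC eta) \Po ('X + ('X)%:P).
have QDz z : (map_poly (map_poly i) QD).[z%:P] = jetc (Some z).
  rewrite /QD map_comp_poly rmorphD /= map_polyX map_polyC /= map_polyX.
  rewrite horner_comp hornerD hornerX hornerC /jetc /jet addrC /comp_poly.
  congr (_.[_]); rewrite -map_poly_comp /etab -map_poly_comp.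
  by apply: eq_map_poly => c /=; rewrite map_polyC.
have [PD PDE] := rat QD.
pose S := (\sum_(o < r) m (Some o) ^ 2)%N.
have PDS : i PD`_S = \prod_(o < r) (jetc (Some (w o)))`_(m (Some o)) ^+ m (Some o).
  rewrite -coef_map PDE prod_w.
  have [T TP] : exists T : 'I_r -> {poly kbar}, forall o,
     jetc (Some (w o)) = 'X^(m (Some o)) * T o /\ (T o)`_0 != 0.
    by have [T TP] := choice jetSome; exists T.
  have -> : \prod_(o < r) (map_poly (map_poly i) QD).[(w o)%:P] ^+ m (Some o) =
      'X^S * \prod_(o < r) T o ^+ m (Some o).
    rewrite /S expr_sum -big_split /=; apply: eq_bigr => o _.
    by rewrite QDz (TP o).1 exprMn -exprM -mulnn.
  rewrite coefXnM ltnn subnn -horner_coef0 horner_prod; apply: eq_bigr => o _.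
  by rewrite horner_exp horner_coef0 (TP o).1 coefXnM ltnn subnn.
(* The products of the pencils of [F^n] and of [A] over the zeros are defined over [k] and differ by
   the factor [Theta], which is thus a quotient of leading coefficients. *)
pose QT (p q : {poly k}) : {poly {poly k}} := map_poly polyC p + 'X%:P * map_poly polyC q.
have QTz p q z : (map_poly (map_poly i) (QT p q)).[z%:P] =
    ((map_poly i p).[z])%:P + 'X * ((map_poly i q).[z])%:P.
  rewrite /QT rmorphD rmorphM /= map_polyC /= map_polyX hornerD hornerM hornerC.
  have E (p' : {poly k}) : (map_poly (map_poly i) (map_poly polyC p')).[z%:P] = ((map_poly i p').[z])%:P.
    rewrite -horner_map /=; congr (_.[_]); rewrite -map_poly_comp -[in RHS]map_poly_comp.
    by apply: eq_map_poly => c /=; rewrite map_polyC.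
  by rewrite !E.
have [PF PFE] := rat (QT f0 f1).
have [PA PAE] := rat (QT a0 a1).
pose TF := PF * ((f0`_(d ^ n)%N)%:P + 'X * (f1`_(d ^ n)%N)%:P) ^+ m None.
pose TA := PA * ((a0`_e)%:P + 'X * (a1`_e)%:P) ^+ m None.
have mapT (P : {poly k}) c1 c2 (G : mpoly 2 k * mpoly 2 k) D j :
    c1 = (dehom G.1)`_D -> c2 = (dehom G.2)`_D ->
    map_poly i P = \prod_(z <- rs) (map_poly (map_poly i) (QT (dehom G.1) (dehom G.2))).[z%:P] ->
    map_poly i (P * (c1%:P + 'X * c2%:P) ^+ j) =
    (form_polys None G D) ^+ j * \prod_(o < r) (form_polys (Some (w o)) G D) ^+ m (Some o).
  move=> -> -> PE; rewrite rmorphM rmorphXn rmorphD rmorphM /= !map_polyC map_polyX PE prod_w mulrC.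
  congr (_ * _); apply: eq_bigr => o _; congr (_ ^+ _); rewrite QTz //.
have TFE : map_poly i TF = \prod_o (form_polys (omap w o) (lift_iter n F) (d ^ n)%N) ^+ m o.
  by rewrite big_optM /TF (@mapT PF _ _ (lift_iter n F) (d ^ n)%N).
have TAE : map_poly i TA = \prod_o (form_polys (omap w o) A e) ^+ m o.
  by rewrite big_optM /TA (@mapT PA _ _ A e).
have TT : map_poly i TF = (\prod_o th o ^+ m o) *: map_poly i TA.
  rewrite TFE TAE -mul_polyC rmorph_prod -big_split /=; apply: eq_bigr => o _.
  case: (posnP (m o)) => mo; first by rewrite mo !expr0 mulr1.
  rewrite (form_polys_theta ((thP o).2 mo)) -mul_polyC exprMn polyC_exp //.
have lin0 (c1 c2 : kbar) : c1%:P + 'X * c2%:P = 0 -> c1 = 0 /\ c2 = 0.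
  move=> h; split.
    by have /= := congr1 (fun p : {poly kbar} => p`_0) h; rewrite coefD coefXM coefC /= addr0 polyseq0.
  by have /= := congr1 (fun p : {poly kbar} => p`_1) h; rewrite coefD coefXM !coefC /= add0r.
have TA0 : TA != 0.
  rewrite -(map_poly_eq0 i) TAE; apply/prodf_neq0 => o _.
  case: (posnP (m o)) => mo; first by rewrite mo expr0 oner_neq0.
  rewrite expf_neq0 //; apply/eqP => h.
  have az0 : (az (omap w o)).1 = 0 /\ (az (omap w o)).2 = 0.
    rewrite azE /= !(bieval_hcoord _ A1) !(bieval_hcoord _ A2); exact: lin0.
  apply: (@hcoord0 (omap w o)); move: az0; rewrite azE /= => -[h1 h2]; exact: A0.
exists r, w, m, th, (PD`_S * lead_coef eta ^+ m None), (lead_coef TF / lead_coef TA).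
have DE : i (PD`_S * lead_coef eta ^+ m None) = \prod_o (jetc (omap w o))`_(m o) ^+ m o.
  rewrite big_optM rmorphM rmorphXn PDS [X in X ^+ _ * _]jetNone mulrC; congr (_ ^+ _ * _).
  by rewrite /lc /etab lead_coef_map.
have TE : i (lead_coef TF / lead_coef TA) = \prod_o th o ^+ m o.
  have lA : i (lead_coef TA) != 0 by rewrite fmorph_eq0 lead_coef_eq0.
  rewrite fmorph_div; apply: (mulIf lA); rewrite divfK // -!lead_coef_map TT.
  by rewrite lead_coefZ.
split; first exact: leq_trans (size_undup rs) rsN.
split; split=> //.
- rewrite /diag_mass (fsbigE (None :: [seq Some (w o) | o <- enum 'I_r])) //; last first.
  + move=> [x|] _; last by rewrite mem_head.
    rewrite coinc_divisorE in_cons negb_or => /andP[_ xw]; rewrite mupNroot //.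
    apply: contra xw => xr; have : x \in rs.
      by move: xr; rewrite rsE rootZ // root_prod_XsubC.
    rewrite -(mem_undup rs) => /(nthP 0) [j jr jx]; rewrite -jx.
    have H : (Some (w (Ordinal jr)) : option kbar) \in [seq Some (w o) | o <- enum 'I_r].
      by apply/mapP; exists (Ordinal jr); rewrite ?mem_enum.
    exact: H.
  + rewrite /= map_inj_uniq ?enum_uniq; last by move=> o o' [] /winj.
    by rewrite andbT; apply/mapP => -[].
  under eq_bigl do rewrite in_setT.
  rewrite big_cons big_map big_enum [RHS]big_opt; congr (_ + _).
    rewrite coinc_divisorE; congr (_ ^ _)%N; apply/eqP.
    have rev0 : revp N etab != 0.
      by apply/eqP => h; have := jetm None; rewrite /jetc /= h coef0 eqxx.
    have jj : forall j, (j < m None)%N -> (revp N etab)`_j = 0.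
      move=> j jm; rewrite coef_poly; case: ifP => // _; rewrite nth_default // sz_rs.
      by move: jm; rewrite /m ltn_subRL addnC => h; rewrite ltn_subRL.
    have dv j : ('X - 0%:P) ^+ j %| revp N etab <-> forall l, (l < j)%N -> (revp N etab)`_l = 0.
      rewrite -jet_dvdp addr0 comp_polyXr //.
    rewrite eqn_leq mup_leq // mup_geq //; apply/andP; split; last exact/dv.
    apply/negP => /dv /(_ (m None) (ltnSn _)) h; have := jetm None.
    by rewrite /jetc /jet [(revp _ _)`__]h eqxx.
  apply: eq_bigr => o _; rewrite coinc_divisorE; congr (_ ^ _)%N.
  rewrite rsE -mul_polyC mupMr ?mu_prod_XsubC //.
  by rewrite /root hornerC.
- rewrite -(fmorph_eq0 i) DE; apply/prodf_neq0 => o _; rewrite expf_neq0 //; exact: jetm.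
- rewrite -(fmorph_eq0 i) TE; apply/prodf_neq0 => o _; rewrite expf_neq0 //; exact: (thP o).1.
- by move=> o mo; split; [exact: jetm | exact: (thP o).2].
Qed.

End FixedOrder.
End CoincidenceData.

(** * Constants at all places and the product formula for the leading coefficients *)

Lemma form_bounds_le (R : realType) (k L : fieldType) (g : {rmorphism k -> L}) (b : absval R L)
    P d (C C' : R) : C <= C' -> form_bounds g b P d C -> form_bounds g b P d C'.
Proof.
move=> CC' [C1 kC ub pub lb taylor].
have nrm0 (S : comNzRingType) (kappa : R) (nu : qnorm S kappa) X : 0 <= qmax nu X by exact: qmax_ge0.
split.
- exact: le_trans CC'.
- exact: le_trans CC'.
- by move=> X; apply: le_trans (ub X) _; rewrite ler_wpM2r // exprn_ge0.
- by move=> rho rho0 X; apply: le_trans (pub rho rho0 X) _; rewrite ler_wpM2r // exprn_ge0.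
- by move=> X; apply: le_trans (lb X) _; rewrite ler_wpM2r.
move=> rho rho0 X0 X e e01 h; apply: le_trans (taylor rho rho0 X0 X e e01 h) _.
by rewrite ler_wpM2r // ler_wpM2r //; case/andP: e01.
Qed.

Section Global.
Variables (R : realType) (k : fieldType) (k_char0 : [pchar k] =i pred0).
Variable PF : product_formula_structure R k.

Let Cmax (s : seq k) (u : pf_place PF) : R := \prod_(c <- s) Num.max 1 (pf_abs u c).

Let Cmax_ge1 s u : 1 <= Cmax s u.
Proof.
elim: s => [|c s IH]; rewrite /Cmax ?big_nil // big_cons.
by rewrite -[leLHS]mulr1 ler_pM // le_max lexx.
Qed.

Let Cmax_mem s u c : c \in s -> pf_abs u c <= Cmax s u.
Proof.
elim: s => [|x s IH] //; rewrite in_cons /Cmax big_cons => /orP[/eqP <-|/IH h].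
  rewrite -[leLHS]mulr1 ler_pM ?absv_ge0 // ?le_max ?lexx ?orbT //; exact: Cmax_ge1.
by rewrite -[leLHS]mul1r ler_pM ?absv_ge0 // le_max lexx.
Qed.

Let Cmax_coef s u (p : {poly k}) j : {subset (p : seq k) <= s} -> pf_abs u p`_j <= Cmax s u.
Proof.
move=> ps; case: (ltnP j (size p)) => jp; first by apply: Cmax_mem; apply: ps; exact: mem_nth.
by rewrite nth_default // absv0 (le_trans ler01).
Qed.

Let Cmax_fin s : finite_set [set u | Cmax s u != 1].
Proof.
elim: s => [|c s IH].
  by apply: sub_finite_set (finite_set0 _) => u /=; rewrite /Cmax big_nil eqxx.
have [->|c0] := eqVneq c 0.
  apply: sub_finite_set IH => u /=; rewrite /Cmax big_cons absv0.
  by rewrite max_l ?ler01 // mul1r.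
have : finite_set ([set u : pf_place PF | pf_abs u c != 1] `|` [set u | Cmax s u != 1]).
  by rewrite finite_setU; split => //; exact: pf_finite.
apply: sub_finite_set => u /= h; case: (eqVneq (pf_abs u c) 1) => uc; last by left.
by right; apply: contra h; rewrite /Cmax big_cons uc maxxx mul1r.
Qed.

(** A majorant of [kap] for every extension of the place: where 2 has absolute value 1 all
    extensions are ultrametric, and the exceptions are finite in number. *)
Let kmax (u : pf_place PF) : R := if pf_abs u (2%:R : k) != 1 then 2 else 1.

Let kmax_ge1 u : 1 <= kmax u. Proof. by rewrite /kmax; case: ifP => // _; rewrite ler1n. Qed.

Let kmax_kap u (L : fieldType) (g : {rmorphism k -> L}) (b : absval R L) :
  absv_extends g (pf_abs u) b -> kap b <= kmax u.
Proof.
move=> bE; rewrite /kmax; case: eqP => /= h; last exact: kap_le2.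
rewrite /kap; case: asboolP => // na; case: na.
by apply: nonarchimedean_le2; rewrite -(rmorph_nat g) bE h.
Qed.

Let kmax_fin : finite_set [set u | kmax u != 1].
Proof.
have fin2 : finite_set [set u : pf_place PF | pf_abs u (2%:R : k) != 1].
  by apply: pf_finite; exact: natr_char0_neq0.
by apply: sub_finite_set fin2 => u /=; rewrite /kmax; case: ifP => //; rewrite eqxx.
Qed.

Variables (kbar : closedFieldType) (i : {rmorphism k -> kbar}).
Hypothesis kbar_closure : is_algebraic_closure i.
Variables (F A : mpoly 2 k * mpoly 2 k) (d e : nat).
Hypotheses (F1 : F.1 \is ishomog1 d mdeg) (F2 : F.2 \is ishomog1 d mdeg).
Hypotheses (A1 : A.1 \is ishomog1 e mdeg) (A2 : A.2 \is ishomog1 e mdeg).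
Hypotheses (F0 : nonvanishing i F) (A0 : nonvanishing i A).
Hypotheses (d2 : (1 < d)%N) (e0 : (0 < e)%N).

(** The constants come from finitely many elements of [k], the coefficients of [P] and of its Bezout
    data, so they are 1 at almost all places. They do not depend on the extension [b] and serve for
    [kbar] and [C_v] alike. *)
Lemma adelic_form_bounds (P : mpoly 2 k * mpoly 2 k) D : (0 < D)%N ->
  P.1 \is ishomog1 D mdeg -> P.2 \is ishomog1 D mdeg -> nonvanishing i P ->
  exists C : pf_place PF -> R, [/\ forall u, 1 <= C u, finite_set [set u | C u != 1] &
    forall u (L : fieldType) (g : {rmorphism k -> L}) (b : absval R L),
      absv_extends g (pf_abs u) b -> form_bounds g b (dehom2 P) D (C u)].
Proof.
move=> D0 H1 H2 P0; have [x [y bz]] := bezout_exists H1 H2 P0.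
pose s := (dehom2 P).1 ++ (dehom2 P).2 ++ x.1 ++ x.2 ++ y.1 ++ y.2 : seq k.
pose S := (size x.1 + size x.2 + size y.1 + size y.2)%N.
exists (fun u => kmax u ^+ (S + 3 * D + 2) * Cmax s u ^+ 2); split.
- by move=> u; rewrite -[leLHS]mulr1 ler_pM // exprn_ege1.
- have : finite_set ([set u | kmax u != 1] `|` [set u | Cmax s u != 1]).
    by rewrite finite_setU; split; [exact: kmax_fin | exact: Cmax_fin].
  apply: sub_finite_set => u /= h; case: (eqVneq (kmax u) 1) => ku; last by left.
  right; apply: contra h => /eqP ->; by rewrite ku !expr1n mul1r.
move=> u L g b bE.
apply: form_bounds_le (form_boundsP (g := g) (b := b) (C0 := Cmax s u) (s := S) _ _ _ _ _ _ _ _ _ _ bz) => //.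
- apply: ler_pM; rewrite ?exprn_ge0 //; first exact: le_trans (kap_ge1 b).
    by rewrite (le_trans ler01).
  rewrite lerXn2r ?nnegrE //; first exact: le_trans (kap_ge1 b).
    exact: le_trans (kmax_ge1 u).
  exact: kmax_kap bE.
- exact: dehom_size.
- exact: dehom_size.
- by move=> j; split; rewrite bE; apply: Cmax_coef => c cP; rewrite !mem_cat cP ?orbT.
- by rewrite /S; lia.
- by rewrite /S; lia.
- by rewrite /S; lia.
- by rewrite /S; lia.
by move=> j; split; rewrite bE; apply: Cmax_coef => c cP; rewrite !mem_cat cP ?orbT.
Qed.

Lemma adelic_bounds : exists C : pf_place PF -> R,
  [/\ forall u, 1 <= C u, finite_set [set u | C u != 1] &
    forall u (L : fieldType) (g : {rmorphism k -> L}) (b : absval R L),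
      absv_extends g (pf_abs u) b ->
      form_bounds g b (dehom2 F) d (C u) /\ form_bounds g b (dehom2 A) e (C u)].
Proof.
have [CF [CF1 CFfin CFP]] := adelic_form_bounds (ltnW d2) F1 F2 F0.
have [CA [CA1 CAfin CAP]] := adelic_form_bounds e0 A1 A2 A0.
exists (fun u => CF u * CA u); split.
- by move=> u; rewrite -[leLHS]mulr1 ler_pM.
- have : finite_set ([set u | CF u != 1] `|` [set u | CA u != 1]) by rewrite finite_setU; split.
  apply: sub_finite_set => u /= h; case: (eqVneq (CF u) 1) => cu; last by left.
  by right; apply: contra h => /eqP ->; rewrite cu mul1r.
move=> u L g b bE; split.
  by apply: form_bounds_le (CFP u L g b bE); rewrite ler_peMr // (le_trans ler01).
by apply: form_bounds_le (CAP u L g b bE); rewrite ler_peMl // (le_trans ler01).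
Qed.

Variable (C : pf_place PF -> R).
Hypotheses (C1 : forall u, 1 <= C u) (Cfin : finite_set [set u | C u != 1]).
Hypothesis CP : forall u (L : fieldType) (g : {rmorphism k -> L}) (b : absval R L),
  absv_extends g (pf_abs u) b ->
  form_bounds g b (dehom2 F) d (C u) /\ form_bounds g b (dehom2 A) e (C u).

Section LocalLeading.
Variables (n : nat).
Hypotheses (n0 : (0 < n)%N) (en : (2 * e <= d ^ n)%N).
Let N := (d ^ n + e)%N.
Let q := (d ^ n - e)%N.
Let etab := map_poly i (dehom (coinc_form F A n)).
Variables (r : nat) (w : 'I_r -> kbar) (m : option 'I_r -> nat).
Variables (th : option 'I_r -> kbar) (Delta Theta : k).
Hypotheses (DeltaE : i Delta = \prod_o (jet N (omap w o) etab)`_(m o) ^+ m o).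
Hypotheses (ThetaE : i Theta = \prod_o th o ^+ m o).
Hypothesis thE : forall o, (0 < m o)%N ->
  iter n (fmap i d (dehom2 F)) (hcoord (omap w o)) =
    (th o * (fmap i e (dehom2 A) (hcoord (omap w o))).1,
     th o * (fmap i e (dehom2 A) (hcoord (omap w o))).2).

(** [Delta] and [Theta] lie in [k], so any extension to [kbar] computes their absolute values. At
    each zero the Taylor bound of order [m o] meets [weight_bound]; the resulting exponent
    [7 + 6 * e + n * m o] is at most [(8 + 6 * e) * (n * m o)]. *)
Lemma leading_local u : pf_abs u Delta ^+ q <=
  pf_abs u Theta ^+ N * C u ^+ (q * ((8 + 6 * e) * (n * \sum_o m o ^ 2))).
Proof.
have [b bE] := absv_extension (pf_abs u) kbar_closure.
have [hF hA] := CP bE.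
have c1 := C1 u; have c0 : 0 <= C u by apply: le_trans c1.
rewrite -!bE DeltaE ThetaE !absv_prod -!prodrXl.
rewrite !big_distrr /= expr_sum -big_split /=.
apply: ler_prod => o _; rewrite exprn_ge0 ?absv_ge0 //= !absvX.
case: (posnP (m o)) => mo; first by rewrite mo !expr0 !expr1n mul1r exprn_ege1.
have [h1 h2] := hcoord_norm b (omap w o).
have T := coinc_taylor hF hA n h1 h2 (m o); rewrite (coinc_jet i F1 F2 A1 A2) -/N -/etab in T.
have W := weight_bound d2 hF hA h1 h2 en (thE mo).
set nn := (qmax _ _ * qmax _ _) in T W.
have nn0 : 0 <= nn by rewrite mulr_ge0 // qmax_ge0.
set x := b _ in T *.
have x0 : 0 <= x by exact: absv_ge0.
have step : x ^+ q <= b (th o) ^+ N * C u ^+ (q * ((8 + 6 * e) * n * m o)).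
  apply: (@le_trans _ _ (C u ^+ ((5 + n * m o) * q) * nn ^+ q)).
    rewrite exprM -exprMn lerXn2r ?nnegrE //.
    by rewrite mulr_ge0 ?exprn_ge0.
  apply: (@le_trans _ _ (C u ^+ ((5 + n * m o) * q) * (b (th o) ^+ N * C u ^+ (q * (2 + 6 * e))))).
    by rewrite ler_wpM2l ?exprn_ge0.
  rewrite mulrCA -exprD ler_wpM2l ?exprn_ge0 ?absv_ge0 //.
  apply: ler_weXn2l => //; rewrite mulnC -mulnDr leq_mul2l; apply/orP; right.
  have : (0 < n * m o)%N by rewrite muln_gt0 n0.
  by rewrite -[((_ * n) * m o)%N]mulnA; move: (n * m o)%N => z z0; nia.
rewrite exprAC; apply: (@le_trans _ _ ((b (th o) ^+ N * C u ^+ (q * ((8 + 6 * e) * n * m o))) ^+ m o)).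
  by rewrite lerXn2r ?nnegrE ?exprn_ge0 // mulr_ge0 ?exprn_ge0 ?absv_ge0.
rewrite exprMn -!exprM [(N * _)%N]mulnC ler_wpM2l ?exprn_ge0 ?absv_ge0 //.
apply: ler_weXn2l => //; rewrite -mulnn !mulnA leqnn //.
Qed.

End LocalLeading.

(** Liouville's inequality for [Delta ^+ (d ^ n - e) / Theta ^+ (d ^ n + e)], bounded at all places
    by [leading_local]. *)
Lemma leading_global : exists2 G : R, 1 <= G & forall n, (0 < n)%N -> (2 * e <= d ^ n)%N ->
  exists (r : nat) (w : 'I_r -> kbar) (m : option 'I_r -> nat) (th : option 'I_r -> kbar),
  let etab := map_poly i (dehom (coinc_form F A n)) in
  (r <= d ^ n + e)%N /\
  [/\ injective w, etab = lead_coef etab *: \prod_(o < r) ('X - (w o)%:P) ^+ m (Some o),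
      lead_coef etab != 0,
      (\sum_o m o)%N = (d ^ n + e)%N &
      diag_mass (coincidence_divisor i F A n) = (\sum_o m o ^ 2)%N] /\
  (forall o, (0 < m o)%N -> (jet (d ^ n + e) (omap w o) etab)`_(m o) != 0 /\
    iter n (fmap i d (dehom2 F)) (hcoord (omap w o)) =
    (th o * (fmap i e (dehom2 A) (hcoord (omap w o))).1,
     th o * (fmap i e (dehom2 A) (hcoord (omap w o))).2)) /\
  (forall (v : pf_place PF) (L : fieldType) (g : {rmorphism kbar -> L}) (b : absval R L),
    absv_extends (g \o i) (pf_abs v) b ->
    (\prod_o b (g (th o)) ^+ m o) ^+ (d ^ n + e) <=
    G ^+ ((d ^ n - e) * (n * diag_mass (coincidence_divisor i F A n))) *
    (\prod_o b (g (jet (d ^ n + e) (omap w o) etab)`_(m o)) ^+ m o) ^+ (d ^ n - e)).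
Proof.
have [G G1 GP] := product_formula_lower C1 Cfin.
exists (G ^+ (8 + 6 * e)); first exact: exprn_ege1.
move=> n n0 en; have en' : (e < d ^ n)%N by lia.
have [r [w [m [th [Delta [ Theta [rN [[winj etaE lc0 mN dE] [DeltaE Delta0 ThetaE Theta0 thE]]]]]]]]] :=
  coincidence_data F1 F2 A1 A2 F0 A0 en'.
exists r, w, m, th; cbv zeta; split; first exact: rN.
split; first by split.
split; first exact: thE.
move=> v L g b bE.
have th2 o : (0 < m o)%N -> iter n (fmap i d (dehom2 F)) (hcoord (omap w o)) =
    (th o * (fmap i e (dehom2 A) (hcoord (omap w o))).1,
     th o * (fmap i e (dehom2 A) (hcoord (omap w o))).2) by case/thE.
have loc := fun u => leading_local n0 en DeltaE ThetaE th2 u.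
have D0 : Delta ^+ (d ^ n - e) / Theta ^+ (d ^ n + e) != 0.
  by rewrite mulf_neq0 ?invr_eq0 ?expf_neq0.
have tu (u : pf_place PF) : 0 < pf_abs u Theta ^+ (d ^ n + e) by rewrite exprn_gt0 // absv_gt0.
have loc2 (u : pf_place PF) : pf_abs u (Delta ^+ (d ^ n - e) / Theta ^+ (d ^ n + e)) <=
    C u ^+ ((d ^ n - e) * ((8 + 6 * e) * (n * \sum_o m o ^ 2))).
  by rewrite absvM absvV !absvX ler_pdivrMr // mulrC.
have := GP _ _ D0 loc2 v; rewrite absvM absvV !absvX mulrA ler_pdivlMr // mul1r.
rewrite dE -exprM mulnCA.
have -> : pf_abs v Theta = \prod_o b (g (th o)) ^+ m o.
  by rewrite -bE /= ThetaE rmorph_prod absv_prod; apply: eq_bigr => o _; rewrite rmorphXn absvX.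
suff -> : pf_abs v Delta = \prod_o b (g (jet (d ^ n + e) (omap w o)
     (map_poly i (dehom (coinc_form F A n))))`_(m o)) ^+ m o by [].
rewrite -bE /= DeltaE rmorph_prod absv_prod; apply: eq_bigr => o _.
by rewrite rmorphXn absvX.
Qed.

End Global.

(** * Lower bounds on a fixed disk *)

Lemma fact_le_expn n : (n`! <= n ^ n)%N.
Proof.
elim: n => // n IH; rewrite factS expnS leq_mul2l /=.
by apply: leq_trans IH _; case: n => // n; rewrite leq_exp2r.
Qed.

Lemma ltn_expn_exp2 d n : (0 < n)%N -> (d ^ n < 2 ^ (d * n))%N.
Proof. by move=> n0; rewrite expnM ltn_exp2r // ltn_expl. Qed.

Section SmallOnDisk.
Variables (R : realType) (k L : fieldType) (g : {rmorphism k -> L}) (a : absval R L).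
Variables (F A : mpoly 2 k * mpoly 2 k) (d e : nat) (C G Gl : R) (c pi : L) (Z : R).
Hypotheses (F1 : F.1 \is ishomog1 d mdeg) (F2 : F.2 \is ishomog1 d mdeg).
Hypotheses (A1 : A.1 \is ishomog1 e mdeg) (A2 : A.2 \is ishomog1 e mdeg).
Hypothesis (d2 : (1 < d)%N).
Hypotheses (hF : form_bounds g a (dehom2 F) d C) (hA : form_bounds g a (dehom2 A) e C).
Hypotheses (G1 : 1 <= G).
Hypothesis natG : forall m X, (0 < m)%N -> (m <= 2 ^ X)%N -> 1 <= G ^+ X * a m%:R.
Hypothesis roots : forall u t, (0 < u)%N -> (0 < t)%N ->
  exists z : 'I_t -> L, injective z /\ 'X^t - (u%:R)%:P = \prod_l ('X - (z l)%:P) :> {poly L}.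
Hypotheses (pi0 : pi != 0) (Gl1 : 1 <= Gl).
Hypotheses (ZC : C <= Z) (ZG : 32 * G <= Z) (ZGl : Gl <= Z) (Zpi : (a pi)^-1 <= Z).
Hypothesis (ZB : 1 + 2 * a pi + a c <= Z).

Notation nrm := (qmax (qnorm_absv a)).
Variable n : nat.
Hypotheses (n0 : (0 < n)%N) (en : (2 * e <= d ^ n)%N).
Let N := (d ^ n + e)%N.
Let q := (d ^ n - e)%N.
Let eta : {poly L} := map_poly g (dehom (coinc_form F A n)).
Variables (r : nat) (w : 'I_r -> L) (m : option 'I_r -> nat) (lc : L) (th : option 'I_r -> L).
Hypotheses (rN : (r <= N)%N) (winj : injective w) (lc0 : lc != 0).
Hypothesis etaE : eta = lc *: \prod_(o < r) ('X - (w o)%:P) ^+ m (Some o).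
Hypothesis mN : (\sum_o m o)%N = N.
Hypothesis K0 : forall o, (0 < m o)%N -> (jet N (omap w o) eta)`_(m o) != 0.
Hypothesis thE : forall o, (0 < m o)%N ->
  iter n (fmap g d (dehom2 F)) (hcoord (omap w o)) =
    (th o * (fmap g e (dehom2 A) (hcoord (omap w o))).1,
     th o * (fmap g e (dehom2 A) (hcoord (omap w o))).2).
Let diag := (\sum_o m o ^ 2)%N.
Hypothesis leading : (\prod_o a (th o) ^+ m o) ^+ N <=
  Gl ^+ (q * (n * diag)) * (\prod_o a (jet N (omap w o) eta)`_(m o) ^+ m o) ^+ q.

Let C1 : 1 <= C := fb_ge1 hF.
Let Z1 : 1 <= Z. Proof. exact: le_trans ZC. Qed.
Let Z0 : 0 < Z. Proof. exact: lt_le_trans Z1. Qed.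
Let Z2 : 2 <= Z. Proof. by apply: le_trans ZG; move: G1; lra. Qed.
Let q0 : (0 < q)%N.
Proof.
rewrite subn_gt0; have : (0 < d ^ n)%N by rewrite expn_gt0 (ltnW d2).
case: (posnP e) => [-> //|e0 _]; apply: leq_trans en; exact: ltn_Pmull.
Qed.

(** By [leading] the right side is in turn bounded by the leading coefficients to the power [q]: the
    weights, not bounded individually, thus cancel against these coefficients. *)
Let weight_prod :
  (\prod_o (C ^+ 5 * (nrm (iter n (fmap g d (dehom2 F)) (hcoord (omap w o))) *
      nrm (fmap g e (dehom2 A) (hcoord (omap w o))))) ^+ m o) ^+ q <=
  Z ^+ (q * ((7 + 6 * e) * N)) * (\prod_o a (th o) ^+ m o) ^+ N.
Proof.
have cc : 0 <= C by rewrite (le_trans ler01).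
have zz : 0 <= Z by exact: ltW.
rewrite -{1}mN [((7 + _) * _)%N]big_distrr big_distrr /= expr_sum -!prodrXl -big_split /=.
apply: ler_prod => o _.
set nn := (nrm _ * nrm _).
have nn0 : 0 <= nn by rewrite mulr_ge0 // qmax_ge0.
rewrite !exprn_ge0 ?(mulr_ge0 _ nn0) ?exprn_ge0 //=.
case: (posnP (m o)) => mo; first by rewrite mo !muln0 !expr0 !expr1n mulr1.
have [h1 h2] := hcoord_norm a (omap w o).
have W := weight_bound d2 hF hA h1 h2 en (thE mo); rewrite -/nn -/q -/N in W.
clearbody nn.
rewrite exprAC [X in _ <= _ * X]exprAC mulnA [X in _ <= X * _]exprM -exprMn.
rewrite lerXn2r ?nnegrE ?(exprn_ge0, mulr_ge0, absv_ge0) //.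
rewrite exprMn; apply: le_trans (ler_wpM2l _ W) _; first by rewrite !exprn_ge0.
rewrite mulrCA [X in _ <= X]mulrC ler_wpM2l ?exprn_ge0 ?absv_ge0 // -!exprM -exprD.
have -> : (5 * q + q * (2 + 6 * e) = q * (7 + 6 * e))%N by ring.
by rewrite lerXn2r ?nnegrE.
Qed.

Lemma small_on_disk (i0 : nat) (E : R) : (i0 <= n)%N -> (d.+1 * n <= d ^ i0)%N -> 0 < E ->
  (forall p, a (p - c) <= 2 * a pi ->
     a eta.[p] <= E * nrm (iter n (fmap g d (dehom2 F)) (p, 1))) ->
  1 <= E ^+ (d ^ i0) * Z ^+ ((3 * d + 6 * e + 28) * (n * diag + (d ^ i0) ^ 2)).
Proof.
move=> i0n Xt E0 small.
(* [2 ^ X] exceeds the number of zeros and [t], yet [X] is linear in [n]: the points keep distance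
   [rho] from the zeros, and [rho^-1] to the power [diag] is only [Z ^+ O(n * diag)]. *)
set t := (d ^ i0)%N in Xt *; pose X := (d.+1 * n)%N.
have dn0 : (0 < d ^ n)%N by rewrite expn_gt0 (ltnW d2).
have t0 : (0 < t)%N by rewrite expn_gt0 (ltnW d2).
have tdn : (t <= d ^ n)%N by rewrite leq_exp2l.
have N2 : (N <= 2 * d ^ n)%N by rewrite /N mul2n -addnn leq_add2l (leq_trans _ en) // leq_pmull.
have dnX : (2 * d ^ n < 2 ^ X)%N.
  have h1 : (2 <= 2 ^ n)%N by rewrite -{1}[2%N]expn1 leq_exp2l.
  have XE : X = (n + d * n)%N by rewrite /X mulSn.
  rewrite XE expnD; apply: leq_trans (leq_mul h1 (leqnn _)).
  by rewrite ltn_mul2l /= ltn_expn_exp2.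
have tX : (t <= 2 ^ X)%N by apply: leq_trans (ltnW dnX); apply: leq_trans tdn _; rewrite leq_pmull.
have wX : (size (codom w) < 2 ^ X)%N.
  by rewrite size_codom card_ord; apply: leq_ltn_trans (leq_trans rN N2) dnX.
have [p [pinj pc pw lamp]] := separated_points G1 natG roots c pi0 t0 Xt tX wX ZG Zpi.
have api : 0 < a pi by exact: absv_gt0.
pose B := 1 + 2 * a pi + a c.
have B1 : 1 <= B by rewrite /B -addrA lerDl addr_ge0 ?absv_ge0 // mulr_ge0 // ltW.
have pB u : a (p u) <= B.
  rewrite -[p u](subrK c); apply: le_trans (absvD _ _ _) _; rewrite lerD2r.
  by apply: le_trans (pc u) _; rewrite lerDr.
pose rho := (Z ^+ X.+2)^-1.
have rho01 : 0 < rho <= 1 by rewrite invr_gt0 exprn_gt0 // invf_le1 ?exprn_gt0 // exprn_ege1.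
have rhoC : C ^+ n <= rho^-1.
  rewrite invrK; apply: le_trans (_ : Z ^+ n <= _).
    by rewrite lerXn2r ?nnegrE ?(le_trans ler01) ?(ltW Z0).
  by apply: ler_weXn2l => //; rewrite /X; clear; nia.
have rhoB : B <= rho^-1.
  by rewrite invrK; apply: le_trans ZB _; rewrite -[leLHS]expr1; apply: ler_weXn2l.
have pw' u o : rho <= a (p u - w o) by apply: pw; exact: codom_f.
pose lam := (Z ^+ (3 * t))^-1.
have lam0 : 0 < lam by rewrite invr_gt0 exprn_gt0.
have aux := auxiliary_inequality F1 F2 A1 A2 d2 hF hA i0n winj lc0 etaE mN K0 B1 pB rho01 rhoC
  rhoB pw' lam0 lamp E0 (fun u => small (p u) (pc u)).
cbv beta in aux; rewrite -/N -/eta -/t -/diag in aux.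
have lead := leading.
set PK := \prod_o a (jet _ _ _)`__ ^+ _ in aux lead.
have PK0 : 0 < PK.
  apply: prodr_gt0 => o _; case: (posnP (m o)) => mo; first by rewrite mo expr0.
  by rewrite exprn_gt0 // absv_gt0 // K0.
set PW := \prod_o _ in aux.
have PW0 : 0 <= PW.
  by apply: prodr_ge0 => o _; rewrite exprn_ge0 // !mulr_ge0 ?qmax_ge0 ?exprn_ge0 // (le_trans ler01).
have Ndiag : (N <= diag)%N.
  rewrite -mN /diag; apply: leq_sum => o _; rewrite -mulnn.
  by case: (m o) => // x; rewrite leq_pmulr.
have Zp j : 0 <= Z ^+ j by rewrite exprn_ge0 // ltW.
have PKge := ltW PK0.
have PWb : PW <= Z ^+ ((7 + 6 * e) * N + n * diag) * PK.
  rewrite -(@ler_pXn2r _ q) ?nnegrE ?(mulr_ge0 (Zp _) PKge) //.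
  apply: le_trans weight_prod _; rewrite exprMn -exprM.
  apply: (@le_trans _ _ (Z ^+ (q * ((7 + 6 * e) * N)) * (Gl ^+ (q * (n * diag)) * PK ^+ q))).
    by rewrite ler_wpM2l.
  rewrite mulrA ler_wpM2r ?(exprn_ge0 _ PKge) // [leRHS](_ : _ =
     Z ^+ (q * ((7 + 6 * e) * N)) * Z ^+ (q * (n * diag))); last by rewrite -exprD mulnC mulnDr.
  by rewrite ler_wpM2l // lerXn2r ?nnegrE ?(le_trans ler01) ?(ltW Z0).
(* The factorial of the Leibniz expansion has exponent [O(n * N)], within [O(n * diag)] because
   [N <= diag]. *)
have factb : ((N + t)`!%:R : R) <= Z ^+ (X.+1 * (2 * N)).
  apply: (@le_trans _ _ ((2 ^ (X.+1 * (2 * N)))%N%:R)).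
    rewrite ler_nat; apply: leq_trans (fact_le_expn _) _.
    have tN : (t <= N)%N by apply: leq_trans tdn _; exact: leq_addr.
    have NtX : (N + t <= 2 ^ X.+1)%N.
      rewrite expnS mul2n -addnn; apply: leq_add => //.
      exact: ltnW (leq_ltn_trans N2 dnX).
    apply: leq_trans (_ : (2 ^ X.+1) ^ (N + t) <= _)%N.
      by rewrite leq_exp2r ?addn_gt0 ?t0 ?orbT.
    rewrite -expnM leq_exp2l // leq_mul2l; apply/orP; right.
    by rewrite mul2n -addnn leq_add2l.
  by rewrite natrX lerXn2r ?nnegrE ?(ltW Z0).
have CBb : ((C ^+ 4 * B ^+ 2) ^+ t * C ^+ (3 * d ^ (n - i0))) ^+ t <= Z ^+ (6 * t ^ 2 + 3 * d ^ n).
  have -> : (6 * t ^ 2 + 3 * d ^ n = (6 * t + 3 * d ^ (n - i0)) * t)%N.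
    rewrite mulnDl -!mulnA mulnn; congr (_ + 3 * _)%N.
    by rewrite /t -expnD subnK.
  have cc : 0 <= C by rewrite (le_trans ler01).
  have bb : 0 <= B by rewrite (le_trans ler01).
  have zz := ltW Z0.
  rewrite [leRHS]exprM lerXn2r ?nnegrE ?mulr_ge0 ?exprn_ge0 ?mulr_ge0 ?exprn_ge0 //.
  rewrite exprD; apply: ler_pM; rewrite ?exprn_ge0 ?mulr_ge0 ?exprn_ge0 //; last by rewrite lerXn2r ?nnegrE.
  rewrite [leRHS]exprM lerXn2r ?nnegrE ?mulr_ge0 ?exprn_ge0 //.
  by rewrite (exprD Z 4 2); apply: ler_pM; rewrite ?exprn_ge0 ?lerXn2r ?nnegrE.
have Ei : 0 <= E ^+ t by rewrite exprn_ge0 // ltW.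
have main : lam ^+ t * PK <= E ^+ t * (Z ^+ (X.+1 * (2 * N)) * (Z ^+ ((7 + 6 * e) * N + n * diag) * PK) *
     Z ^+ (X.+2 * diag) * Z ^+ (6 * t ^ 2 + 3 * d ^ n)).
  apply: le_trans aux _; rewrite ler_wpM2l //.
  have cbt : 0 <= ((C ^+ 4 * B ^+ 2) ^+ t * C ^+ (3 * d ^ (n - i0))) ^+ t.
    by rewrite !(exprn_ge0, mulr_ge0) // (le_trans ler01).
  rewrite /rho invrK -exprM; apply: ler_pM CBb => //; first by rewrite !mulr_ge0.
  rewrite ler_wpM2r //; exact: ler_pM.
have main2 : lam ^+ t <= E ^+ t * Z ^+ (X.+1 * (2 * N) + ((7 + 6 * e) * N + n * diag) + X.+2 * diag +
    (6 * t ^ 2 + 3 * d ^ n)).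
  rewrite -(ler_pM2r PK0); apply: le_trans main _.
  have gen (x y z u v s : R) : x * (y * (z * s) * u * v) = x * (y * z * u * v) * s by ring.
  by rewrite gen -!exprD.
have lamt : lam ^+ t = (Z ^+ (3 * t ^ 2))^-1 by rewrite /lam exprVn -exprM -mulnA mulnn.
have zt : 0 < Z ^+ (3 * t ^ 2) by rewrite exprn_gt0.
rewrite lamt -[leLHS]mul1r ler_pdivrMr // -mulrA -exprD in main2.
apply: le_trans main2 _; rewrite ler_wpM2l //; apply: ler_weXn2l => //.
(* All terms are linear in [n * diag] or in [t ^ 2]. The coefficients of [n * diag] are [2 * d + 4],
   [d + 3], [7 + 6 * e], 1 and 3, with a sum below [3 * d + 6 * e + 28]. *)
have dN : (d ^ n <= N)%N by exact: leq_addr.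
have nN : (n * N <= n * diag)%N by rewrite leq_mul2l Ndiag orbT.
have N1 : (N <= n * N)%N by rewrite leq_pmull.
have D1 : (diag <= n * diag)%N by rewrite leq_pmull.
have e1 : (X.+1 * (2 * N) <= (2 * d + 4) * (n * diag))%N.
  have : (X.+1 <= (d + 2) * n)%N by rewrite /X; move: n0; clear; nia.
  move=> h; apply: leq_trans (leq_mul h (leqnn _)) _.
  have -> : ((d + 2) * n * (2 * N) = (2 * d + 4) * (n * N))%N by ring.
  by rewrite leq_mul2l nN orbT.
have e2 : (X.+2 * diag <= (d + 3) * (n * diag))%N.
  by rewrite mulnA leq_mul2r; apply/orP; right; rewrite /X; move: n0; clear; nia.
have e3 : ((7 + 6 * e) * N <= (7 + 6 * e) * (n * diag))%N.
  by rewrite leq_mul2l (leq_trans N1 nN) orbT.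
have e4 : (3 * d ^ n <= 3 * (n * diag))%N.
  by rewrite leq_mul2l /=; apply: leq_trans dN (leq_trans N1 nN).
move: e1 e2 e3 e4; rewrite mulnDr; clear.
move: (d ^ n)%N (X.+1 * _)%N (X.+2 * _)%N (t ^ 2)%N (n * diag)%N => x1 x2 x3 x4 x5.
move: ((7 + 6 * e) * N)%N => x6 h1 h2 h3 h4.
have := leq_add (leq_add h1 h2) (leq_add h3 h4).
nia.
Qed.

End SmallOnDisk.

Lemma lagrange_interpolation (L : fieldType) t (p : 'I_t -> L) (Q : {poly L}) :
  injective p -> (size Q <= t)%N ->
  Q = \sum_u (Q.[p u] / \prod_(v | v != u) (p u - p v)) *: \prod_(v | v != u) ('X - (p v)%:P).
Proof.
move=> pinj sQ; apply/eqP; rewrite -subr_eq0; apply/eqP.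
set S := \sum_u _.
have pr0 u : \prod_(v | v != u) (p u - p v) != 0.
  apply/prodf_neq0 => v uv; rewrite subr_eq0; apply: contra uv => /eqP /pinj ->; exact: eqxx.
have sS : (size S <= t)%N.
  apply: leq_trans (size_sum _ _ _) _; apply/bigmax_leqP => u _.
  apply: leq_trans (size_scale_leq _ _) _.
  have -> : \prod_(v | v != u) ('X - (p v)%:P) = \prod_(x <- [seq p v | v <- enum (predC1 u)]) ('X - x%:P).
    by rewrite big_map big_enum.
  rewrite size_prod_XsubC size_map -cardE cardC1 card_ord.
  by case: (t) u => [[]|].
apply: (@roots_geq_poly_eq0 _ _ (codom p)).
- apply/allP => _ /codomP [u ->].
  suff H : S.[p u] = Q.[p u] by rewrite rootE hornerD hornerN H subrr.
  rewrite horner_sum (bigD1 u) //= [X in _ + X]big1 => [|v vu].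
    rewrite addr0 hornerZ horner_prod.
    have -> : \prod_(v | v != u) ('X - (p v)%:P).[p u] = \prod_(v | v != u) (p u - p v).
      by apply: eq_bigr => v _; rewrite hornerXsubC.
    by rewrite divfK.
  rewrite hornerZ horner_prod [X in _ * X](bigD1 u) /=; last by rewrite eq_sym.
  by rewrite hornerXsubC subrr mul0r mulr0.
- by apply/injectiveP.
rewrite size_codom card_ord; apply: leq_trans (size_polyD _ _) _.
by rewrite size_polyN geq_max sQ sS.
Qed.

(** Lagrange interpolation at separated points: [lam] controls the denominators, and each basis
    polynomial has norm at most [(2 * B) ^+ t] at radius 1. *)
Lemma coef_le_values (R : realType) (L : fieldType) (a : absval R L) t (p : 'I_t -> L)
    (Q : {poly L}) (B E lam : R) j :
  injective p -> (size Q <= t)%N -> 1 <= B -> (forall u, a (p u) <= B) ->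
  0 < lam -> (forall u, lam <= a (\prod_(v | v != u) (p u - p v))) ->
  (forall u, a Q.[p u] <= E) ->
  lam * a Q`_j <= t%:R * (E * (2 * B) ^+ t).
Proof.
move=> pinj sQ B1 pB lam0 lamp QE.
have B0 : 0 <= 2 * B by rewrite mulr_ge0 // (le_trans ler01).
have prodb u : a (\prod_(v | v != u) ('X - (p v)%:P))`_j <= (2 * B) ^+ t.
  have := pnorm_coef a (@ler01 R) (\prod_(v | v != u) ('X - (p v)%:P)) j.
  rewrite expr1n mulr1 => H; apply: le_trans H _; rewrite -(qnorm_polyE a (@ler01 R)).
  apply: le_trans (qn_prod _ _ _ _) _.
  apply: (@le_trans _ _ (\prod_(v | v != u) (2 * B))).
    apply: ler_prod => v _; rewrite qn_ge0 andTb; apply: le_trans (qnD _ _ _) _.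
    rewrite qnN !qnorm_polyE (pnormX a (@ler01 R)) pnormC.
    apply: ler_pM (kap_le2 a) _; rewrite ?(le_trans ler01 (kap_ge1 a)) //.
      by rewrite le_max ler01.
    by rewrite ge_max B1 pB.
  rewrite prodr_const; apply: ler_weXn2l.
    by rewrite -[leLHS]mulr1 ler_pM // ler1n.
  by rewrite -[leqRHS](card_ord t) max_card.
have E0 (u : 'I_t) : 0 <= E by apply: le_trans (QE u); exact: absv_ge0.
rewrite {1}(lagrange_interpolation pinj sQ) coef_sum.
apply: (@le_trans _ _ (lam * \sum_(u < t) (E / lam * (2 * B) ^+ t))); last first.
  rewrite sumr_const card_ord -[_ *+ t]mulr_natl mulrCA ler_wpM2l //.
  by rewrite mulrA [lam * _]mulrC divfK ?gt_eqF.
rewrite ler_pM2l //; apply: le_trans (absv_sum _ _ _ _) _; apply: ler_sum => u _.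
rewrite coefZ absvM; apply: ler_pM; rewrite ?absv_ge0 //.
rewrite absvM absvV; apply: ler_pM; rewrite ?absv_ge0 ?invr_ge0 ?absv_ge0 //.
by rewrite lef_pV2 ?posrE // (lt_le_trans lam0).
Qed.

Section Coefficients.
Variables (R : realType) (k L : fieldType) (g : {rmorphism k -> L}) (b : absval R L).
Variables (F A : mpoly 2 k * mpoly 2 k) (d e : nat) (C : R).
Hypotheses (F1 : F.1 \is ishomog1 d mdeg) (F2 : F.2 \is ishomog1 d mdeg).
Hypotheses (A1 : A.1 \is ishomog1 e mdeg) (A2 : A.2 \is ishomog1 e mdeg).
Hypothesis (d2 : (1 < d)%N).
Hypotheses (hF : form_bounds g b (dehom2 F) d C) (hA : form_bounds g b (dehom2 A) e C).

Lemma coinc_coef_le n j :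
  b (map_poly g (dehom (coinc_form F A n)))`_j <= C ^+ (d ^ n + 2).
Proof.
have C1 := fb_ge1 hF; have C0 : 0 <= C by apply: le_trans C1.
pose X := lineP (hcoord (Some 0 : P1 L)) (tangent (Some 0 : P1 L)).
have X1 : qmax (qnorm_poly b (@ler01 R)) X <= 1.
  rewrite /qmax ge_max /X /lineP /= add0r scale1r scale0r addr0.
  by rewrite (pnormX b (@ler01 R)) pnormC absv1 lexx.
have -> : map_poly g (dehom (coinc_form F A n)) =
    coinc (dehom2 F) (dehom2 A) d e n (polyC \o g) X.
  by rewrite /X (coinc_jet g F1 F2 A1 A2) /jet addr0 comp_polyXr.
have := pnorm_coef b (@ler01 R) (coinc (dehom2 F) (dehom2 A) d e n (polyC \o g) X) j.
rewrite expr1n mulr1 => H; apply: le_trans H _; rewrite -(qnorm_polyE b (@ler01 R)).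
apply: le_trans (qnD _ _ _) _; rewrite qnN.
have Fb : qmax (qnorm_poly b (@ler01 R)) (iter n (fmap (polyC \o g) d (dehom2 F)) X) <= C ^+ (d ^ n).
  apply: le_trans (iter_pub d2 hF n (@ler01 R) X) _.
  by rewrite lerXn2r ?nnegrE ?mulr_ge0 ?qmax_ge0 // -[leRHS]mulr1 ler_wpM2l.
have Ab : qmax (qnorm_poly b (@ler01 R)) (fmap (polyC \o g) e (dehom2 A) X) <= C.
  apply: le_trans (fb_pub hA (@ler01 R) X) _; rewrite -[leRHS]mulr1 ler_wpM2l //.
  by rewrite exprn_ile1 // qmax_ge0.
have step (x y : {poly L}) : qnorm_poly b (@ler01 R) x <= C ^+ (d ^ n) ->
    qnorm_poly b (@ler01 R) y <= C -> qnorm_poly b (@ler01 R) (x * y) <= C ^+ (d ^ n) * C.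
  by move=> hx hy; apply: le_trans (qnM _ _ _) _; apply: ler_pM; rewrite ?qn_ge0.
rewrite addn2 exprS; apply: ler_pM (fb_kap hF) _; rewrite ?(le_trans ler01 (kap_ge1 b)) ?le_max ?qn_ge0 //.
move: Fb Ab; rewrite {1 2}/qmax !ge_max exprSr => /andP[x1 x2] /andP[y1 y2].
by apply/andP; split; apply: step.
Qed.

Variables (G G2 : R) (c pi : L) (Z : R).
Hypotheses (G1 : 1 <= G).
Hypothesis natG : forall m X, (0 < m)%N -> (m <= 2 ^ X)%N -> 1 <= G ^+ X * b m%:R.
Hypothesis roots : forall u t, (0 < u)%N -> (0 < t)%N ->
  exists z : 'I_t -> L, injective z /\ 'X^t - (u%:R)%:P = \prod_l ('X - (z l)%:P) :> {poly L}.
Hypotheses (pi0 : pi != 0).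
Hypotheses (ZC : C <= Z) (ZG : 32 * G <= Z) (ZG2 : G2 <= Z) (Zpi : (b pi)^-1 <= Z).
Hypothesis (ZB : 1 + 2 * b pi + b c <= Z).
Variable n : nat.
Hypotheses (en : (2 * e <= d ^ n)%N) (G21 : 1 <= G2).
Let eta : {poly L} := map_poly g (dehom (coinc_form F A n)).

(** [d ^ n + e + 1] points determine [eta], so smallness on the disk makes all its coefficients
    small, against the lower bound for the [j]-th. The distance from the zeros does not matter here,
    whence the empty list of points to avoid. *)
Lemma trivial_on_disk (E : R) j : 1 <= G2 ^+ (d ^ n) * b eta`_j -> 0 < E ->
  (forall p, b (p - c) <= 2 * b pi ->
     b eta.[p] <= E * qmax (qnorm_absv b) (iter n (fmap g d (dehom2 F)) (p, 1))) ->
  1 <= E * Z ^+ (21 * d ^ n).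
Proof.
move=> etaj E0 small.
have C1 := fb_ge1 hF; have C0 : 0 <= C by apply: le_trans C1.
have Z1 : 1 <= Z by apply: le_trans ZC.
have Z0 : 0 < Z by exact: lt_le_trans Z1.
have zz := ltW Z0.
have Z2 : 2 <= Z by apply: le_trans ZG; move: G1; lra.
have GZ : G <= Z by apply: le_trans ZG; move: G1; lra.
have G0 : 0 <= G by apply: le_trans G1.
have dn0 : (0 < d ^ n)%N by rewrite expn_gt0 (ltnW d2).
pose t := (d ^ n + e).+1.
have t3 : (t <= 3 * d ^ n)%N.
  have : (e <= d ^ n)%N by apply: leq_trans en; rewrite leq_pmull.
  by move: dn0; rewrite /t; move: (d ^ n)%N => M; clear; lia.
have wX : (size ([::] : seq L) < 2 ^ t)%N by rewrite expn_gt0.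
have [p [pinj pc _ lamp]] := separated_points G1 natG roots c pi0 (ltn0Sn _ : 0 < t)%N (leqnn t)
  (ltnW (ltn_expl t (ltnSn 1))) wX ZG Zpi.
pose B := 1 + 2 * b pi + b c.
have B1 : 1 <= B by rewrite /B -addrA lerDl addr_ge0 ?absv_ge0 // mulr_ge0 // absv_ge0.
have B0 : 0 <= B by apply: le_trans B1.
have pB u : b (p u) <= B.
  rewrite -[p u](subrK c); apply: le_trans (absvD _ _ _) _; rewrite lerD2r.
  by apply: le_trans (pc u) _; rewrite lerDr.
pose lam := (Z ^+ (3 * t))^-1.
have lam0 : 0 < lam by rewrite invr_gt0 exprn_gt0.
have szeta : (size eta <= t)%N.
  by rewrite size_map_poly; exact: dehom_size (coinc_form_homog F1 F2 A1 A2 n).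
have val u : b eta.[p u] <= E * Z ^+ (2 * d ^ n).
  apply: le_trans (small _ (pc u)) _; rewrite ler_wpM2l ?(ltW E0) //.
  apply: le_trans (iter_ub d2 hF n _) _; rewrite exprM lerXn2r ?nnegrE ?mulr_ge0 ?qmax_ge0 ?exprn_ge0 //.
  rewrite expr2; apply: ler_pM; rewrite ?qmax_ge0 //; apply: le_trans ZB.
  by rewrite /qmax /= ge_max pB absv1.
have H := coef_le_values j pinj szeta B1 pB lam0 lamp val.
have h1 : lam <= Z ^+ (d ^ n) * (t%:R * (E * Z ^+ (2 * d ^ n) * (2 * B) ^+ t)).
  have h2 : lam <= lam * (G2 ^+ (d ^ n) * b eta`_j) by rewrite ler_peMr // ltW.
  apply: le_trans h2 _; rewrite mulrCA; apply: ler_pM H => //.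
  - by rewrite exprn_ge0 // (le_trans ler01).
  - by rewrite mulr_ge0 ?absv_ge0 // ltW.
  by rewrite lerXn2r ?nnegrE ?(le_trans ler01).
have tZ : t%:R <= Z ^+ t.
  apply: le_trans (_ : (2 ^ t)%N%:R <= _); first by rewrite ler_nat ltnW // ltn_expl.
  by rewrite natrX lerXn2r ?nnegrE.
have BZ : (2 * B) ^+ t <= Z ^+ (2 * t).
  rewrite exprM lerXn2r ?nnegrE ?mulr_ge0 ?exprn_ge0 // expr2.
  by apply: ler_pM.
have h3 : lam <= Z ^+ (d ^ n) * (Z ^+ t * (E * Z ^+ (2 * d ^ n) * Z ^+ (2 * t))).
  apply: le_trans h1 _; rewrite ler_wpM2l ?exprn_ge0 //; apply: ler_pM tZ _ => //.
    by rewrite !(mulr_ge0, exprn_ge0) // ltW.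
  by rewrite ler_wpM2l // mulr_ge0 ?exprn_ge0 // ltW.
rewrite /lam -[leLHS]mul1r ler_pdivrMr ?exprn_gt0 // in h3.
apply: le_trans h3 _.
have gen (x y z u s : R) : x * (y * (E * z * u)) * s = E * (x * y * z * u * s) by ring.
rewrite gen -!exprD ler_wpM2l ?(ltW E0) //; apply: ler_weXn2l => //.
(* [M] is [d ^ n] and [T] the number of points: the exponents add up to [3 * M + 6 * T]. *)
have arith : forall M T, (T <= 3 * M -> M + T + 2 * M + 2 * T + 3 * T <= 21 * M)%N by clear; lia.
exact: arith.
Qed.

End Coefficients.

(** The coefficient is bounded by [C u ^+ (d ^ n + 2)] at all places, so the product formula bounds
    it below at each; [d ^ n + 2 <= 3 * d ^ n] accounts for the cube. *)
Lemma leading_coef_lower (R : realType) (k : fieldType) (PF : product_formula_structure R k)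
  (kbar : closedFieldType) (i : {rmorphism k -> kbar}) (kbar_closure : is_algebraic_closure i)
  (F A : mpoly 2 k * mpoly 2 k) (d e : nat) :
  F.1 \is ishomog1 d mdeg -> F.2 \is ishomog1 d mdeg ->
  A.1 \is ishomog1 e mdeg -> A.2 \is ishomog1 e mdeg ->
  nonvanishing i F -> nonvanishing i A -> (1 < d)%N -> (0 < e)%N ->
  forall C : pf_place PF -> R, (forall u, 1 <= C u) -> finite_set [set u | C u != 1] ->
  (forall u (L : fieldType) (g : {rmorphism k -> L}) (b : absval R L), absv_extends g (pf_abs u) b ->
    form_bounds g b (dehom2 F) d (C u) /\ form_bounds g b (dehom2 A) e (C u)) ->
  exists2 G : R, 1 <= G & forall n, (2 * e <= d ^ n)%N ->
    forall v : pf_place PF, 1 <= G ^+ (d ^ n) * pf_abs v (lead_coef (dehom (coinc_form F A n))).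
Proof.
move=> F1 F2 A1 A2 F0 A0 d2 e0 C C1 Cfin CP.
have [G G1 GP] := product_formula_lower C1 Cfin.
exists (G ^+ 3); first exact: exprn_ege1.
move=> n en v; rewrite -exprM; apply: GP.
  rewrite lead_coef_eq0; apply: (coinc_neq0 F1 F2 A1 A2 F0 A0).
  by apply: leq_trans en; exact: ltn_Pmull.
move=> u.
have idext : absv_extends idfun (pf_abs u) (pf_abs u) by [].
have [hF hA] := CP u k idfun (pf_abs u) idext.
have := coinc_coef_le F1 F2 A1 A2 d2 hF hA n (size (dehom (coinc_form F A n))).-1.
rewrite map_poly_id // => H; apply: le_trans H _; apply: ler_weXn2l => //.
have : (0 < d ^ n)%N by rewrite expn_gt0 (ltnW d2).
by move: (d ^ n)%N => M; clear; lia.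
Qed.

(** * The chordal metric *)

Lemma hpoint_hcoord (K : fieldType) (x y : K) : (x, y) != (0, 0) ->
  exists2 s, s != 0 & hcoord (hpoint x y) = (s * x, s * y).
Proof.
rewrite /hpoint; have [->|y0] := eqVneq y 0 => xy.
  have x0 : x != 0 by apply: contraNneq xy => ->.
  by exists x^-1; rewrite ?invr_eq0 // mulVf ?mulr0.
by exists y^-1; rewrite ?invr_eq0 // mulVf // mulrC.
Qed.

Lemma hpointZ (K : fieldType) (s x y : K) : s != 0 -> hpoint (s * x) (s * y) = hpoint x y.
Proof.
move=> s0; rewrite /hpoint mulf_eq0 (negbTE s0) /=; case: eqP => // _.
by rewrite -mulf_div divff // mul1r.
Qed.

Section Norm2.
Variables (R : realType) (K : fieldType) (a : absval R K).
Notation nrm := (qmax (qnorm_absv a)).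

Lemma qmax_le_norm2 X : nrm X <= norm2 a X.
Proof.
rewrite /norm2 /qmax; case: asboolP => // _; rewrite ge_max /=.
have sq x : Num.sqrt (a x ^+ 2) = a x by rewrite sqrtr_sqr ger0_norm ?absv_ge0.
rewrite -[X in X <= _]sq -[X in _ && (X <= _)]sq.
by rewrite !ler_sqrt ?addr_ge0 ?sqr_ge0 // lerDl lerDr !sqr_ge0.
Qed.

Lemma norm2_le_qmax X : norm2 a X <= 2 * nrm X.
Proof.
have m0 := qmax_ge0 (qnorm_absv a) X.
rewrite /norm2; case: asboolP => _; first by rewrite -[leLHS]mul1r ler_wpM2r // ler1n.
have h1 : a X.1 <= nrm X by rewrite le_max lexx.
have h2 : a X.2 <= nrm X by rewrite le_max lexx orbT.
rewrite -[leRHS]ger0_norm ?mulr_ge0 // -sqrtr_sqr ler_sqrt ?sqr_ge0 //.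
have q1 : a X.1 ^+ 2 <= nrm X ^+ 2 by rewrite lerXn2r ?nnegrE ?absv_ge0.
have q2 : a X.2 ^+ 2 <= nrm X ^+ 2 by rewrite lerXn2r ?nnegrE ?absv_ge0.
rewrite exprMn; have : 0 <= nrm X ^+ 2 by exact: sqr_ge0.
move: q1 q2; rewrite -natrX /=; lra.
Qed.

Lemma norm2Z s (X : K * K) : norm2 a (s * X.1, s * X.2) = a s * norm2 a X.
Proof.
rewrite /norm2 !absvM; case: asboolP => _ /=; first by rewrite maxr_pMr ?absv_ge0.
by rewrite !exprMn -mulrDr sqrtrM ?sqr_ge0 // sqrtr_sqr ger0_norm ?absv_ge0.
Qed.

Lemma norm2_hcoord_ge1 (z : P1 K) : 1 <= norm2 a (hcoord z).
Proof. by apply: le_trans (qmax_le_norm2 _); case: (hcoord_norm a z). Qed.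

Lemma chordal_ge0 z w : 0 <= chordal a z w.
Proof.
by rewrite divr_ge0 ?absv_ge0 // mulr_ge0 // (le_trans ler01 (norm2_hcoord_ge1 _)).
Qed.

(** Any constant serves: it only enters the upper half of the bound on the absolute value of the
    logarithm. *)
Lemma chordal_le2 z w : chordal a z w <= 2.
Proof.
have [h1 h2] := (norm2_hcoord_ge1 z, norm2_hcoord_ge1 w).
rewrite ler_pdivrMr ?mulr_gt0 ?(lt_le_trans ltr01) //.
have bound x y : a x <= norm2 a (hcoord z) -> a y <= norm2 a (hcoord w) ->
    a (x * y) <= norm2 a (hcoord z) * norm2 a (hcoord w).
  by move=> hx hy; rewrite absvM ler_pM ?absv_ge0.
have q (X : K * K) : a X.1 <= norm2 a X /\ a X.2 <= norm2 a X.
  by have := qmax_le_norm2 X; rewrite ge_max => /andP[].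
have [z1 z2] := q (hcoord z); have [w1 w2] := q (hcoord w).
apply: le_trans (absvD _ _ _) _; rewrite absvN.
have := bound _ _ z1 w2; have := bound _ _ z2 w1; lra.
Qed.

Lemma chordal_hpoint (X Y : K * K) : X != (0, 0) -> Y != (0, 0) ->
  chordal a (hpoint X.1 X.2) (hpoint Y.1 Y.2) = a (wedge X Y) / (norm2 a X * norm2 a Y).
Proof.
case: X Y => [x1 x2] [y1 y2] X0 Y0.
have [s s0 sE] := hpoint_hcoord X0; have [u u0 uE] := hpoint_hcoord Y0.
rewrite /chordal sE uE /= (norm2Z s (x1, x2)) (norm2Z u (y1, y2)).
have -> : s * x1 * (u * y2) - s * x2 * (u * y1) = (s * u) * wedge (x1, x2) (y1, y2).
  by rewrite /wedge /=; ring.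
rewrite absvM mulrACA absvM -mulf_div divff ?mul1r // mulf_neq0 //.
  by rewrite gt_eqF ?absv_gt0.
by rewrite gt_eqF ?absv_gt0.
Qed.

Lemma absv_small (eps : R) : absv_nontrivial a -> 0 < eps -> exists2 y, y != 0 & a y <= eps.
Proof.
move=> [x x0 x1] eps0.
wlog xl1 : x x0 x1 / a x < 1.
  move=> H; case: (ltP (a x) 1) => [|h]; first exact: H.
  have {}h : 1 < a x by rewrite lt_neqAle eq_sym x1.
  apply: (H x^-1); rewrite ?invr_eq0 ?absvV ?invr_eq1 //.
  by rewrite invf_lt1 // (lt_trans ltr01).
have ax : 0 < a x by exact: absv_gt0.
have q1 : 1 < (a x)^-1 by rewrite invf_gt1.
have [n Hn] := expr_growth eps^-1 0 q1.
exists (x ^+ n); first exact: expf_neq0.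
rewrite expr0 mulr1 exprVn in Hn.
by rewrite absvX ltW // -[ltLHS]invrK -[ltRHS]invrK ltf_pV2 ?posrE ?invr_gt0 ?exprn_gt0.
Qed.

(* If the center is at infinity, the affine disk is taken around a point of
   large absolute value. *)
Lemma affine_disk_in_chordal (w : P1 K) (r : R) : absv_nontrivial a -> 0 < r ->
  exists c pi : K, pi != 0 /\ forall p, a (p - c) <= 2 * a pi -> chordal a (Some p) w <= r.
Proof.
move=> na r0; case: w => [x|].
  have [y y0 yr] := absv_small na (divr_gt0 r0 (ltr0n R 2)).
  exists x, y; split=> // p px.
  rewrite ler_pdivrMr ?mulr_gt0 ?(lt_le_trans ltr01 (norm2_hcoord_ge1 _)) //=.
  rewrite mulr1 mul1r; apply: le_trans px _; apply: (@le_trans _ _ r).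
    by rewrite mulrC -ler_pdivlMr.
  rewrite ler_peMr ?(ltW r0) // -[leLHS]mulr1.
  by apply: ler_pM => //; [exact: (norm2_hcoord_ge1 (Some p)) | exact: (norm2_hcoord_ge1 (Some x))].
have e0 : 0 < (r^-1 + 2)^-1 by rewrite invr_gt0 addr_gt0 ?invr_gt0.
have [y y0 yr] := absv_small na e0.
exists y^-1, 1; split=> [|p py]; first exact: oner_neq0.
rewrite /chordal /= mulr0 mulr1 sub0r absvN absv1 div1r.
have n10 : norm2 a (1, 0) >= 1 by have := norm2_hcoord_ge1 None.
have np : r^-1 <= norm2 a (p, 1).
  apply: le_trans (qmax_le_norm2 _); rewrite le_max /=; apply/orP; left.
  have ay : r^-1 + 2 <= a y^-1.
    by rewrite absvV -[leLHS]invrK lef_pV2 ?posrE ?absv_gt0.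
  rewrite absv1 mulr1 in py.
  have := absvD a p (y^-1 - p); rewrite addrC subrK (absvB a y^-1) => h.
  by move: py ay h; move: (a p) (a (p - y^-1)) (a y^-1) => *; lra.
rewrite -[leRHS]invrK lef_pV2 ?posrE ?mulr_gt0 ?invr_gt0 ?(lt_le_trans ltr01 n10) //; last first.
  by rewrite (lt_le_trans _ np) ?invr_gt0.
by rewrite -[leLHS]mulr1 ler_pM // invr_ge0 ltW.
Qed.

End Norm2.

Section Dynamics.
Variables (R : realType) (k K : fieldType) (g : {rmorphism k -> K}) (a : absval R K).
Variables (F A : mpoly 2 k * mpoly 2 k) (d e : nat) (C : R).
Hypotheses (F1 : F.1 \is ishomog1 d mdeg) (F2 : F.2 \is ishomog1 d mdeg).
Hypotheses (A1 : A.1 \is ishomog1 e mdeg) (A2 : A.2 \is ishomog1 e mdeg).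
Hypotheses (hF : form_bounds g a (dehom2 F) d C) (hA : form_bounds g a (dehom2 A) e C).
Notation nrm := (qmax (qnorm_absv a)).

Let nrm_neq0 (X : K * K) : 0 < nrm X -> X != (0, 0).
Proof. by apply: contraTneq => ->; rewrite /qmax /= absv0 maxxx ltxx. Qed.

Let nrm_gt0 (X : K * K) : X != (0, 0) -> 0 < nrm X.
Proof.
case: X => x y; apply: contraNT; rewrite lt_max !lt_neqAle !absv_ge0 !andbT negb_or !negbK /=.
by rewrite ![0 == _]eq_sym => /andP[/eqP /absv_eq0 -> /eqP /absv_eq0 ->].
Qed.

Let fmap_neq0 P D X : form_bounds g a P D C -> X != (0, 0) -> fmap g D P X != (0, 0).
Proof.
move=> hP X0; apply: nrm_neq0; rewrite lt_neqAle qmax_ge0 andbT; apply/eqP => h.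
by have := fb_lb hP X; rewrite -h mulr0 leNgt exprn_gt0 ?nrm_gt0.
Qed.

Let iter_neq0 n X : X != (0, 0) -> iter n (fmap g d (dehom2 F)) X != (0, 0).
Proof. by move=> X0; elim: n => //= n IH; apply: fmap_neq0 hF IH. Qed.

Let hcoord_neq0 (z : P1 K) : hcoord z != (0, 0).
Proof. by apply: nrm_neq0; apply: lt_le_trans ltr01 _; case: (hcoord_norm a z). Qed.

Lemma P1_map_hpoint P D X : P.1 \is ishomog1 D mdeg -> P.2 \is ishomog1 D mdeg ->
  X != (0, 0) ->
  P1_map g P (hpoint X.1 X.2) = hpoint (fmap g D (dehom2 P) X).1 (fmap g D (dehom2 P) X).2.
Proof.
case: X => x y H1 H2 X0; have [s s0 sE] := hpoint_hcoord X0.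
rewrite /P1_map sE (bieval_hform g _ _ H1) (bieval_hform g _ _ H2) /=.
by rewrite !(hformZ _ D s (x, y)) hpointZ // expf_neq0.
Qed.

Lemma iter_P1_map n z : iter n (P1_map g F) z =
  hpoint (iter n (fmap g d (dehom2 F)) (hcoord z)).1 (iter n (fmap g d (dehom2 F)) (hcoord z)).2.
Proof.
elim: n => [|n IH].
  by case: z => [x|] /=; rewrite /hpoint ?eqxx // oner_eq0 divr1.
by rewrite iterS IH (P1_map_hpoint F1 F2) // iter_neq0.
Qed.

Lemma chordal_coinc n p :
  chordal a (iter n (P1_map g F) (Some p)) (P1_map g A (Some p)) =
  a (map_poly g (dehom (coinc_form F A n))).[p] /
  (norm2 a (iter n (fmap g d (dehom2 F)) (p, 1)) * norm2 a (fmap g e (dehom2 A) (p, 1))).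
Proof.
have zE : Some p = hpoint p 1 :> P1 K by rewrite /hpoint oner_eq0 divr1.
have AE := P1_map_hpoint (X := (p, 1)) A1 A2 (hcoord_neq0 (Some p)).
rewrite -[hpoint (p, 1).1 (p, 1).2]/(hpoint p 1) -zE in AE.
rewrite iter_P1_map AE.
rewrite chordal_hpoint ?iter_neq0 ?fmap_neq0 ?(hcoord_neq0 (Some p)) //.
by rewrite (coinc_eval g F1 F2 A1 A2).
Qed.

(** Chordal smallness becomes smallness of [H] relative to [F^n]: [A] is bounded on the disk, and
    passing from [norm2] to the maximum norm costs 2 twice. *)
Lemma coinc_eval_le n p (E B : R) : 0 <= E -> nrm (p, 1) <= B ->
  chordal a (iter n (P1_map g F) (Some p)) (P1_map g A (Some p)) <= E ->
  a (map_poly g (dehom (coinc_form F A n))).[p] <=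
    4 * (C * B ^+ e) * E * nrm (iter n (fmap g d (dehom2 F)) (p, 1)).
Proof.
move=> E0 pB; rewrite chordal_coinc.
have h0 := hcoord_neq0 (Some p).
have q (X : K * K) : X != (0, 0) -> 0 < norm2 a X.
  by move=> X0; apply: lt_le_trans (qmax_le_norm2 a X); exact: nrm_gt0.
rewrite ler_pdivrMr ?mulr_gt0 ?q ?iter_neq0 ?fmap_neq0 // => h; apply: le_trans h _.
have n0 X : 0 <= norm2 a X by apply: le_trans (qmax_le_norm2 a X); exact: qmax_ge0.
have C0 : 0 <= C by apply: le_trans (fb_ge1 hF).
have B0 : 0 <= B by apply: le_trans pB; exact: qmax_ge0.
have AB : norm2 a (fmap g e (dehom2 A) (p, 1)) <= 2 * (C * B ^+ e).
  apply: le_trans (norm2_le_qmax a _) _; rewrite ler_wpM2l //.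
  apply: le_trans (fb_ub hA _) _; rewrite ler_wpM2l // lerXn2r ?nnegrE ?qmax_ge0 //.
have := ler_pM (n0 _) (n0 _) (norm2_le_qmax a (iter n (fmap g d (dehom2 F)) (p, 1))) AB.
move=> /(ler_wpM2l E0) h; apply: le_trans h _.
by rewrite le_eqVlt; apply/orP; left; apply/eqP; ring.
Qed.

End Dynamics.

(** * Transfer to the completion, choice of scale and conclusion *)

Lemma roots_of_nat (K : closedFieldType) u t : [pchar K] =i pred0 -> (0 < u)%N -> (0 < t)%N ->
  exists z : 'I_t -> K, injective z /\ 'X^t - (u%:R)%:P = \prod_l ('X - (z l)%:P) :> {poly K}.
Proof.
move=> ch u0 t0.
have nat0 m : (0 < m)%N -> m%:R != 0 :> K by move=> m0; rewrite ((pcharf0P K).1 ch) -lt0n.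
have [rs rsE] := closed_field_poly_normal ('X^t - (u%:R)%:P : {poly K}).
rewrite lead_coefXnsubC // scale1r in rsE.
have sz : size rs = t.
  by have := congr1 (fun p : {poly K} => (size p).-1) rsE; rewrite size_XnsubC // size_prod_XsubC.
have us : uniq rs.
  rewrite -separable_prod_XsubC -rsE unlock.
  apply/Pdiv.ClosedField.coprimepP => z /rootP; rewrite hornerD hornerN hornerXn hornerC => h.
  rewrite derivB derivC subr0 derivXn hornerMn hornerXn -mulr_natr mulf_neq0 ?nat0 //.
  apply/negP => /eqP h2; move: h.
  rewrite -(prednK t0) exprS h2 mulr0 sub0r => /eqP; rewrite oppr_eq0.
  by apply/negP; exact: nat0.
exists (fun l => rs`_l); split.
  by move=> l v /eqP; rewrite nth_uniq ?sz // => /eqP /val_inj.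
by rewrite rsE (big_nth 0) big_mkord sz.
Qed.

Section Transfer.
Variables (k K L : fieldType) (i : {rmorphism k -> K}) (phi : {rmorphism K -> L}).

Lemma map_jet D (z : option K) (Q : {poly K}) :
  jet D (omap phi z) (map_poly phi Q) = map_poly phi (jet D z Q).
Proof.
case: z => [x|]; last by rewrite /jet /= map_revp.
by rewrite /jet /= map_comp_poly rmorphD /= map_polyX map_polyC.
Qed.

Lemma map_fmap d P (X : K * K) :
  fmap (phi \o i) d P (phi X.1, phi X.2) = (phi (fmap i d P X).1, phi (fmap i d P X).2).
Proof.
rewrite /fmap /hform /= !rmorph_sum.
by congr pair; apply: eq_bigr => j _; rewrite !rmorphM !rmorphXn.
Qed.

Lemma map_iter_fmap n d P (X : K * K) :
  iter n (fmap (phi \o i) d P) (phi X.1, phi X.2) =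
  (phi (iter n (fmap i d P) X).1, phi (iter n (fmap i d P) X).2).
Proof. by elim: n => [|n IH] //; rewrite !iterS IH map_fmap. Qed.

Lemma map_hcoord (z : P1 K) : hcoord (omap phi z : P1 L) = (phi (hcoord z).1, phi (hcoord z).2).
Proof. by case: z => [x|] /=; rewrite rmorph1 ?rmorph0. Qed.

End Transfer.

(** The upper half of the bound is [ln 2 <= l]. For the lower half [E] is the supremum itself; were
    it 0, [E = expR (- l - 1)] would contradict the hypothesis. *)
Lemma abs_lne_sup_le (R : realType) (T : Type) (D : set T) (f : T -> R) (l : R) :
  D !=set0 -> (forall z, 0 <= f z <= 2) -> ln 2 <= l ->
  (forall E, 0 < E -> (forall z, D z -> f z <= E) -> - l <= ln E) ->
  (`| lne (ereal_sup [set (f z)%:E | z in D]) | <= l%:E)%E.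
Proof.
move=> [z0 z0D] f02 l2 low; set s := ereal_sup _.
have s2 : (s <= 2%:E)%E.
  by apply: ge_ereal_sup => _ [z _ <-]; rewrite lee_fin; case/andP: (f02 z).
have fs z : D z -> ((f z)%:E <= s)%E by move=> zD; apply: ereal_sup_ubound; exists z.
have s0 : (0%:E <= s)%E.
  by apply: le_trans (fs _ z0D); rewrite lee_fin; case/andP: (f02 z0).
clearbody s; case: s s2 fs s0 => [x| |] //; rewrite lee_fin => x2 fs; rewrite lee_fin => x0.
have fx z : D z -> f z <= x by move=> zD; have := fs z zD; rewrite lee_fin.
have xpos : 0 < x.
  rewrite lt_neqAle x0 andbT; apply/eqP => xE.
  have := low (expR (- l - 1)) (expR_gt0 _) (fun z zD => le_trans (fx z zD) _).
  rewrite expRK -xE => H; have := H (expR_ge0 _); lra.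
rewrite lne_EFin // abse_EFin lee_fin ler_norml low //=.
by apply: le_trans l2; rewrite ler_ln ?posrE.
Qed.

Section Scales.
Variables (d n : nat).
Hypotheses (d2 : (1 < d)%N) (n0 : (0 < n)%N).

(** [i0] is the integer part of the logarithm of [s] to the base [d ^ 2]. It satisfies
    [d.+1 * n <= d ^ i0] because [s >= n * d ^ n] and [d ^ n] is large compared with [n]. *)
Lemma scale_exists s : (n * d ^ n <= s)%N -> (d ^ 2 * d.+1 ^ 2 * n <= d ^ n)%N ->
  (s < d ^ (2 * n))%N ->
  exists i0, [/\ (i0 <= n)%N, (d.+1 * n <= d ^ i0)%N & ((d ^ i0) ^ 2 <= s < d ^ 2 * (d ^ i0) ^ 2)%N].
Proof.
move=> sn big sd.
have dn0 : (0 < d ^ n)%N by rewrite expn_gt0 (ltnW d2).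
have s0 : (0 < s)%N by apply: leq_trans sn; rewrite muln_gt0 n0.
have D2 : (1 < d ^ 2)%N by rewrite -[1%N](exp1n 2) ltn_exp2r.
have /andP[h1 h2] := trunc_log_bounds D2 s0.
set i0 := trunc_log _ _ in h1 h2.
have E : ((d ^ i0) ^ 2 = (d ^ 2) ^ i0)%N by rewrite -!expnM mulnC.
exists i0; rewrite E; split.
- apply: ltnW; rewrite -(ltn_exp2l _ _ D2).
  by apply: leq_ltn_trans h1 _; rewrite -expnM.
- rewrite -(@leq_exp2r _ _ 2) // E -(@leq_pmul2l (d ^ 2)) ?(ltnW D2) //.
  rewrite -expnS; apply: ltnW; apply: leq_ltn_trans _ h2; apply: leq_trans _ sn.
  rewrite expnMn mulnA (_ : (n ^ 2 = n * n)%N) // mulnA [leqRHS]mulnC leq_mul2r.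
  by rewrite big orbT.
by rewrite h1 /= -expnS.
Qed.

End Scales.

(** Splitting [2 ^ n] into two powers with exponent about [n / 2] shows that it grows at least
    quadratically. *)
Lemma eventually_linear_le_exp d c : (1 < d)%N ->
  exists n0, forall n, (n0 <= n)%N -> (c * n <= d ^ n)%N.
Proof.
move=> d2; exists (4 * c)%N => n cn.
apply: (@leq_trans (2 ^ n)); last by case: n cn => // n _; rewrite leq_exp2r.
set h := n./2; have nh : (n <= 2 * h + 1)%N.
  by rewrite -{1}(odd_double_half n) -/h -mul2n addnC leq_add2l; case: odd.
have hn : (2 * h <= n)%N by rewrite -[leqRHS](odd_double_half n) -/h -mul2n leq_addl.
have h2 : (h.+1 * h.+1 <= 2 ^ n)%N.
  apply: leq_trans (_ : 2 ^ h * 2 ^ h <= _)%N; first by apply: leq_mul; exact: ltn_expl.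
  by rewrite -expnD addnn -mul2n leq_exp2l.
apply: leq_trans h2; clear hn; clearbody h; nia.
Qed.

(** If [s >= d ^ (2 * n)], the elementary bound of exponent [O(d ^ n)] suffices. Otherwise
    [t = d ^ i0], with [t ^ 2] and [s] equal up to a factor [d ^ 2], makes the exponent [O(t ^ 2)],
    and a [t]-th root leaves [O(t)]. *)
Lemma scale_bound (R : realType) (d n s kappa : nat) (E Z : R) : (1 < d)%N -> (0 < n)%N ->
  (n * d ^ n <= s)%N -> (d ^ 2 * d.+1 ^ 2 * n <= d ^ n)%N -> 0 < E -> 1 <= Z ->
  (forall i0, (i0 <= n)%N -> (d.+1 * n <= d ^ i0)%N ->
     1 <= E ^+ (d ^ i0) * Z ^+ (kappa * (s + (d ^ i0) ^ 2))) ->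
  1 <= E * Z ^+ (21 * d ^ n) ->
  exists2 x, (x ^ 2 <= s)%N & 1 <= E * Z ^+ ((kappa * (2 * d ^ 2) + 21) * x).
Proof.
move=> d2 n0 sn big E0 Z1 mid triv.
case: (leqP (d ^ (2 * n)) s) => hs.
  exists (d ^ n)%N; first by rewrite -expnM mulnC.
  apply: le_trans triv _; rewrite ler_wpM2l ?(ltW E0) //; apply: ler_weXn2l => //.
  by rewrite leq_mul2r leq_addl orbT.
have [i0 [i0n di0 /andP[t1 t2]]] := scale_exists d2 n0 sn big hs.
set t := (d ^ i0)%N in di0 t1 t2; exists t => //.
have t0 : (0 < t)%N by rewrite expn_gt0 (ltnW d2).
have Z0 : 0 < Z by exact: lt_le_trans Z1.
have h : 1 <= (E * Z ^+ ((kappa * (2 * d ^ 2) + 21) * t)) ^+ t.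
  apply: le_trans (mid i0 i0n di0) _; rewrite -/t exprMn ler_wpM2l ?exprn_ge0 ?(ltW E0) //.
  rewrite -exprM; apply: ler_weXn2l => //.
  have d21 : (1 <= d ^ 2)%N by rewrite expn_gt0 (ltnW d2).
  rewrite -mulnA mulnDl; apply: leq_trans (leq_addr _ _).
  rewrite -mulnA leq_mul2l; apply/orP; right; rewrite mulnn.
  rewrite -mulnA mul2n -addnn; apply: leq_add; first exact: ltnW.
  by rewrite leq_pmull.
rewrite leNgt; apply/negP => h2; move: h; rewrite leNgt expr_lt1 ?h2 //.
by rewrite mulr_ge0 ?exprn_ge0 // ltW.
Qed.

Lemma coincidence_lower_bound (R : realType) (k : fieldType) (k_char0 : [pchar k] =i pred0)
  (PF : product_formula_structure R k) (kbar : closedFieldType) (i : {rmorphism k -> kbar})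
  (kbar_closure : is_algebraic_closure i) (F A : mpoly 2 k * mpoly 2 k) (d e : nat) :
  F.1 \is ishomog1 d mdeg -> F.2 \is ishomog1 d mdeg ->
  A.1 \is ishomog1 e mdeg -> A.2 \is ishomog1 e mdeg ->
  nonvanishing i F -> nonvanishing i A -> (1 < d)%N -> (0 < e)%N ->
  forall (v : pf_place PF) (K : fieldType) (phi : {rmorphism kbar -> K}) (a : absval R K),
  absv_extends (phi \o i) (pf_abs v) a ->
  (forall u t, (0 < u)%N -> (0 < t)%N ->
    exists z : 'I_t -> K, injective z /\ 'X^t - (u%:R)%:P = \prod_l ('X - (z l)%:P) :> {poly K}) ->
  forall c pi : K, pi != 0 ->
  exists M : R, exists n0 : nat, forall n, (n0 <= n)%N ->
    let s := (n * diag_mass (coincidence_divisor i F A n))%N in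
    ln 2 <= M * Num.sqrt s%:R /\
    forall E, 0 < E ->
    (forall p, a (p - c) <= 2 * a pi ->
      chordal a (iter n (P1_map (phi \o i) F) (Some p)) (P1_map (phi \o i) A (Some p)) <= E) ->
    - (M * Num.sqrt s%:R) <= ln E.
Proof.
move=> F1 F2 A1 A2 F0 A0 d2 e0 v K phi a ext roots c pi pi0.
pose g : {rmorphism k -> K} := phi \o i.
have [Cu [C1 Cfin CP]] := adelic_bounds k_char0 PF F1 F2 A1 A2 F0 A0 d2 e0.
have [Gl Gl1 leadP] := leading_global kbar_closure F1 F2 A1 A2 F0 A0 d2 e0 C1 Cfin CP.
have [G2 G21 coefP] := leading_coef_lower kbar_closure F1 F2 A1 A2 F0 A0 d2 e0 C1 Cfin CP.
have [G G1 natP] := absv_nat_lower k_char0 v.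
have [hF hA] := CP v K g a ext.
have natG m X : (0 < m)%N -> (m <= 2 ^ X)%N -> 1 <= G ^+ X * a m%:R.
  by move=> m0 mX; rewrite -(rmorph_nat g) ext; exact: natP.
have api : 0 < a pi by exact: absv_gt0.
have c0 := absv_ge0 a c.
have Cv1 := C1 v.
have ipi : 0 < (a pi)^-1 by rewrite invr_gt0.
pose B := 1 + 2 * a pi + a c.
pose Z := Cu v + 32 * G + Gl + G2 + (a pi)^-1 + B.
have ZC : Cu v <= Z by move: G1 Gl1 G21 c0 ipi api; rewrite /Z /B; lra.
have ZG : 32 * G <= Z by move: Cv1 Gl1 G21 c0 ipi api; rewrite /Z /B; lra.
have ZGl : Gl <= Z by move: Cv1 G1 G21 c0 ipi api; rewrite /Z /B; lra.
have ZG2 : G2 <= Z by move: Cv1 G1 Gl1 c0 ipi api; rewrite /Z /B; lra.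
have Zpi : (a pi)^-1 <= Z by move: Cv1 G1 Gl1 G21 c0 api; rewrite /Z /B; lra.
have ZB : B <= Z by move: Cv1 G1 Gl1 G21 ipi; rewrite /Z; lra.
have Z1 : 1 <= Z by apply: le_trans ZC.
have Z0 : 0 < Z by exact: lt_le_trans Z1.
have B1 : 1 <= B by move: c0 api; rewrite /B; lra.
pose H := 4 * (Cu v * B ^+ e).
have H1 : 1 <= H.
  have h : 1 <= Cu v * B ^+ e by rewrite -[leLHS]mulr1 ler_pM // exprn_ege1.
  by rewrite /H; lra.
have H0 : 0 < H by exact: lt_le_trans H1.
pose kappa := (3 * d + 6 * e + 28)%N.
pose kp := (kappa * (2 * d ^ 2) + 21)%N.
(* One threshold for two conditions: the first summand serves the choice of scale, the second gives
   [2 * e <= d ^ n]. *)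
have [n1 n1P] := eventually_linear_le_exp (d ^ 2 * d.+1 ^ 2 + 2 * e) d2.
(* [ln 2] takes care of the upper bound; the rest is the logarithm of the conclusion of
   [scale_bound], with [ln H] multiplied by [Num.sqrt s%:R >= 1]. *)
exists (ln 2 + (ln H + ln Z *+ kp)), (maxn 1 n1) => n; rewrite geq_max => /andP[n0 n1n].
have big : (d ^ 2 * d.+1 ^ 2 * n <= d ^ n)%N.
  by apply: leq_trans (n1P n n1n); rewrite leq_mul2r leq_addr orbT.
have en : (2 * e <= d ^ n)%N.
  apply: leq_trans (n1P n n1n); apply: leq_trans (leq_pmulr _ n0) _.
  by rewrite leq_mul2r leq_addl orbT.
have [r [w [m [th [rN [[winj etaE lc0 mN dE] [thP lead]]]]]]] := leadP n n0 en.
set diag := diag_mass _ in dE lead *; cbv zeta; set s := (n * diag)%N.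
have Ndiag : (d ^ n <= diag)%N.
  apply: leq_trans (leq_addr e _) _; rewrite -mN dE; apply: leq_sum => o _.
  by rewrite -mulnn; case: (m o) => // x; rewrite leq_pmulr.
have sn : (n * d ^ n <= s)%N by rewrite leq_mul2l Ndiag orbT.
have s1 : (0 < s)%N by apply: leq_trans sn; rewrite muln_gt0 n0 expn_gt0 (ltnW d2).
have sq1 : 1 <= Num.sqrt (s%:R : R) by rewrite -[leLHS]sqrtr1 ler_sqrt ?ler1n.
have lnZ := ln_ge0 Z1; have lnH := ln_ge0 H1.
have ln2 : 0 <= ln 2 :> R by apply: ln_ge0; rewrite ler1n.
have lnZk : 0 <= ln Z *+ kp by exact: mulrn_wge0.
split.
  apply: (@le_trans _ _ (ln 2 * 1)); first by rewrite mulr1.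
  by apply: ler_pM => //; rewrite lerDl addr_ge0.
move=> E E0 small.
have small' p : a (p - c) <= 2 * a pi ->
    a (map_poly g (dehom (coinc_form F A n))).[p] <=
      H * E * qmax (qnorm_absv a) (iter n (fmap g d (dehom2 F)) (p, 1)).
  move=> pc; apply: (@coinc_eval_le _ _ _ g a F A d e (Cu v) F1 F2 A1 A2 hF hA n p E B);
    [exact: ltW | | exact: small].
  rewrite /qmax /= ge_max absv1 B1 andbT -[p](subrK c).
  apply: le_trans (absvD _ _ _) _; rewrite lerD2r; apply: le_trans pc _.
  by rewrite lerDr.
have HE0 : 0 < H * E by exact: mulr_gt0.
pose w' o := phi (w o).
have ptE o : omap w' o = omap phi (omap w o) by case: o.
have gE : map_poly g (dehom (coinc_form F A n)) =
    map_poly phi (map_poly i (dehom (coinc_form F A n))).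
  by rewrite -map_poly_comp.
have mid i0 : (i0 <= n)%N -> (d.+1 * n <= d ^ i0)%N ->
    1 <= (H * E) ^+ (d ^ i0) * Z ^+ (kappa * (s + (d ^ i0) ^ 2)).
  move=> i0n di0; rewrite /s dE.
  apply: (@small_on_disk _ _ _ g a F A d e (Cu v) G Gl c pi Z F1 F2 A1 A2 d2 hF hA G1 natG roots pi0
    Gl1 ZC ZG ZGl Zpi ZB n n0 en r w' m (phi (lead_coef (map_poly i (dehom (coinc_form F A n)))))
    (fun o => phi (th o)) rN _ _ _ mN _ _ _ i0 (H * E)) => //.
  - by move=> o o' /fmorph_inj /winj.
  - by rewrite fmorph_eq0.
  - rewrite gE {1}etaE map_polyZ rmorph_prod; congr (_ *: _); apply: eq_bigr => o _.
    by rewrite rmorphXn rmorphB /= map_polyX map_polyC.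
  - move=> o mo; rewrite ptE gE map_jet coef_map fmorph_eq0.
    by case: (thP o mo).
  - move=> o mo; rewrite ptE map_hcoord map_iter_fmap map_fmap.
    by case: (thP o mo) => _ -> /=; rewrite !rmorphM.
  have := lead v K phi a ext; rewrite dE gE.
  set P1 := \prod_o _; set P2 := \prod_o _ => lead'.
  suff -> : \prod_o a (jet (d ^ n + e) (omap w' o)
     (map_poly phi (map_poly i (dehom (coinc_form F A n)))))`_(m o) ^+ m o = P2 by [].
  by apply: eq_bigr => o _; rewrite ptE map_jet coef_map.
have triv : 1 <= H * E * Z ^+ (21 * d ^ n).
  apply: (trivial_on_disk (j := (size (dehom (coinc_form F A n))).-1) F1 F2 A1 A2 d2 hF G1
    natG roots pi0 ZC ZG ZG2 Zpi ZB en G21 _ HE0 small').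
  by rewrite coef_map ext; exact: coefP.
have [x xs Ex] := scale_bound d2 n0 sn big HE0 Z1 mid triv.
have xq : x%:R <= Num.sqrt (s%:R : R).
  by rewrite -[leLHS]ger0_norm // -sqrtr_sqr ler_sqrt // -natrX ler_nat.
have := ln_ge0 Ex; rewrite lnM ?posrE ?exprn_gt0 // lnM ?posrE // lnXn //.
rewrite -/kp mulrnA -[(ln Z *+ kp) *+ x]mulr_natr => key.
have m1 : (ln Z *+ kp) * x%:R <= (ln Z *+ kp) * Num.sqrt s%:R by rewrite ler_wpM2l.
have m2 : ln H <= ln H * Num.sqrt s%:R by rewrite ler_peMr.
have m3 : 0 <= ln 2 * Num.sqrt (s%:R : R) by rewrite mulr_ge0 // (le_trans ler01).
rewrite !mulrDl; move: key m1 m2 m3; lra.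
Qed.

Theorem theorem5 (R : realType) (k : fieldType)
  (k_char0 : [pchar k] =i pred0)
  (PF : product_formula_structure R k)
  (kbar : closedFieldType) (i : {rmorphism k -> kbar})
  (kbar_closure : is_algebraic_closure i)
  (f a : {fraction {poly k}})
  (f_degree : (1 < ratfun_degree f)%N) (a_degree : (0 < ratfun_degree a)%N)
  (F A : mpoly 2 k * mpoly 2 k)
  (F_lift : is_lift i f F) (A_lift : is_lift i a A)
  (v : pf_place PF) (C : Cv_structure i (pf_abs v))
  (w : P1 C) (r : R) (r_gt0 : 0 < r) :
  exists M : R, \forall n \near \oo,
    (`| lne (ereal_sup
          [set (chordal (Cv_abs C)
                  (iter n (P1_map (Cv_embed C \o i) F) z)
                  (P1_map (Cv_embed C \o i) A z))%:E
          | z in chordal_disk (Cv_abs C) w r]) |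
     <= (M * Num.sqrt
          (n%:R * (diag_mass (coincidence_divisor i F A n))%:R))%:E)%E.
Proof.
have [F1 F2 F0 _] := F_lift; have [A1 A2 A0 _] := A_lift.
have ext : absv_extends (Cv_embed C \o i) (pf_abs v) (Cv_abs C).
  move=> x /=; rewrite Cv_embed_compat; have [-> _ _] := Cv_completion C.
  by rewrite kvbar_extends; have [-> _ _] := kv_completion C.
have bar0 : [pchar (kvbar C)] =i pred0.
  apply/pcharf0P => n.
  rewrite -(rmorph_nat (kvbar_in C)) -(rmorph_nat (kv_in C)) !fmorph_eq0.
  exact: ((pcharf0P k).1 k_char0).
(* [Cv] is only given as a field, so the roots are found in the algebraically closed [kvbar] and
   mapped into it. *)
have roots u t : (0 < u)%N -> (0 < t)%N -> exists z : 'I_t -> C,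
    injective z /\ 'X^t - (u%:R)%:P = \prod_l ('X - (z l)%:P) :> {poly C}.
  move=> u0 t0; have [z [zinj zE]] := roots_of_nat bar0 u0 t0.
  exists (fun l => Cv_in C (z l)); split; first by move=> l l' /fmorph_inj /zinj.
  have := congr1 (map_poly (Cv_in C)) zE.
  rewrite rmorphB /= map_polyXn map_polyC /= rmorph_nat rmorph_prod => ->.
  by apply: eq_bigr => l _; rewrite rmorphB /= map_polyX map_polyC.
have na : absv_nontrivial (Cv_abs C).
  have [x x0 x1] := pf_nontrivial v; exists (Cv_embed C (i x)); first by rewrite !fmorph_eq0.
  by have := ext x => /= ->.
(* For a lower bound on the supremum a smaller affine disk inside the chordal one is enough. *)
have [c [pi [pi0 disk]]] := affine_disk_in_chordal w na r_gt0.
have [M [n0 HM]] := coincidence_lower_bound k_char0 kbar_closure F1 F2 A1 A2 F0 A0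
  f_degree a_degree ext roots c pi0.
exists M, n0 => // n /= n0n; have [h1 h2] := HM n n0n.
rewrite -natrM; apply: abs_lne_sup_le => //.
- exists (Some c); apply: disk; rewrite subrr absv0 mulr_ge0 ?absv_ge0 //.
- by move=> z; rewrite chordal_ge0 chordal_le2.
move=> E E0 small; apply: h2 => // p pc; apply: small; exact: disk.
Qed.
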